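(* Let $R$ be a ring, let $(P,Q,\psi)$ be an $R$-system satisfying condition (FS), and let $J$ be a faithful $\psi$-compatible ideal in $R$. Then the following five conditions are equivalent: (1) The ring $\mathcal{O}_{(P,Q,\psi)}(J)$ is simple. (2) The subring $\sigma(R)$ of $\mathcal{O}_{(P,Q,\psi)}(J)$ has the ideal intersection property and $J$ is a super maximal $\psi$-compatible ideal. (3) The subring $\mathcal{O}_{(P,Q,\psi)}(J)^{(0)}$ has the ideal intersection property and $J$ is a super maximal $\psi$-compatible ideal. (4) The ideal $J$ satisfies condition (L) with respect to $(P,Q,\psi)$ and is a super maximal $\psi$-compatible ideal. (5) If $(S',T',\sigma',B)$ is a non-zero covariant representation of $(P,Q,\psi)$ which is Cuntz-Pimsner invariant relative to $J$, then the ring homomorphism $\eta^J_{(S',T',\sigma',B)}:\mathcal{O}_{(P,Q,\psi)}(J)\to B$ is injective.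
   Context: Conventions. Rings are associative, not necessarily commutative or unital. ''Ideal'' means two-sided ideal. A ring is called simple if it has no ideals other than $\{0\}$ and itself. ''span'' means additive span. $\mathbb{N}=\{1,2,\dots\}$. $R$-systems. An $R$-system is a triple $(P,Q,\psi)$ with $P,Q$ $R$-bimodules and $\psi:P\otimes_R Q\to R$ an $R$-bimodule homomorphism. For $p\in P$, $q\in Q$ let $\theta_{q,p}:Q\to Q$, $\theta_{q,p}(x)=q\psi(p\otimes x)$, and $\theta_{p,q}:P\to P$, $\theta_{p,q}(y)=\psi(y\otimes q)p$. Let $\mathcal{F}_P(Q)=\mathrm{span}\{\theta_{q,p}\}$ and $\mathcal{F}_Q(P)=\mathrm{span}\{\theta_{p,q}\}$. Condition (FS): for all finite subsets $\{q_1,\dots,q_n\}\subseteq Q$ and $\{p_1,\dots,p_m\}\subseteq P$ there are $\Theta\in\mathcal{F}_P(Q)$ and $\Theta'\in\mathcal{F}_Q(P)$ with $\Theta q_i=q_i$ and $\Theta' p_j=p_j$ for all $i,j$. Tensor powers $P^{\otimes n},Q^{\otimes n}$ are over $R$. Covariant representations. A covariant representation of $(P,Q,\psi)$ is $(S,T,\sigma,B)$ with $B$ a ring, $S:P\to B$, $T:Q\to B$ additive, $\sigma:R\to B$ a ring homomorphism, such that $S(pr)=S(p)\sigma(r)$, $S(rp)=\sigma(r)S(p)$, $T(qr)=T(q)\sigma(r)$, $T(rq)=\sigma(r)T(q)$ and $\sigma(\psi(p\otimes q))=S(p)T(q)$. It is injective if $\sigma$ is injective, and non-zero if $S,T,\sigma$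 are not all zero. Put $S^n(p_1\otimes\cdots\otimes p_n)=S(p_1)\cdots S(p_n)$ and $T^n(q_1\otimes\cdots\otimes q_n)=T(q_1)\cdots T(q_n)$. Under (FS) there is a well-defined ring homomorphism $\pi_{T,S}:\mathcal{F}_P(Q)\to B$ with $\pi_{T,S}(\theta_{q,p})=T(q)S(p)$. Relative Cuntz-Pimsner rings. For $r\in R$ let $\Delta(r):Q\to Q$, $\Delta(r)q=rq$. An ideal $J$ of $R$ is $\psi$-compatible if $\Delta(J)\subseteq\mathcal{F}_P(Q)$, and faithful if also $J\cap\ker\Delta=\{0\}$. A covariant representation $(S,T,\sigma,B)$ is Cuntz-Pimsner invariant relative to $J$ if $\pi_{T,S}(\Delta(x))=\sigma(x)$ for all $x\in J$. For $J$ faithful and $\psi$-compatible, $\mathcal{O}_{(P,Q,\psi)}(J)$ with $(S,T,\sigma)$ denotes the universal covariant representation that is Cuntz-Pimsner invariant relative to $J$: it is injective, the ring $\mathcal{O}_{(P,Q,\psi)}(J)$ is generated by $\sigma(R)\cup S(P)\cup T(Q)$, and for every covariant representation $(S',T',\sigma',B)$ Cuntz-Pimsner invariant relative to $J$ there is a unique ring homomorphism $\eta^J_{(S',T',\sigma',B)}:\mathcal{O}_{(P,Q,\psi)}(J)\to B$ with $\eta\circ S=S'$, $\eta\circ T=T'$, $\eta\circ\sigma=\sigma'$. $\mathcal{O}_{(P,Q,\psi)}(J)^{(0)}$ is the subring spanned by $\sigma(R)$ and all $T^k(q)S^k(p)$, $k\in\mathbb{N}$, $q\in Q^{\otimes k}$,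 $p\in P^{\otimes k}$. A subring $A$ of $\mathcal{O}_{(P,Q,\psi)}(J)$ has the ideal intersection property if for every ideal $K$ of $\mathcal{O}_{(P,Q,\psi)}(J)$, $K\cap A=\{0\}$ implies $K=\{0\}$. $T$-pairs. An ideal $I$ of $R$ is $\psi$-invariant if $\psi(px\otimes q)\in I$ for all $p\in P$, $x\in I$, $q\in Q$. For such $I$ put $R_I=R/I$, $Q_I=Q/QI$, ${}_IP=P/IP$ (where $QI=\mathrm{span}\{qx\}$, $IP=\mathrm{span}\{xp\}$, $x\in I$), with quotient maps all denoted $\wp_I$; then $({}_IP,Q_I,\psi_I)$ with $\psi_I(\wp_I(p)\otimes\wp_I(q))=\wp_I(\psi(p\otimes q))$ is an $R_I$-system satisfying (FS). A $T$-pair of $(P,Q,\psi)$ is a pair $(I,J')$ of ideals of $R$ with $I\subseteq J'$, $I$ $\psi$-invariant, and $\wp_I(J')$ a faithful $\psi_I$-compatible ideal of $R_I$. $J$ is a super maximal $\psi$-compatible ideal if the only $T$-pairs $(I,J')$ of $(P,Q,\psi)$ with $J\subseteq J'$ are $(0,J)$ and $(R,R)$. Condition (L). For $p\in P$, $S_p:Q^{\otimes n+1}\to Q^{\otimes n}$ is the right $R$-module homomorphism with $S_p(q\otimes q_n)=\psi(p\otimes q)q_n$ ($q\in Q$, $q_n\in Q^{\otimes n}$); for $q_n\in Q^{\otimes n}$, $T_{q_n}:Q\to Q^{\otimes n+1}$ is $T_{q_n}(q)=q_n\otimes q$. A $\psi$-invariant ideal $I$ is a $\psi$-invariant cycle if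 there are $n\in\mathbb{N}$ and an injective $R$-bimodule homomorphism $\eta:I\to Q^{\otimes n}$ with $S_pT_{\eta(x)}(q)=\eta(\psi(px\otimes q))$ for all $p\in P$, $x\in I$, $q\in Q$. For an ideal $I$ put $\psi^{-1}(I)=\{x\in R\mid\psi(px\otimes q)\in I\ \forall p\in P,q\in Q\}$, $I^{[1]}=I$, $I^{[k]}=\psi^{-1}(I^{[k-1]})\cap I$ for $k>1$, and $I^{[\infty]}=\bigcap_{k\ge1}I^{[k]}$. The ideal $J$ satisfies condition (L) with respect to $(P,Q,\psi)$ if there is no non-zero $\psi$-invariant cycle $I$ in $R$ with $I\subseteq J^{[\infty]}$. *)

(* Defs.v *)
From HB Require Import structures.
From mathcomp Require Import all_boot all_algebra generic_quotient.
From mathcomp Require Import boolp classical_sets functions.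
From mathcomp Require Import freeg.
Set Implicit Arguments.
Unset Strict Implicit.
Unset Printing Implicit Defensive.
Import GRing.Theory.
Local Open Scope ring_scope.
Local Open Scope classical_set_scope.
Local Open Scope quotient_scope.

Reserved Notation "x ∙ y" (at level 40, left associativity).
Reserved Notation "r *> m" (at level 40, left associativity).
Reserved Notation "m <* r" (at level 40, left associativity).
Reserved Notation "p ⊗ q" (at level 40, left associativity).
Reserved Notation "M ⊠ N" (at level 40, left associativity).
Reserved Notation "{ 'rngmorphism' A -> B }"
  (at level 0, A at level 98, B at level 99).

(* MathComp has no non-unital rings: rngType is an abelian group with an
   associative, biadditive product; no unit, no commutativity. *)

Notation "x ∙ y" := (monoid.mul x y) : ring_scope.

HB.mixin Record Zmodule_Semigroup_isRng R of GRing.Zmodule R & Semigroup R := {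
  rngDl : forall x y z : R, (x + y) ∙ z = x ∙ z + y ∙ z;
  rngDr : forall x y z : R, x ∙ (y + z) = x ∙ y + x ∙ z
}.

#[short(type="rngType")]
HB.structure Definition Rng :=
  { R of Zmodule_Semigroup_isRng R & GRing.Zmodule R & Semigroup R }.

HB.structure Definition RngMorphism (A B : rngType) :=
  { f of GRing.isNmodMorphism A B f & isMultiplicative A B f }.
Notation "{ 'rngmorphism' A -> B }" := (RngMorphism.type A B) : type_scope.

Section RngTheory.
Variable R : rngType.
Implicit Types x y : R.

Lemma rng0r x : x ∙ 0 = 0.
Proof. by apply: (addIr (x ∙ 0)); rewrite -rngDr !add0r. Qed.
Lemma rng0l x : 0 ∙ x = 0.
Proof. by apply: (addIr (0 ∙ x)); rewrite -rngDl !add0r. Qed.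
Lemma rngBr x y z : x ∙ (y - z) = x ∙ y - x ∙ z.
Proof. by apply: (addIr (x ∙ z)); rewrite -rngDr !addrNK. Qed.
Lemma rngBl x y z : (x - y) ∙ z = x ∙ z - y ∙ z.
Proof. by apply: (addIr (y ∙ z)); rewrite -rngDl !addrNK. Qed.
Lemma rng_sumr (I : Type) (s : seq I) (F : I -> R) x :
  x ∙ (\sum_(i <- s) F i) = \sum_(i <- s) x ∙ F i.
Proof. exact: (big_morph _ (rngDr x) (rng0r x)). Qed.
Lemma rng_suml (I : Type) (s : seq I) (F : I -> R) x :
  (\sum_(i <- s) F i) ∙ x = \sum_(i <- s) F i ∙ x.
Proof.
exact: (big_morph (fun y => y ∙ x) (fun y z => rngDl y z x) (rng0l x)).
Qed.

End RngTheory.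

HB.mixin Record Zmodule_isBimodule (R : rngType) M of GRing.Zmodule M := {
  lact : R -> M -> M;
  ract : M -> R -> M;
  lactDl : forall r s m, lact (r + s) m = lact r m + lact s m;
  lactDr : forall r m n, lact r (m + n) = lact r m + lact r n;
  lactM : forall r s m, lact (r ∙ s) m = lact r (lact s m);
  ractDl : forall m n r, ract (m + n) r = ract m r + ract n r;
  ractDr : forall m r s, ract m (r + s) = ract m r + ract m s;
  ractM : forall m r s, ract m (r ∙ s) = ract (ract m r) s;
  lractA : forall r m s, ract (lact r m) s = lact r (ract m s)
}.

#[short(type="bimodType")]
HB.structure Definition Bimodule (R : rngType) :=
  { M of Zmodule_isBimodule R M & GRing.Zmodule M }.

Notation "r *> m" := (lact r m) : ring_scope.
Notation "m <* r" := (ract m r) : ring_scope.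

Section BimoduleTheory.
Variables (R : rngType) (M : bimodType R).
Implicit Types (r s : R) (m n : M).

Lemma lactBr r m n : r *> (m - n) = r *> m - r *> n.
Proof. by apply: (addIr (r *> n)); rewrite -lactDr !addrNK. Qed.
Lemma lactBl r s m : (r - s) *> m = r *> m - s *> m.
Proof. by apply: (addIr (s *> m)); rewrite -lactDl !addrNK. Qed.
Lemma ractBr m r s : m <* (r - s) = m <* r - m <* s.
Proof. by apply: (addIr (m <* s)); rewrite -ractDr !addrNK. Qed.
Lemma ractBl m n r : (m - n) <* r = m <* r - n <* r.
Proof. by apply: (addIr (n <* r)); rewrite -ractDl !addrNK. Qed.
Lemma lact0 r : r *> (0 : M) = 0.
Proof. by have := lactBr r 0 0; rewrite !subrr. Qed.
Lemma ract0 r : (0 : M) <* r = 0.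
Proof. by have := ractBl 0 0 r; rewrite !subrr. Qed.
Lemma lactN r m : r *> (- m) = - (r *> m).
Proof. by rewrite -sub0r lactBr lact0 sub0r. Qed.
Lemma ractN m r : (- m) <* r = - (m <* r).
Proof. by rewrite -sub0r ractBl ract0 sub0r. Qed.

End BimoduleTheory.

Definition regular (R : rngType) : Type := R.

Section Regular.
Variable R : rngType.
HB.instance Definition _ := GRing.Zmodule.on (regular R).
HB.instance Definition _ := @Zmodule_isBimodule.Build R (regular R)
  (@monoid.mul R) (@monoid.mul R) (@rngDl R) (@rngDr R)
  (fun r s m => esym (mulgA r s m)) (@rngDl R) (@rngDr R)
  (@mulgA R) (fun r m s => esym (mulgA r m s)).
End Regular.

Definition bimod_hom (R : rngType) (M N : bimodType R) (f : M -> N) :=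
  [/\ {morph f : x y / x + y},
      forall r x, f (r *> x) = r *> f x &
      forall x r, f (x <* r) = f x <* r].

Definition zsubgroup (V : zmodType) (A : set V) :=
  A 0 /\ forall u v, A u -> A v -> A (u - v).

Definition span (V : zmodType) (X : set V) : set V := smallest (@zsubgroup V) X.

Definition subrng (R : rngType) (A : set R) :=
  zsubgroup A /\ forall x y, A x -> A y -> A (x ∙ y).

Definition is_ideal (R : rngType) (I : set R) :=
  [/\ zsubgroup I, forall r x, I x -> I (r ∙ x) & forall x r, I x -> I (x ∙ r)].

Definition simple_rng (R : rngType) :=
  forall K : set R, is_ideal K -> K = [set 0] \/ K = setT.

Definition ideal_intersection_property (R : rngType) (A : set R) :=
  forall K : set R, is_ideal K -> K `&` A = [set 0] -> K = [set 0].

Section Span.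
Variable V : zmodType.
Implicit Types X A : set V.

Lemma span_zsubgroup X : zsubgroup (span X).
Proof.
split=> [A [[]] //|u v hu hv A hA]; have [[_ hB] _] := hA.
by apply: hB; [exact: hu|exact: hv].
Qed.

Lemma span_sub X A : zsubgroup A -> X `<=` A -> span X `<=` A.
Proof. exact: smallest_sub. Qed.

Lemma sub_span X : X `<=` span X.
Proof. exact: sub_gen_smallest. Qed.

Lemma span_id A : zsubgroup A -> span A = A.
Proof. exact: smallest_id. Qed.

Definition spanp X : {pred V} := fun v => `[< span X v >].

Lemma spanp_zmod_closed X : zmod_closed (spanp X).
Proof.
have [h0 hB] := span_zsubgroup X.
by split=> [|u v /asboolP hu /asboolP hv]; apply/asboolP => //; exact: hB.
Qed.
HB.instance Definition _ X :=
  GRing.isZmodClosed.Build V (spanp X) (spanp_zmod_closed X).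

(* the quotient group of V by the subgroup spanned by X *)
Definition zquot X := {ideal_quot (spanp X)}.
HB.instance Definition _ X := GRing.Zmodule.on (zquot X).

Definition zproj X (v : V) : zquot X := \pi_{ideal_quot (spanp X)} v.
Definition zrepr X (x : zquot X) : V := repr (x : {ideal_quot (spanp X)}).

Lemma zreprK X : cancel (@zrepr X) (@zproj X).
Proof. by move=> x; exact: reprK. Qed.

Lemma zproj_eqP X u v : zproj X u = zproj X v <-> span X (u - v).
Proof.
split=> [/eqP|h]; last apply/eqP.
  by rewrite /zproj -Quotient.idealrBE => /asboolP.
by rewrite /zproj -Quotient.idealrBE; apply/asboolP.
Qed.

Lemma zproj_is_zmod_morphism X : zmod_morphism (zproj X).
Proof. by move=> u v; rewrite /zproj !piE. Qed.
HB.instance Definition _ X :=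
  GRing.isZmodMorphism.Build V (zquot X) (zproj X) (zproj_is_zmod_morphism X).

Lemma zquot_lift (W : zmodType) X (f : {additive V -> W}) :
  (forall v, X v -> f v = 0) -> forall v, f (zrepr (zproj X v)) = f v.
Proof.
move=> fX v; apply/eqP; rewrite -subr_eq0 -raddfB; apply/eqP.
have: span X (zrepr (zproj X v) - v) by apply/zproj_eqP; rewrite zreprK.
apply: (@span_sub X [set w | f w = 0]) => //; split=> [|u w /= hu hw].
  exact: raddf0.
by rewrite raddfB hu hw subrr.
Qed.

End Span.

(* Tensor products over R: the free abelian group on M * N modulo the
   relations of biadditivity and R-balancedness. *)

HB.instance Definition _ (K : choiceType) (W : lmodType int) (f : K -> W) :=
  GRing.isZmodMorphism.Build {freeg K / int} W (fglift f) (lift_is_additive f).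

Section Tensor.
Variables (R : rngType) (M N : bimodType R).

Definition tensor_rel : set {freeg (M * N) / int} :=
  [set d | exists m m' n, d = << (m + m', n) >> - << (m, n) >> - << (m', n) >>]
  `|` [set d | exists m n n',
        d = << (m, n + n') >> - << (m, n) >> - << (m, n') >>]
  `|` [set d | exists m r n, d = << (m <* r, n) >> - << (m, r *> n) >>].

Definition tensor := zquot tensor_rel.
HB.instance Definition _ := GRing.Zmodule.on tensor.

Definition tens (m : M) (n : N) : tensor := zproj tensor_rel << (m, n) >>.

Lemma tensDl m m' n : tens (m + m') n = tens m n + tens m' n.
Proof.
apply/eqP; rewrite -subr_eq0 opprD addrA /tens -!raddfB -(raddf0 (zproj _)).
apply/eqP/zproj_eqP; rewrite subr0; apply: sub_span.
by left; left; exists m, m', n.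
Qed.

Lemma tensDr m n n' : tens m (n + n') = tens m n + tens m n'.
Proof.
apply/eqP; rewrite -subr_eq0 opprD addrA /tens -!raddfB -(raddf0 (zproj _)).
apply/eqP/zproj_eqP; rewrite subr0; apply: sub_span.
by left; right; exists m, n, n'.
Qed.

Lemma tens_bal m r n : tens (m <* r) n = tens m (r *> n).
Proof. by apply/zproj_eqP; apply: sub_span; right; exists m, r, n. Qed.

Lemma tens_ind (A : set tensor) :
  zsubgroup A -> (forall m n, A (tens m n)) -> forall t, A t.
Proof.
move=> [A0 AB] At t.
have AN u : A u -> A (- u) by rewrite -sub0r; exact: AB.
have AD u v : A u -> A v -> A (u + v).
  by move=> hu /AN hv; rewrite -[v]opprK; exact: AB.
rewrite -(zreprK t) -(freeg_sumE (zrepr t)) raddf_sum.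
apply: (big_ind A) => // -[m n] _.
rewrite -[coeff _ _]intz -freegU_mulz raddfMz.
have An k : A (tens m n *+ k).
  by elim: k => [|k IHk] //; rewrite mulrS; apply: AD.
by case: (coeff _ _) => k; [exact: An|apply/AN/An].
Qed.

Definition balanced (W : zmodType) (f : M -> N -> W) :=
  [/\ forall m m' n, f (m + m') n = f m n + f m' n,
      forall m n n', f m (n + n') = f m n + f m n' &
      forall m r n, f (m <* r) n = f m (r *> n)].

(* The additive map out of the tensor product induced by f, which is the
   expected one when f is balanced (see tliftE). *)
Definition tlift (W : zmodType) (f : M -> N -> W) (t : tensor) : W :=
  fglift (fun mn => f mn.1 mn.2 : zmodule W) (zrepr t).

Lemma tlift_proj (W : zmodType) (f : M -> N -> W) : balanced f ->
  forall d, tlift f (zproj _ d) = fglift (fun mn => f mn.1 mn.2 : zmodule W) d.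
Proof.
move=> [fDl fDr fb] d.
pose g : {additive {freeg (M * N) / int} -> zmodule W} :=
  fglift (fun mn => f mn.1 mn.2 : zmodule W).
apply: (zquot_lift (f := g)); rewrite /g.
move=> v [[[m [m' [n ->]]]|[m [n [n' ->]]]]|[m [r [n ->]]]];
  rewrite !raddfB /= !liftU !scale1r /=.
- by rewrite fDl addrAC addrK subrr.
- by rewrite fDr addrAC addrK subrr.
- by rewrite fb subrr.
Qed.

Lemma tliftE (W : zmodType) (f : M -> N -> W) :
  balanced f -> forall m n, tlift f (tens m n) = f m n.
Proof. by move=> bf m n; rewrite tlift_proj // liftU scale1r. Qed.

Lemma tliftB (W : zmodType) (f : M -> N -> W) :
  balanced f -> zmod_morphism (tlift f).
Proof.
move=> bf t u; rewrite -(zreprK t) -(zreprK u) -raddfB !tlift_proj //.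
exact: (@raddfB _ (zmodule W) (fglift _)).
Qed.

Lemma tliftD (W : zmodType) (f : M -> N -> W) :
  balanced f -> {morph tlift f : t u / t + u}.
Proof.
move=> bf t u; rewrite -(zreprK t) -(zreprK u) -raddfD !tlift_proj //.
exact: (@raddfD _ (zmodule W) (fglift _)).
Qed.

Lemma tlift_ext (W : zmodType) (g h : tensor -> W) :
  zmod_morphism g -> zmod_morphism h ->
  (forall m n, g (tens m n) = h (tens m n)) -> g =1 h.
Proof.
move=> gB hB gh; apply: tens_ind => //; split=> [|u v /= gu gv].
  by have := gB 0 0; have := hB 0 0; rewrite !subrr => -> ->.
by rewrite gB hB gu gv.
Qed.

End Tensor.

Notation "M ⊠ N" := (tensor M N) : type_scope.
Notation "p ⊗ q" := (tens p q) : ring_scope.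

Section TensorBimodule.
Variables (R : rngType) (M N : bimodType R).

Definition tlact (r : R) : M ⊠ N -> M ⊠ N := tlift (fun m n => (r *> m) ⊗ n).
Definition tract (t : M ⊠ N) (r : R) : M ⊠ N :=
  tlift (fun m n => m ⊗ (n <* r)) t.

Let bl r : balanced (fun (m : M) (n : N) => (r *> m) ⊗ n).
Proof.
split=> [m m' n|m n n'|m s n]; rewrite ?lactDr ?tensDl ?tensDr //.
by rewrite -lractA tens_bal.
Qed.

Let br r : balanced (fun (m : M) (n : N) => m ⊗ (n <* r)).
Proof.
split=> [m m' n|m n n'|m s n]; rewrite ?ractDl ?tensDl ?tensDr //.
by rewrite tens_bal lractA.
Qed.

Lemma tlactE r m n : tlact r (m ⊗ n) = (r *> m) ⊗ n.
Proof. exact: tliftE. Qed.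

Lemma tractE m n r : tract (m ⊗ n) r = m ⊗ (n <* r).
Proof. exact: (tliftE (br r)). Qed.

Let tlactB r : zmod_morphism (tlact r). Proof. exact: tliftB. Qed.
Let tractB r : zmod_morphism (tract^~ r). Proof. exact: (tliftB (br r)). Qed.

Let tlactDr r : {morph tlact r : t u / t + u}. Proof. exact: tliftD. Qed.
Let tractDl t u r : tract (t + u) r = tract t r + tract u r.
Proof. exact: (tliftD (br r)). Qed.

Let tlactDl r s t : tlact (r + s) t = tlact r t + tlact s t.
Proof.
apply: (tlift_ext (g := tlact (r + s)) (h := fun t => tlact r t + tlact s t)).
- exact: tlactB.
- by move=> u v; rewrite !tlactB opprD addrACA.
- by move=> m n; rewrite !tlactE lactDl tensDl.
Qed.

Let tlactM r s t : tlact (r ∙ s) t = tlact r (tlact s t).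
Proof.
apply: (tlift_ext (g := tlact (r ∙ s)) (h := fun t => tlact r (tlact s t))).
- exact: tlactB.
- by move=> u v; rewrite !tlactB.
- by move=> m n; rewrite !tlactE lactM.
Qed.

Let tractDr t r s : tract t (r + s) = tract t r + tract t s.
Proof.
apply: (tlift_ext (g := tract^~ (r + s)) (h := fun t => tract t r + tract t s)).
- exact: tractB.
- by move=> u v; rewrite !tractB opprD addrACA.
- by move=> m n; rewrite !tractE ractDr tensDr.
Qed.

Let tractM t r s : tract t (r ∙ s) = tract (tract t r) s.
Proof.
apply: (tlift_ext (g := tract^~ (r ∙ s)) (h := fun t => tract (tract t r) s)).
- exact: tractB.
- by move=> u v; rewrite !tractB.
- by move=> m n; rewrite !tractE ractM.
Qed.

Let tlractA r t s : tract (tlact r t) s = tlact r (tract t s).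
Proof.
apply: (tlift_ext (g := fun t => tract (tlact r t) s)
                  (h := fun t => tlact r (tract t s))).
- by move=> u v; rewrite tlactB tractB.
- by move=> u v; rewrite tractB tlactB.
- by move=> m n; rewrite tlactE !tractE tlactE.
Qed.

HB.instance Definition _ := @Zmodule_isBimodule.Build R (M ⊠ N) tlact tract
  tlactDl tlactDr tlactM tractDl tractDr tractM tlractA.

Lemma lact_tens (r : R) (m : M) (n : N) : r *> (m ⊗ n) = (r *> m) ⊗ n.
Proof. exact: tlactE. Qed.

Lemma ract_tens (r : R) (m : M) (n : N) : (m ⊗ n) <* r = m ⊗ (n <* r).
Proof. exact: tractE. Qed.

End TensorBimodule.

(* Index shift: tpow M n is the (n + 1)-fold tensor power M ⊠ (M ⊠ ...), so
   that n : nat covers exactly the positive tensor powers. *)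
Fixpoint tpow (R : rngType) (M : bimodType R) (n : nat) : bimodType R :=
  if n is n'.+1 then (M ⊠ tpow M n' : bimodType R) else M.

Record rsystem (R : rngType) := RSystem {
  sysP : bimodType R;
  sysQ : bimodType R;
  psi : sysP ⊠ sysQ -> R;
  psi_hom : bimod_hom (psi : sysP ⊠ sysQ -> regular R)
}.

Section RSystem.
Variables (R : rngType) (X : rsystem R).
Local Notation P := (sysP X).
Local Notation Q := (sysQ X).
Implicit Types (p : P) (q : Q) (I J : set R).

Definition thetaQ (q : Q) (p : P) : Q -> Q := fun x => q <* psi (p ⊗ x).
Definition thetaP (p : P) (q : Q) : P -> P := fun y => psi (y ⊗ q) *> p.

Definition finrankQ : set (Q -> Q) :=
  span [set f | exists q p, f = thetaQ q p].
Definition finrankP : set (P -> P) :=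
  span [set f | exists p q, f = thetaP p q].

Definition condition_FS :=
  forall (qs : seq Q) (ps : seq P),
    exists f g, [/\ finrankQ f, finrankP g,
      {in qs, forall q, f q = q} & {in ps, forall p, g p = p}].

Definition Delta (r : R) : Q -> Q := fun q => r *> q.

Definition psi_compatible J := is_ideal J /\ Delta @` J `<=` finrankQ.

Definition faithful_psi_compatible J :=
  psi_compatible J /\ J `&` [set r | Delta r = 0] = [set 0].

Definition psi_invariant I :=
  forall p x q, I x -> I (psi ((p <* x) ⊗ q)).

Lemma psiB : zmod_morphism (@psi R X).
Proof.
have [hD _ _] := psi_hom X => t u; apply: (addIr (psi u)).
by rewrite addrNK -[psi (t - u) + psi u]hD addrNK.
Qed.

Lemma psi0 : psi (0 : P ⊠ Q) = 0.
Proof. by rewrite -(subrr 0) psiB subrr. Qed.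

Lemma psiD (t u : P ⊠ Q) : psi (t + u) = psi t + psi u.
Proof. by have [hD _ _] := psi_hom X; rewrite [LHS]hD. Qed.

Lemma psi_lact r p q : psi ((r *> p) ⊗ q) = r ∙ psi (p ⊗ q).
Proof. by have [_ hl _] := psi_hom X; rewrite -lact_tens [LHS]hl. Qed.

Lemma psi_ract p q r : psi (p ⊗ (q <* r)) = psi (p ⊗ q) ∙ r.
Proof. by have [_ _ hr] := psi_hom X; rewrite -ract_tens [LHS]hr. Qed.

Lemma finrankP_sum g : finrankP g ->
  exists s : seq (P * Q), forall y, g y = \sum_(z <- s) psi (y ⊗ z.2) *> z.1.
Proof.
apply: (@span_sub _ _ [set g | exists s : seq (P * Q),
  forall y, g y = \sum_(z <- s) psi (y ⊗ z.2) *> z.1])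
  => [|_ [p [q ->]]]; last first.
  by exists [:: (p, q)] => y; rewrite big_seq1.
split=> [|g1 g2 [s1 h1] [s2 h2]]; first by exists [::] => y; rewrite big_nil.
exists (s1 ++ [seq (- z.1, z.2) | z <- s2]) => y.
rewrite big_cat big_map /= -h1 -[(g1 - g2) y]/(g1 y - g2 y) h2 -sumrN.
by congr (_ + _); apply: eq_bigr => z _; rewrite lactN.
Qed.

Lemma finrankQ_sum f : finrankQ f ->
  exists s : seq (Q * P), forall x, f x = \sum_(z <- s) z.1 <* psi (z.2 ⊗ x).
Proof.
apply: (@span_sub _ _ [set f | exists s : seq (Q * P),
  forall x, f x = \sum_(z <- s) z.1 <* psi (z.2 ⊗ x)])
  => [|_ [q [p ->]]]; last first.
  by exists [:: (q, p)] => x; rewrite big_seq1.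
split=> [|g1 g2 [s1 h1] [s2 h2]]; first by exists [::] => y; rewrite big_nil.
exists (s1 ++ [seq (- z.1, z.2) | z <- s2]) => y.
rewrite big_cat big_map /= -h1 -[(g1 - g2) y]/(g1 y - g2 y) h2 -sumrN.
by congr (_ + _); apply: eq_bigr => z _; rewrite ractN.
Qed.

End RSystem.

Record covrep (R : rngType) (X : rsystem R) (B : rngType) := CovRep {
  repS : {additive sysP X -> B};
  repT : {additive sysQ X -> B};
  repsigma : {rngmorphism R -> B};
  repS_ract : forall p r, repS (p <* r) = repS p ∙ repsigma r;
  repS_lact : forall r p, repS (r *> p) = repsigma r ∙ repS p;
  repT_ract : forall q r, repT (q <* r) = repT q ∙ repsigma r;
  repT_lact : forall r q, repT (r *> q) = repsigma r ∙ repT q;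
  rep_psi : forall p q, repsigma (psi (p ⊗ q)) = repS p ∙ repT q
}.

Section CovRep.
Variables (R : rngType) (X : rsystem R) (B : rngType) (u : covrep X B).
Local Notation P := (sysP X).
Local Notation Q := (sysQ X).
Local Notation S := (repS u).
Local Notation T := (repT u).
Local Notation sigma := (repsigma u).

Definition nonzero_rep := ~ [/\ S =1 \0, T =1 \0 & sigma =1 \0].

Fixpoint repSn (n : nat) : tpow P n -> B :=
  if n is n'.+1 then tlift (fun p y => S p ∙ repSn (y : tpow P n')) else S.

Fixpoint repTn (n : nat) : tpow Q n -> B :=
  if n is n'.+1 then tlift (fun q y => T q ∙ repTn (y : tpow Q n')) else T.

(* pi_{T,S}, extended by 0 outside F_P(Q). Its value does not depend on the
   chosen decomposition under condition (FS), see repi_sum and repi_theta. *)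
Definition repi (f : Q -> Q) : B :=
  xget 0 [set b | exists s : seq (Q * P),
    f = \sum_(z <- s) thetaQ z.1 z.2 /\ b = \sum_(z <- s) T z.1 ∙ S z.2].

Definition CP_invariant (J : set R) :=
  forall x, J x -> repi (Delta x) = sigma x.

Lemma repi_uniq : condition_FS X -> forall s s' : seq (Q * P),
  \sum_(z <- s) thetaQ z.1 z.2 = \sum_(z <- s') thetaQ z.1 z.2 ->
  \sum_(z <- s) T z.1 ∙ S z.2 = \sum_(z <- s') T z.1 ∙ S z.2.
Proof.
move=> FS s s' ss'.
have [_ [g [_ /finrankP_sum [t gE] _ gid]]] := FS [::] [seq z.2 | z <- s ++ s'].
have key s0 : {subset s0 <= s ++ s'} -> \sum_(z <- s0) T z.1 ∙ S z.2 =
    \sum_(w <- t) T ((\sum_(z <- s0) thetaQ z.1 z.2) w.2) ∙ S w.1.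
  move=> sub; transitivity (\sum_(z <- s0) T z.1 ∙ S (g z.2)).
    apply: eq_big_seq => z /sub zs; rewrite gid //.
    by apply/mapP; exists z.
  under eq_bigr do rewrite gE raddf_sum rng_sumr.
  rewrite exchange_big /=; apply: eq_bigr => w _.
  rewrite fct_sumE raddf_sum rng_suml; apply: eq_bigr => z _.
  by rewrite repS_lact mulgA -repT_ract.
by rewrite !key ?ss' // => z zs; rewrite mem_cat zs ?orbT.
Qed.

Lemma repi_sum : condition_FS X -> forall s : seq (Q * P),
  repi (\sum_(z <- s) thetaQ z.1 z.2) = \sum_(z <- s) T z.1 ∙ S z.2.
Proof.
move=> FS s; rewrite /repi; case: xgetP => [b _ [s' [ss' ->]]|]; last first.
  by move/(_ (\sum_(z <- s) T z.1 ∙ S z.2)) => [] //; exists s.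
exact/esym/repi_uniq.
Qed.

Lemma repi_theta : condition_FS X ->
  forall q p, repi (thetaQ q p) = T q ∙ S p.
Proof. by move=> FS q p; have := repi_sum FS [:: (q, p)]; rewrite !big_seq1. Qed.

End CovRep.

Section TensorMaps.
Variables (R : rngType) (X : rsystem R) (B : rngType) (u : covrep X B).
Local Notation P := (sysP X).
Local Notation Q := (sysQ X).

Lemma repSn_morph n :
  {morph repSn u (n := n) : y z / y + z} *
  (forall r y, repSn u (r *> y : tpow P n) = repsigma u r ∙ repSn u y).
Proof.
elim: n => [|n [IHD IHl]] /=.
  by split; [exact: raddfD | move=> r y; exact: repS_lact].
have bal : balanced (fun p (y : tpow P n) => repS u p ∙ repSn u y).
  split=> [p p' y|p y y'|p r y]; rewrite ?raddfD ?IHD ?rngDl ?rngDr //.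
  by rewrite repS_ract IHl mulgA.
split=> [|r y]; first exact: tliftD.
apply: (tlift_ext (g := fun y => tlift _ (r *> y))
                  (h := fun y => repsigma u r ∙ tlift _ y)).
- by move=> t t'; rewrite lactBr tliftB.
- by move=> t t'; rewrite tliftB // rngBr.
- by move=> p z; rewrite lact_tens !tliftE // repS_lact mulgA.
Qed.

Lemma repSn_tens n p (y : tpow P n) :
  repSn u (p ⊗ y : tpow P n.+1) = repS u p ∙ repSn u y.
Proof.
have [IHD IHl] := repSn_morph n.
apply: (tliftE (f := fun p (y : tpow P n) => repS u p ∙ repSn u y)).
split=> [p1 p' z|p1 z z'|p1 r z]; rewrite ?raddfD ?IHD ?rngDl ?rngDr //.
by rewrite repS_ract IHl mulgA.
Qed.

Lemma repTn_morph n :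
  {morph repTn u (n := n) : y z / y + z} *
  (forall r y, repTn u (r *> y : tpow Q n) = repsigma u r ∙ repTn u y).
Proof.
elim: n => [|n [IHD IHl]] /=.
  by split; [exact: raddfD | move=> r y; exact: repT_lact].
have bal : balanced (fun p (y : tpow Q n) => repT u p ∙ repTn u y).
  split=> [p p' y|p y y'|p r y]; rewrite ?raddfD ?IHD ?rngDl ?rngDr //.
  by rewrite repT_ract IHl mulgA.
split=> [|r y]; first exact: tliftD.
apply: (tlift_ext (g := fun y => tlift _ (r *> y))
                  (h := fun y => repsigma u r ∙ tlift _ y)).
- by move=> t t'; rewrite lactBr tliftB.
- by move=> t t'; rewrite tliftB // rngBr.
- by move=> p z; rewrite lact_tens !tliftE // repT_lact mulgA.
Qed.

Lemma repTn_tens n q (y : tpow Q n) :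
  repTn u (q ⊗ y : tpow Q n.+1) = repT u q ∙ repTn u y.
Proof.
have [IHD IHl] := repTn_morph n.
apply: (tliftE (f := fun q (y : tpow Q n) => repT u q ∙ repTn u y)).
split=> [p1 p' z|p1 z z'|p1 r z]; rewrite ?raddfD ?IHD ?rngDl ?rngDr //.
by rewrite repT_ract IHl mulgA.
Qed.

End TensorMaps.

Definition rep_factor (R : rngType) (X : rsystem R) (O B : rngType)
    (u : covrep X O) (v : covrep X B) (eta : {rngmorphism O -> B}) :=
  [/\ eta \o repS u =1 repS v, eta \o repT u =1 repT v &
      eta \o repsigma u =1 repsigma v].

(* (O, u) is the universal covariant representation that is Cuntz-Pimsner
   invariant relative to J; this determines it up to unique isomorphism. *)
Definition is_CP_ring (R : rngType) (X : rsystem R) (J : set R) (O : rngType)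
    (u : covrep X O) :=
  [/\ CP_invariant u J,
      injective (repsigma u),
      smallest (@subrng O)
        (range (repsigma u) `|` range (repS u) `|` range (repT u)) = setT &
      forall (B : rngType) (v : covrep X B), CP_invariant v J ->
        (exists eta : {rngmorphism O -> B}, rep_factor u v eta) /\
        (forall eta eta' : {rngmorphism O -> B},
           rep_factor u v eta -> rep_factor u v eta' -> eta =1 eta')].

Definition degree0_part (R : rngType) (X : rsystem R) (O : rngType)
    (u : covrep X O) : set O :=
  span (range (repsigma u) `|`
    [set b | exists k (q : tpow (sysQ X) k) (p : tpow (sysP X) k),
       b = repTn u q ∙ repSn u p]).

Section ConditionL.
Variables (R : rngType) (X : rsystem R).
Local Notation P := (sysP X).
Local Notation Q := (sysQ X).
Implicit Types (I J : set R).

(* S_p (q ⊗ y) = psi (p ⊗ q) y, see tcontractE *)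
Definition tcontract (p : P) n : tpow Q n.+1 -> tpow Q n :=
  tlift (fun q (y : tpow Q n) => psi (p ⊗ q) *> y).

(* tappend y q = y ⊗ q, i.e. T_y (q); with right-nested tensor powers the new
   factor is inserted at the innermost position, see tappend_tens. *)
Fixpoint tappend n : tpow Q n -> Q -> tpow Q n.+1 :=
  if n is n'.+1 then
    fun y q => tlift (fun q1 (z : tpow Q n') => q1 ⊗ tappend z q) y
  else fun q1 q => q1 ⊗ q.

Lemma tcontractE p n q (y : tpow Q n) :
  tcontract p (q ⊗ y) = psi (p ⊗ q) *> y.
Proof.
apply: tliftE; split=> [q1 q2 z|q1 z z'|q1 r z].
- by rewrite tensDr psiD lactDl.
- by rewrite lactDr.
- by rewrite psi_ract lactM.
Qed.

Lemma tappend_morph n (q : Q) :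
  {morph (fun y : tpow Q n => tappend y q) : y z / y + z} *
  (forall r (y : tpow Q n), tappend (r *> y) q = r *> tappend y q).
Proof.
elim: n => [|n [IHD IHl]] /=.
  by split=> [y z|r y]; rewrite ?tensDl ?lact_tens.
have bal : balanced (fun q1 (z : tpow Q n) => q1 ⊗ tappend z q).
  split=> [q1 q2 z|q1 z z'|q1 r z]; rewrite ?tensDl ?IHD ?tensDr //.
  by rewrite tens_bal IHl.
split=> [|r y]; first exact: tliftD.
apply: (tlift_ext (g := fun y => tlift _ (r *> y))
                  (h := fun y => r *> tlift _ y)).
- by move=> t t'; rewrite lactBr tliftB.
- by move=> t t'; rewrite tliftB // lactBr.
- by move=> p z; rewrite lact_tens !tliftE // lact_tens.
Qed.

Lemma tappend_tens n q1 (y : tpow Q n) q :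
  tappend (q1 ⊗ y : tpow Q n.+1) q = q1 ⊗ tappend y q.
Proof.
have [IHD IHl] := tappend_morph n q.
apply: (tliftE (f := fun q1 (z : tpow Q n) => q1 ⊗ tappend z q)).
split=> [q2 q3 z|q2 z z'|q2 r z]; rewrite ?tensDl ?IHD ?tensDr //.
by rewrite tens_bal IHl.
Qed.

(* The bimodule map eta : I -> tpow Q n is given by a function on R of which
   only the values on I matter. *)
Definition psi_invariant_cycle I :=
  [/\ is_ideal I, psi_invariant X I &
    exists n (eta : R -> tpow Q n),
      [/\ forall x y, I x -> I y -> eta (x + y) = eta x + eta y,
          forall r x, I x ->
            eta (r ∙ x) = r *> eta x /\ eta (x ∙ r) = eta x <* r,
          forall x y, I x -> I y -> eta x = eta y -> x = y &
          forall p x q, I x ->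
            tcontract p (tappend (eta x) q) = eta (psi ((p <* x) ⊗ q))]].

Definition psi_preim I : set R :=
  [set x | forall (p : P) (q : Q), I (psi ((p <* x) ⊗ q))].

(* I^[k + 1] is the k-th iterate, as I^[1] = I. *)
Definition ideal_infty I : set R :=
  \bigcap_k iter k (fun K => psi_preim K `&` I) I.

Definition condition_L J :=
  ~ exists I, [/\ psi_invariant_cycle I, I <> [set 0] & I `<=` ideal_infty J].

End ConditionL.

(* Since I is an ideal, it is equal to its span (spanI), so zquot I is R/I. *)
Section QuotientRing.
Variables (R : rngType) (I : set R) (Iid : is_ideal I).

Definition rquot (_ : is_ideal I) := zquot I.
Local Notation RI := (rquot Iid).
HB.instance Definition _ := GRing.Zmodule.on RI.

Definition rproj : R -> RI := zproj I.
HB.instance Definition _ := GRing.Additive.copy rproj (zproj I).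

Lemma spanI : span I = I.
Proof. by have [h _ _] := Iid; exact: span_id. Qed.

Lemma rproj_eqP x y : rproj x = rproj y <-> I (x - y).
Proof. by have := @zproj_eqP _ I x y; rewrite spanI. Qed.

Definition rquot_mul (x y : RI) : RI := rproj (zrepr x ∙ zrepr y).

Lemma rprojM x y : rproj (x ∙ y) = rquot_mul (rproj x) (rproj y).
Proof.
have [[I0 IB] Il Ir] := Iid.
apply/rproj_eqP; set x' := zrepr (rproj x); set y' := zrepr (rproj y).
have hx : I (x - x') by apply/rproj_eqP; rewrite /rproj zreprK.
have hy : I (y' - y) by apply/rproj_eqP; rewrite /rproj zreprK.
have -> : x ∙ y - x' ∙ y' = (x - x') ∙ y - x' ∙ (y' - y).
  by rewrite rngBl rngBr opprB addrA addrNK.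
by apply: IB; [exact: Ir|exact: Il].
Qed.

Let rprojK (x : RI) : rproj (zrepr x) = x. Proof. exact: zreprK. Qed.
Let rprojD x y : rproj (x + y) = rproj x + rproj y. Proof. exact: raddfD. Qed.

Let mulA : associative rquot_mul.
Proof.
by move=> x y z; rewrite -(rprojK x) -(rprojK y) -(rprojK z) -!rprojM mulgA.
Qed.
HB.instance Definition _ := isSemigroup.Build RI mulA.

Let mulDl (x y z : RI) : (x + y) ∙ z = x ∙ z + y ∙ z.
Proof.
rewrite -(rprojK x) -(rprojK y) -(rprojK z) -rprojD.
apply: etrans (esym (rprojM _ _)) _; rewrite rngDl rprojD.
by congr (_ + _); apply: rprojM.
Qed.
Let mulDr (x y z : RI) : x ∙ (y + z) = x ∙ y + x ∙ z.
Proof.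
rewrite -(rprojK x) -(rprojK y) -(rprojK z) -rprojD.
apply: etrans (esym (rprojM _ _)) _; rewrite rngDr rprojD.
by congr (_ + _); apply: rprojM.
Qed.
HB.instance Definition _ := Zmodule_Semigroup_isRng.Build RI mulDl mulDr.
HB.instance Definition _ := isMultiplicative.Build R RI rproj rprojM.

End QuotientRing.

(* The quotient of the R-bimodule M by the subgroup spanned by X is an
   R/I-bimodule as soon as this subgroup is stable and contains IM and MI. *)
Definition bquot_compat (R : rngType) (I : set R) (M : bimodType R)
    (X : set M) :=
  [/\ forall r m, span X m -> span X (r *> m),
      forall m r, span X m -> span X (m <* r),
      forall x m, I x -> span X (x *> m) &
      forall m x, I x -> span X (m <* x)].

Section QuotientBimodule.
Variables (R : rngType) (I : set R) (Iid : is_ideal I) (M : bimodType R) (X : set M).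
Variable XI : bquot_compat I X.

Definition bquot (_ : bquot_compat I X) := zquot X.
Local Notation MX := (bquot XI).
HB.instance Definition _ := GRing.Zmodule.on MX.

Definition bproj : M -> MX := zproj X.
HB.instance Definition _ := GRing.Additive.copy bproj (zproj X).

Lemma bproj_eqP m n : bproj m = bproj n <-> span X (m - n).
Proof. exact: zproj_eqP. Qed.

Let bprojK (m : MX) : bproj (zrepr m) = m. Proof. exact: zreprK. Qed.
Let rprojK (x : rquot Iid) : rproj Iid (zrepr x) = x. Proof. exact: zreprK. Qed.
Let bprojD m n : bproj (m + n) = bproj m + bproj n. Proof. exact: raddfD. Qed.
Let rprojD x y : rproj Iid (x + y) = rproj Iid x + rproj Iid y.
Proof. exact: raddfD. Qed.
Let rprojM x y : rproj Iid (x ∙ y) = rproj Iid x ∙ rproj Iid y.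
Proof. exact: rprojM. Qed.

Definition bquot_lact (x : rquot Iid) (m : MX) : MX := bproj (zrepr x *> zrepr m).
Definition bquot_ract (m : MX) (x : rquot Iid) : MX := bproj (zrepr m <* zrepr x).

Lemma bproj_lact r m : bproj (r *> m) = bquot_lact (rproj Iid r) (bproj m).
Proof.
have [hl hr Il Ir] := XI; have [_ sB] := span_zsubgroup X.
apply/bproj_eqP; set r' := zrepr (rproj Iid r); set m' := zrepr (bproj m).
have h1 : I (r - r') by apply/rproj_eqP; rewrite rprojK.
have h2 : span X (m' - m) by apply/bproj_eqP; rewrite bprojK.
have -> : r *> m - r' *> m' = (r - r') *> m - r' *> (m' - m).
  by rewrite lactBl lactBr opprB addrA addrNK.
by apply: sB; [exact: Il|exact: hl].
Qed.

Lemma bproj_ract m r : bproj (m <* r) = bquot_ract (bproj m) (rproj Iid r).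
Proof.
have [hl hr Il Ir] := XI; have [_ sB] := span_zsubgroup X.
apply/bproj_eqP; set r' := zrepr (rproj Iid r); set m' := zrepr (bproj m).
have h1 : I (r - r') by apply/rproj_eqP; rewrite rprojK.
have h2 : span X (m' - m) by apply/bproj_eqP; rewrite bprojK.
have -> : m <* r - m' <* r' = m <* (r - r') - (m' - m) <* r'.
  by rewrite ractBl ractBr opprB addrA addrNK.
by apply: sB; [exact: Ir|exact: hr].
Qed.

Let lDl x y m : bquot_lact (x + y) m = bquot_lact x m + bquot_lact y m.
Proof.
rewrite -(rprojK x) -(rprojK y) -(bprojK m) -rprojD -!bproj_lact.
by rewrite lactDl bprojD.
Qed.
Let lDr x m n : bquot_lact x (m + n) = bquot_lact x m + bquot_lact x n.
Proof.
rewrite -(rprojK x) -(bprojK m) -(bprojK n) -bprojD -!bproj_lact.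
by rewrite lactDr bprojD.
Qed.
Let lM x y m : bquot_lact (x ∙ y) m = bquot_lact x (bquot_lact y m).
Proof.
rewrite -(rprojK x) -(rprojK y) -(bprojK m) -rprojM -!bproj_lact.
by rewrite lactM.
Qed.
Let rDl m n x : bquot_ract (m + n) x = bquot_ract m x + bquot_ract n x.
Proof.
rewrite -(rprojK x) -(bprojK m) -(bprojK n) -bprojD -!bproj_ract.
by rewrite ractDl bprojD.
Qed.
Let rDr m x y : bquot_ract m (x + y) = bquot_ract m x + bquot_ract m y.
Proof.
rewrite -(rprojK x) -(rprojK y) -(bprojK m) -rprojD -!bproj_ract.
by rewrite ractDr bprojD.
Qed.
Let rM m x y : bquot_ract m (x ∙ y) = bquot_ract (bquot_ract m x) y.
Proof.
rewrite -(rprojK x) -(rprojK y) -(bprojK m) -rprojM -!bproj_ract.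
by rewrite ractM.
Qed.
Let lrA x m y : bquot_ract (bquot_lact x m) y = bquot_lact x (bquot_ract m y).
Proof.
rewrite -(rprojK x) -(rprojK y) -(bprojK m).
by rewrite -bproj_lact -!bproj_ract -bproj_lact lractA.
Qed.
HB.instance Definition _ := @Zmodule_isBimodule.Build (rquot Iid) MX
  bquot_lact bquot_ract lDl lDr lM rDl rDr rM lrA.

End QuotientBimodule.

Section QuotientSystem.
Variables (R : rngType) (X : rsystem R) (FS : condition_FS X).
Variables (I : set R) (Iid : is_ideal I) (Iinv : psi_invariant X I).
Local Notation P := (sysP X).
Local Notation Q := (sysQ X).

Definition IP_gen : set P := [set y | exists x p, I x /\ y = x *> p].
Definition QI_gen : set Q := [set y | exists q x, I x /\ y = q <* x].

(* (FS) and psi-invariance give PI ⊆ IP and IQ ⊆ QI, without which P/IP and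
   Q/QI would not be R/I-bimodules. *)
Lemma IP_compat : bquot_compat I IP_gen.
Proof.
have [[I0 IB] Il Ir] := Iid.
have [s0 sB] := span_zsubgroup IP_gen.
have hIP x p : I x -> span IP_gen (x *> p).
  by move=> Ix; apply: sub_span; exists x, p.
split=> //.
- move=> r m; apply: (@span_sub _ _ [set m | span IP_gen (r *> m)]).
    split=> [|u v hu hv] /=; first by rewrite lact0.
    by rewrite lactBr; exact: sB.
  by move=> _ [x [p [Ix ->]]] /=; rewrite -lactM; apply: hIP; exact: Il.
- move=> m r; move: m; apply: (@span_sub _ _ [set m | span IP_gen (m <* r)]).
    split=> [|u v hu hv] /=; first by rewrite ract0.
    by rewrite ractBl; exact: sB.
  by move=> _ [x [p [Ix ->]]] /=; rewrite lractA; apply: hIP.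
- move=> m x Ix; have [_ [g [_ /finrankP_sum [s gE] _ gid]]] := FS [::] [:: m <* x].
  rewrite -(gid (m <* x)) ?mem_seq1 // gE.
  have sD u v : span IP_gen u -> span IP_gen v -> span IP_gen (u + v).
    by move=> hu hv; rewrite -[v]opprK; apply: (sB) => //; rewrite -sub0r; exact: sB.
  by apply: (big_ind (span IP_gen)) => // z _; apply: hIP; exact: Iinv.
Qed.

Lemma QI_compat : bquot_compat I QI_gen.
Proof.
have [[I0 IB] Il Ir] := Iid.
have [s0 sB] := span_zsubgroup QI_gen.
have hQI q x : I x -> span QI_gen (q <* x).
  by move=> Ix; apply: sub_span; exists q, x.
split=> //.
- move=> r m; apply: (@span_sub _ _ [set m | span QI_gen (r *> m)]).
    split=> [|u v hu hv] /=; first by rewrite lact0.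
    by rewrite lactBr; exact: sB.
  by move=> _ [x [p [Ix ->]]] /=; rewrite -lractA; apply: hQI.
- move=> m r; move: m; apply: (@span_sub _ _ [set m | span QI_gen (m <* r)]).
    split=> [|u v hu hv] /=; first by rewrite ract0.
    by rewrite ractBl; exact: sB.
  by move=> _ [x [p [Ix ->]]] /=; rewrite -ractM; apply: hQI; exact: Ir.
- move=> x m Ix; have [f [_ [/finrankQ_sum [s fE] _ fid _]]] := FS [:: x *> m] [::].
  rewrite -(fid (x *> m)) ?mem_seq1 // fE.
  have sD u v : span QI_gen u -> span QI_gen v -> span QI_gen (u + v).
    by move=> hu hv; rewrite -[v]opprK; apply: (sB) => //; rewrite -sub0r; exact: sB.
  apply: (big_ind (span QI_gen)) => // z _; apply: hQI.
  by rewrite -tens_bal; exact: Iinv.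
Qed.

Definition quotP : bimodType (rquot Iid) := bquot IP_compat.
Definition quotQ : bimodType (rquot Iid) := bquot QI_compat.
Definition projP : P -> quotP := bproj IP_compat.
Definition projQ : Q -> quotQ := bproj QI_compat.

Let projPK (p : quotP) : projP (zrepr p) = p. Proof. exact: zreprK. Qed.
Let projQK (q : quotQ) : projQ (zrepr q) = q. Proof. exact: zreprK. Qed.
Let projPD p p' : projP (p + p') = projP p + projP p'.
Proof. exact: raddfD. Qed.
Let projQD q q' : projQ (q + q') = projQ q + projQ q'.
Proof. exact: raddfD. Qed.
Let rprojD x y : rproj Iid (x + y) = rproj Iid x + rproj Iid y.
Proof. exact: raddfD. Qed.
Let projPl r p : projP (r *> p) = rproj Iid r *> projP p.
Proof. exact: bproj_lact. Qed.
Let projPr p r : projP (p <* r) = projP p <* rproj Iid r.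
Proof. exact: bproj_ract. Qed.
Let projQl r q : projQ (r *> q) = rproj Iid r *> projQ q.
Proof. exact: bproj_lact. Qed.
Let projQr q r : projQ (q <* r) = projQ q <* rproj Iid r.
Proof. exact: bproj_ract. Qed.
Let rprojM x y : rproj Iid (x ∙ y) = rproj Iid x ∙ rproj Iid y.
Proof. exact: rprojM. Qed.
Let rprojK (x : rquot Iid) : rproj Iid (zrepr x) = x. Proof. exact: zreprK. Qed.

Definition psi_quot : quotP ⊠ quotQ -> rquot Iid :=
  tlift (fun (p : quotP) (q : quotQ) =>
    rproj Iid (psi ((zrepr p : P) ⊗ (zrepr q : Q)))).

Let psi_repr p q :
  rproj Iid (psi ((zrepr (projP p) : P) ⊗ (zrepr (projQ q) : Q))) =
  rproj Iid (psi (p ⊗ q)).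
Proof.
have [[I0 IB] Il Ir] := Iid.
set p' : P := zrepr (projP p); set q' : Q := zrepr (projQ q).
have psiBl (u v : P) (w : Q) : psi ((u - v) ⊗ w) = psi (u ⊗ w) - psi (v ⊗ w) :> R.
  by apply: (addIr (psi (v ⊗ w))); rewrite -psiD -tensDl !addrNK.
have psiBr (u v : Q) (w : P) : psi (w ⊗ (u - v)) = psi (w ⊗ u) - psi (w ⊗ v) :> R.
  by apply: (addIr (psi (w ⊗ v))); rewrite -psiD -tensDr !addrNK.
have hp : span IP_gen (p' - p) by apply/(bproj_eqP IP_compat); exact: (projPK (projP p)).
have hq : span QI_gen (q - q') 
  by apply/(bproj_eqP QI_compat); exact: (esym (projQK (projQ q))).
apply/rproj_eqP.
have -> : psi (p' ⊗ q') - psi (p ⊗ q) =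
    psi ((p' - p) ⊗ q) - psi (p' ⊗ (q - q')).
  by rewrite psiBl psiBr opprB [RHS]addrC addrA addrNK.
apply: (IB).
  move: (p' - p) hp; apply: (@span_sub _ _ [set m | I (psi (m ⊗ q))]).
    split=> [|u v hu hv] /=; last by rewrite psiBl; exact: IB.
    by have := psiBl 0 0 q; rewrite !subrr => ->.
  by move=> _ [x [p1 [Ix ->]]] /=; rewrite psi_lact; exact: Ir.
move: (q - q') hq; apply: (@span_sub _ _ [set m | I (psi (p' ⊗ m))]).
  split=> [|u v hu hv] /=; last by rewrite psiBr; exact: IB.
  by have := psiBr 0 0 p'; rewrite !subrr => ->.
by move=> _ [q1 [x [Ix ->]]] /=; rewrite psi_ract; exact: Il.
Qed.

Let psi_quot_bal : balanced (fun (p : quotP) (q : quotQ) =>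
  rproj Iid (psi ((zrepr p : P) ⊗ (zrepr q : Q)))).
Proof.
split=> [p p' q|p q q'|p r q].
- have -> : p + p' = projP ((zrepr p : P) + zrepr p').
    by rewrite projPD !projPK.
  rewrite -{1}(projQK q) psi_repr.
  by rewrite tensDl psiD rprojD.
- have -> : q + q' = projQ ((zrepr q : Q) + zrepr q').
    by rewrite projQD !projQK.
  rewrite -{1}(projPK p) psi_repr.
  by rewrite tensDr psiD rprojD.
- rewrite -(projPK p) -(projQK q) -(rprojK r) -projPr -projQl !psi_repr.
  by rewrite tens_bal.
Qed.

Lemma psi_quotE p q :
  psi_quot (projP p ⊗ projQ q) = rproj Iid (psi (p ⊗ q)).
Proof. by rewrite /psi_quot (tliftE psi_quot_bal) psi_repr. Qed.

Lemma psi_quot_hom : bimod_hom (psi_quot : quotP ⊠ quotQ -> regular (rquot Iid)).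
Proof.
have psiqB : zmod_morphism psi_quot by exact: tliftB.
split=> [|r|t r]; first exact: tliftD.
- apply: (tlift_ext (g := fun t => psi_quot (r *> t))
                    (h := fun t => r ∙ psi_quot t)).
  + by move=> u v; rewrite lactBr psiqB.
  + by move=> u v; rewrite psiqB rngBr.
  + move=> p q; rewrite lact_tens -(projPK p) -(projQK q) -(rprojK r).
    by rewrite -projPl !psi_quotE psi_lact rprojM.
- move: t; apply: (tlift_ext (g := fun t => psi_quot (t <* r))
                    (h := fun t => psi_quot t ∙ r)).
  + by move=> u v; rewrite ractBl psiqB.
  + by move=> u v; rewrite psiqB rngBl.
  + move=> p q; rewrite ract_tens -(projPK p) -(projQK q) -(rprojK r).
    by rewrite -projQr !psi_quotE psi_ract rprojM.
Qed.

Definition quot_system : rsystem (rquot Iid) := RSystem psi_quot_hom.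

End QuotientSystem.

Section TPairs.
Variables (R : rngType) (X : rsystem R) (FS : condition_FS X).

Definition T_pair (I J : set R) :=
  [/\ is_ideal J, I `<=` J &
    exists (Iid : is_ideal I) (Iinv : psi_invariant X I),
      faithful_psi_compatible (quot_system FS Iid Iinv) (rproj Iid @` J)].

Definition super_maximal (J : set R) :=
  forall I J' : set R, T_pair I J' -> J `<=` J' ->
    (I = [set 0] /\ J' = J) \/ (I = setT /\ J' = setT).

End TPairs.

(* Main.v *)
From HB Require Import structures.
From mathcomp Require Import all_boot all_order all_algebra.
From mathcomp Require Import boolp classical_sets functions.
Require Import Defs.
Set Implicit Arguments.
Unset Strict Implicit.
Unset Printing Implicit Defensive.
Import Order.TTheory GRing.Theory Num.Theory.
Local Open Scope ring_scope.
Local Open Scope classical_set_scope.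

(** Every ideal K of O is the kernel of the map O -> O/K, so the ideals of O are
   studied through the covariant representations v that factor through O.

   Super maximality controls a representation in degree zero. The ideals
   ker(sigma_v) and {r | sigma_v(r) in T_v(Q)S_v(P)} always form a T-pair
   ([rep_T_pair]). So if J is super maximal and v is non-zero and
   Cuntz-Pimsner invariant relative to J, then sigma_v is injective and
   sigma_v(r) lies in T_v(Q)S_v(P) only for r in J. An element a of degree
   zero that is mapped to 0 is moved towards sigma(R) by the compressions
   S(p) a T(q), and these two facts make it vanish ([homog0_inj]). Hence
   an ideal other than O misses the degree-zero part, and the intersection
   property of that part gives simplicity ([degree0_IIP_simple]).

   Conversely, a T-pair (I, J') is realized by a Fock representation of the
   quotient system. It is obtained from the usual operators on sequences in the
   tensor powers of Q by dividing out the finitely supported sequences with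
   values in Q^n J'. If O is simple and J is contained in J', then O is mapped
   to 0 by this representation and I = R, or it is mapped injectively. In the
   second case I = 0, and J' = J because sigma(r) lies in T(Q)S(P) only for r in
   J, as the Fock representation of the system itself shows ([CP_ring_cov]). So
   J is super maximal ([simple_super_maximal]).

   Condition (L) controls the other degrees. Let K be a non-zero ideal that
   misses degree zero. Among the non-zero families of homogeneous elements
   with sum in K, take one with the fewest members and translate it so that
   its lowest degree is 0. By minimality each member determines the others.
   Compressions lead to a family with sigma(r) in degree 0 and some T^n(y) in
   another degree n, and r |-> y is then a psi-invariant cycle
   ([condition_L_ideal0]). In the other direction, let O be simple and let
   eta be a non-zero cycle with values in Q^n. Then T^n(eta(x)) behaves like
   c sigma(x), where c is central, invertible and of degree n. Let elements of
   degree d act on the functions f from the integers to O by left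
   multiplication and a translation by d. On those f that satisfy
   f(k) = c f(k - n), sigma(x) and T^n(eta(x)) act in the same way, so
   the elements that kill all such f form an ideal that is neither 0 nor O
   ([simple_no_cycle]). *)

(** * Subgroups and ideals *)

Section Subgroups.
Variable V : zmodType.
Implicit Types (A : set V) (X : set V).

Lemma zsubgroupN A u : zsubgroup A -> A u -> A (- u).
Proof. by move=> [A0 AB] Au; rewrite -sub0r; exact: AB. Qed.

Lemma zsubgroupD A u v : zsubgroup A -> A u -> A v -> A (u + v).
Proof.
by move=> zA Au Av; rewrite -[v]opprK; apply: zA.2 => //; exact: zsubgroupN.
Qed.

Lemma zsubgroup_sum A (I : eqType) (s : seq I) (F : I -> V) :
  zsubgroup A -> (forall i, i \in s -> A (F i)) -> A (\sum_(i <- s) F i).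
Proof.
move=> zA AF; rewrite big_seq; apply: (big_ind A) => //; first exact: zA.1.
by move=> u v; exact: zsubgroupD.
Qed.

Lemma span_sum X (I : eqType) (s : seq I) (F : I -> V) :
  (forall i, i \in s -> span X (F i)) -> span X (\sum_(i <- s) F i).
Proof. by apply: zsubgroup_sum; exact: span_zsubgroup. Qed.

Lemma zsubgroup_mulrz A u (k : int) : zsubgroup A -> A u -> A (u *~ k).
Proof.
move=> zA Au; have An m : A (u *+ m).
  by elim: m => [|m IHm]; [exact: zA.1|rewrite mulrS; exact: zsubgroupD].
by case: k => m; [exact: An|apply: zsubgroupN => //; exact: An].
Qed.

Lemma zsubgroup_preim (W : zmodType) (f : {additive V -> W}) (B : set W) :
  zsubgroup B -> zsubgroup (f @^-1` B).
Proof.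
move=> [B0 BB]; split=> [|u v] /=; first by rewrite raddf0.
by rewrite raddfB; exact: BB.
Qed.

Lemma zsubgroup_set0 : zsubgroup [set (0 : V)].
Proof. by split=> // u v -> ->; rewrite /= subr0. Qed.

Lemma zsubgroup_range (W : zmodType) (f : {additive W -> V}) :
  zsubgroup (range f).
Proof.
split=> [|_ _ [u _ <-] [v _ <-]]; first by exists 0; rewrite ?raddf0.
by exists (u - v); rewrite ?raddfB.
Qed.

End Subgroups.

Lemma span_morph (V W : zmodType) (f : {additive V -> W}) (X : set V)
    (Y : set W) :
  (forall x, X x -> span Y (f x)) -> forall x, span X x -> span Y (f x).
Proof.
move=> h; apply: (@span_sub _ X (f @^-1` span Y)) => //.
by apply: zsubgroup_preim; exact: span_zsubgroup.
Qed.

HB.instance Definition _ (R : rngType) (x : R) :=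
  GRing.isZmodMorphism.Build R R (monoid.mul x) (rngBr x).

Definition mulrr (R : rngType) (x y : R) := y ∙ x.
HB.instance Definition _ (R : rngType) (x : R) :=
  GRing.isZmodMorphism.Build R R (mulrr x) (fun y z => rngBl y z x).

Lemma rngNl (R : rngType) (x y : R) : - x ∙ y = - (x ∙ y).
Proof. exact: (raddfN (mulrr y)). Qed.

Lemma rngNr (R : rngType) (x y : R) : x ∙ - y = - (x ∙ y).
Proof. exact: (raddfN (monoid.mul x)). Qed.

Lemma lact0l (R : rngType) (M : bimodType R) (m : M) : (0 : R) *> m = 0.
Proof. by rewrite -(subrr 0) lactBl subrr. Qed.

Lemma ract0r (R : rngType) (M : bimodType R) (m : M) : m <* (0 : R) = 0.
Proof. by rewrite -(subrr 0) ractBr subrr. Qed.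

Section Tens.
Variables (R : rngType) (M N : bimodType R).
Implicit Types (m : M) (n : N).

Lemma tensBr m n n' : m ⊗ (n - n') = m ⊗ n - m ⊗ n'.
Proof. by apply: (addIr (m ⊗ n')); rewrite -tensDr !addrNK. Qed.

Lemma tens0r m : m ⊗ (0 : N) = 0.
Proof. by rewrite -(subrr 0) tensBr subrr. Qed.

Lemma tens_suml (I : Type) (s : seq I) (F : I -> M) n :
  (\sum_(i <- s) F i) ⊗ n = \sum_(i <- s) F i ⊗ n.
Proof.
apply: (big_morph (fun m => m ⊗ n) (fun m m' => tensDl m m' n)).
by apply: (addIr (0 ⊗ n)); rewrite -tensDl !add0r.
Qed.
End Tens.

Section Ideals.
Variable R : rngType.
Implicit Types (I K : set R) (x y : R).

Lemma ideal_zsub I : is_ideal I -> zsubgroup I. Proof. by case. Qed.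
Lemma idealMl I r x : is_ideal I -> I x -> I (r ∙ x).
Proof. by case=> _ h _; exact: h. Qed.
Lemma idealMr I r x : is_ideal I -> I x -> I (x ∙ r).
Proof. by case=> _ _ h; exact: h. Qed.

Lemma simple_ideal K x : simple_rng R -> is_ideal K -> K x -> x <> 0 -> K = setT.
Proof. by move=> sR /sR [->|->]. Qed.

End Ideals.

Section RngMorphisms.
Variables (A B : rngType) (f : {rngmorphism A -> B}).

Lemma rmM x y : f (x ∙ y) = f x ∙ f y. Proof. exact: gmulfM. Qed.

Lemma rker_ideal : is_ideal [set x | f x = 0].
Proof.
split=> [|r x /= fx|x r /= fx]; last 2 first.
- by rewrite rmM fx rng0r.
- by rewrite rmM fx rng0l.
apply: (@zsubgroup_preim _ _ f [set 0]); exact: zsubgroup_set0.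
Qed.

Lemma rker_inj : [set x | f x = 0] = [set 0] -> injective f.
Proof.
move=> h x y fxy; apply/eqP; rewrite -subr_eq0; apply/eqP.
have : [set x | f x = 0] (x - y).
  by rewrite /= raddfB; apply/eqP; rewrite subr_eq0; apply/eqP.
by rewrite h.
Qed.

End RngMorphisms.

Lemma image_ideal (A C : rngType) (f : {rngmorphism A -> C}) (I : set A) :
  (forall y, exists x, f x = y) -> is_ideal I -> is_ideal (f @` I).
Proof.
move=> fsurj [[I0 IB] Il Ir]; split; first split.
- by exists 0; rewrite ?raddf0.
- move=> _ _ [x Ix <-] [y Iy <-]; exists (x - y); first exact: IB.
  by rewrite raddfB.
- move=> r _ [x Ix <-]; have [s <-] := fsurj r.
  by exists (s ∙ x); rewrite ?rmM //; exact: Il.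
- move=> _ r [x Ix <-]; have [s <-] := fsurj r.
  by exists (x ∙ s); rewrite ?rmM //; exact: Ir.
Qed.

Section RprojTheory.
Variables (R : rngType) (I : set R) (iI : is_ideal I).

Lemma rproj_surj (y : rquot iI) : exists x, rproj iI x = y.
Proof. by exists (zrepr y); exact: zreprK. Qed.

Lemma rproj_eq0 x : rproj iI x = 0 <-> I x.
Proof. by rewrite -(raddf0 (rproj iI)) rproj_eqP subr0. Qed.

End RprojTheory.

(** * The ring of additive endomorphisms *)

Record zendo (V : zmodType) := Zendo {
  zfun :> V -> V;
  zfunB : zmod_morphism zfun
}.
HB.instance Definition _ V := gen_eqMixin (zendo V).
HB.instance Definition _ V := gen_choiceMixin (zendo V).

Section Zendo.
Variable V : zmodType.
Implicit Types a b c : zendo V.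

Lemma zendoP a b : a =1 b -> a = b.
Proof.
case: a b => [f fB] [g gB] /= /funext fg; rewrite fg in fB *.
by congr Zendo; exact: Prop_irrelevance.
Qed.

Fact zendo_zero_proof : zmod_morphism (fun _ : V => 0 : V).
Proof. by move=> x y; rewrite subr0. Qed.
Definition zendo_zero := Zendo zendo_zero_proof.
Fact zendo_opp_proof a : zmod_morphism (fun x => - a x).
Proof. by move=> x y; rewrite zfunB opprD. Qed.
Definition zendo_opp a := Zendo (zendo_opp_proof a).
Fact zendo_add_proof a b : zmod_morphism (fun x => a x + b x).
Proof. by move=> x y; rewrite !zfunB opprD addrACA. Qed.
Definition zendo_add a b := Zendo (zendo_add_proof a b).
Fact zendo_mul_proof a b : zmod_morphism (fun x => a (b x)).
Proof. by move=> x y; rewrite !zfunB. Qed.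
Definition zendo_mul a b := Zendo (zendo_mul_proof a b).

Let zaddA : associative zendo_add.
Proof. by move=> a b c; apply: zendoP => x /=; rewrite addrA. Qed.
Let zaddC : commutative zendo_add.
Proof. by move=> a b; apply: zendoP => x /=; rewrite addrC. Qed.
Let zadd0 : left_id zendo_zero zendo_add.
Proof. by move=> a; apply: zendoP => x /=; rewrite add0r. Qed.
Let zaddN : left_inverse zendo_zero zendo_opp zendo_add.
Proof. by move=> a; apply: zendoP => x /=; rewrite addNr. Qed.
HB.instance Definition _ := GRing.isZmodule.Build (zendo V) zaddA zaddC zadd0 zaddN.

Let zmulA : associative zendo_mul.
Proof. by move=> a b c; apply: zendoP. Qed.
HB.instance Definition _ := isSemigroup.Build (zendo V) zmulA.

Lemma zendoDE a b x : (a + b) x = a x + b x. Proof. by []. Qed.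
Lemma zendoME a b x : (a ∙ b) x = a (b x). Proof. by []. Qed.
HB.instance Definition _ a := GRing.isZmodMorphism.Build V V (zfun a) (@zfunB V a).

Let zmulDl a b c : (a + b) ∙ c = a ∙ c + b ∙ c.
Proof. by apply: zendoP. Qed.
Let zmulDr a b c : a ∙ (b + c) = a ∙ b + a ∙ c.
Proof. by apply: zendoP => x; rewrite zendoDE !zendoME zendoDE raddfD. Qed.
HB.instance Definition _ := Zmodule_Semigroup_isRng.Build (zendo V) zmulDl zmulDr.

Lemma zendoBE a b x : (a - b) x = a x - b x. Proof. by []. Qed.

Lemma zendo_sumE (I : Type) (s : seq I) (F : I -> zendo V) x :
  (\sum_(i <- s) F i) x = \sum_(i <- s) F i x.
Proof. by elim/big_rec2: _ => // i y z _ <-. Qed.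

End Zendo.

(** * Local units and homogeneous elements *)

Section System.
Variables (R : rngType) (X : rsystem R) (FS : condition_FS X).
Local Notation P := (sysP X).
Local Notation Q := (sysQ X).

Lemma fs_unitQ (qs : seq Q) : exists s : seq (Q * P),
  {in qs, forall q, \sum_(z <- s) z.1 <* psi (z.2 ⊗ q) = q}.
Proof.
have [f [_ [/finrankQ_sum [s fE] _ fid _]]] := FS qs [::].
by exists s => q qqs; rewrite -fE fid.
Qed.

Lemma fs_unitP (ps : seq P) : exists s : seq (P * Q),
  {in ps, forall p, \sum_(z <- s) psi (p ⊗ z.2) *> z.1 = p}.
Proof.
have [_ [g [_ /finrankP_sum [s gE] _ gid]]] := FS [::] ps.
by exists s => p pps; rewrite -gE gid.
Qed.

Lemma psi_nondegQ (q : Q) : (forall p : P, psi (p ⊗ q) = 0) -> q = 0.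
Proof.
move=> h; have [s /(_ q (mem_head _ _)) <-] := fs_unitQ [:: q].
by rewrite big1 // => z _; rewrite h ract0r.
Qed.

Lemma contract_balanced (M : bimodType R) (p : P) :
  balanced (fun (q : Q) (y : M) => psi (p ⊗ q) *> y).
Proof.
split=> [q1 q2 z|q1 z z'|q1 r z].
- by rewrite tensDr psiD lactDl.
- by rewrite lactDr.
- by rewrite psi_ract lactM.
Qed.

Lemma finrankQ_seq (f : Q -> Q) : finrankQ f ->
  exists s : seq (Q * P), f = \sum_(z <- s) thetaQ z.1 z.2.
Proof.
move=> /finrankQ_sum [s fE]; exists s.
by apply/funext => x; rewrite fE fct_sumE.
Qed.

Lemma Delta_seq (J : set R) x : faithful_psi_compatible X J -> J x ->
  exists s : seq (Q * P), Delta x = \sum_(z <- s) thetaQ z.1 z.2.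
Proof. by move=> [[_ cJ] _] Jx; apply: finrankQ_seq; apply: cJ; exists x. Qed.

Lemma finrankQ_of_seq (s : seq (Q * P)) :
  finrankQ (\sum_(z <- s) thetaQ z.1 z.2).
Proof. by apply: span_sum => z _; apply: sub_span; exists z.1, z.2. Qed.

End System.

Section Representation.
Variables (R : rngType) (X : rsystem R) (FS : condition_FS X).
Variables (O : rngType) (u : covrep X O).
Local Notation P := (sysP X).
Local Notation Q := (sysQ X).
Local Notation S := (repS u).
Local Notation T := (repT u).
Local Notation sigma := (repsigma u).
Implicit Types (a b e : O) (p : P) (q : Q) (r : R).

Lemma repS_eq0 : (forall r, sigma r = 0) -> forall p, S p = 0.
Proof.
move=> s0 p; have [s /(_ p (mem_head _ _)) <-] := fs_unitP FS [:: p].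
by rewrite raddf_sum big1 // => z _; rewrite repS_lact s0 rng0l.
Qed.

Lemma repT_eq0 : (forall r, sigma r = 0) -> forall q, T q = 0.
Proof.
move=> s0 q; have [s /(_ q (mem_head _ _)) <-] := fs_unitQ FS [:: q].
by rewrite raddf_sum big1 // => z _; rewrite repT_ract s0 rng0r.
Qed.

(** The image of F_P(Q) under pi_{T,S}. *)
Definition TSspan : set O := span [set b | exists q p, b = T q ∙ S p].

Lemma TSspan_seq a : TSspan a -> exists s : seq (Q * P),
  a = \sum_(z <- s) T z.1 ∙ S z.2.
Proof.
apply: (@span_sub _ _ [set a | exists s : seq (Q * P),
  a = \sum_(z <- s) T z.1 ∙ S z.2]) => [|_ [q [p ->]]]; last first.
  by exists [:: (q, p)]; rewrite big_seq1.
split=> [|_ _ [s1 ->] [s2 ->]]; first by exists [::]; rewrite big_nil.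
exists (s1 ++ [seq (- z.1, z.2) | z <- s2]).
rewrite big_cat big_map /= -sumrN; congr (_ + _); apply: eq_bigr => z _.
by rewrite raddfN rngNl.
Qed.

Lemma TSspan_of_seq (s : seq (Q * P)) : TSspan (\sum_(z <- s) T z.1 ∙ S z.2).
Proof. by apply: span_sum => z _; apply: sub_span; exists z.1, z.2. Qed.

Lemma unitT (qs : seq Q) : exists2 e, TSspan e &
  forall q, q \in qs -> e ∙ T q = T q.
Proof.
have [s h] := fs_unitQ FS qs; exists (\sum_(z <- s) T z.1 ∙ S z.2).
  exact: TSspan_of_seq.
move=> q /h {2}<-; rewrite raddf_sum rng_suml; apply: eq_bigr => z _.
by rewrite -mulgA -rep_psi repT_ract.
Qed.

Lemma unitS (ps : seq P) : exists2 e, TSspan e &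
  forall p, p \in ps -> S p ∙ e = S p.
Proof.
have [s h] := fs_unitP FS ps; exists (\sum_(z <- s) T z.2 ∙ S z.1).
  by apply: span_sum => z _; apply: sub_span; exists z.2, z.1.
move=> p /h {2}<-; rewrite rng_sumr raddf_sum; apply: eq_bigr => z _.
by rewrite mulgA -rep_psi repS_lact.
Qed.

(** Left-unital elements, those of T(Q) O: they are fixed by all sufficiently
   large local units, where large refers to the T(q) that are fixed. Naming
   the finite set of q instead of one local unit makes it possible to fix
   several elements with the same local unit. *)
Definition lunital a := exists qs : seq Q,
  forall e, (forall q, q \in qs -> e ∙ T q = T q) -> e ∙ a = a.
Definition runital a := exists ps : seq P,
  forall e, (forall p, p \in ps -> S p ∙ e = S p) -> a ∙ e = a.

Lemma lunital_seq (I : eqType) (s : seq I) (F : I -> O) :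
  (forall i, i \in s -> lunital (F i)) ->
  exists2 e, TSspan e & forall i, i \in s -> e ∙ F i = F i.
Proof.
suff h : (forall i, i \in s -> lunital (F i)) -> exists qs : seq Q, forall e,
    (forall q, q \in qs -> e ∙ T q = T q) -> forall i, i \in s -> e ∙ F i = F i.
  by move=> /h [qs qsP]; have [e eTS eq] := unitT qs; exists e => //; exact: qsP.
elim: s => [|i s IHs] h; first by exists [::].
have [|qs qsP] := IHs; first by move=> j js; apply: h; rewrite inE js orbT.
have [qs' qs'P] := h i (mem_head _ _).
exists (qs' ++ qs) => e eP j; rewrite inE => /orP[/eqP ->|].
  by apply: qs'P => q qq; apply: eP; rewrite mem_cat qq.
by apply: qsP => q qq; apply: eP; rewrite mem_cat qq orbT.
Qed.

Lemma lunital1 a : lunital a -> exists2 e, TSspan e & e ∙ a = a.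
Proof.
move=> la; have [e eTS eP] := @lunital_seq unit [:: tt] (fun _ => a) (fun _ _ => la).
by exists e => //; apply: (eP tt).
Qed.

Lemma runital1 a : runital a -> exists2 e, TSspan e & a ∙ e = a.
Proof. by move=> [ps psP]; have [e eTS /psP] := unitS ps; exists e. Qed.

Lemma lunital_zsub : zsubgroup lunital.
Proof.
split=> [|a b [qs ha] [qs' hb]]; first by exists [::] => e _; rewrite rng0r.
exists (qs ++ qs') => e he; rewrite rngBr ha ?hb // => q hq;
  by apply: he; rewrite mem_cat hq ?orbT.
Qed.

Lemma runital_zsub : zsubgroup runital.
Proof.
split=> [|a b [qs ha] [qs' hb]]; first by exists [::] => e _; rewrite rng0l.
exists (qs ++ qs') => e he; rewrite rngBl ha ?hb // => q hq;
  by apply: he; rewrite mem_cat hq ?orbT.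
Qed.

Lemma lunitalT q a : lunital (T q ∙ a).
Proof. by exists [:: q] => e he; rewrite mulgA he ?mem_head. Qed.
Lemma lunitalMr a b : lunital a -> lunital (a ∙ b).
Proof. by move=> [qs h]; exists qs => e he; rewrite mulgA h. Qed.
Lemma runitalS p a : runital (a ∙ S p).
Proof. by exists [:: p] => e he; rewrite -mulgA he ?mem_head. Qed.
Lemma runitalMl a b : runital a -> runital (b ∙ a).
Proof. by move=> [qs h]; exists qs => e he; rewrite -mulgA h. Qed.

Lemma TSspan_lunital a : TSspan a -> lunital a.
Proof.
apply: span_sub; first exact: lunital_zsub.
by move=> _ [q [p ->]]; exact: lunitalT.
Qed.

Lemma TSspan_runital a : TSspan a -> runital a.
Proof.
apply: span_sub; first exact: runital_zsub.
by move=> _ [q [p ->]]; exact: runitalS.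
Qed.

Lemma TSspan_sigmaMr a r : TSspan a -> TSspan (a ∙ sigma r).
Proof.
apply: (@span_morph _ _ (mulrr (sigma r))) => _ [q [p ->]]; apply: sub_span.
by exists q, (p <* r); rewrite /mulrr repS_ract mulgA.
Qed.

Lemma TSspan_sigmaMl a r : TSspan a -> TSspan (sigma r ∙ a).
Proof.
apply: (@span_morph _ _ (monoid.mul (sigma r))) => _ [q [p ->]]; apply: sub_span.
by exists (r *> q), p; rewrite repT_lact /= mulgA.
Qed.

Lemma lunital_sigma r : lunital (sigma r) -> TSspan (sigma r).
Proof. by move=> /lunital1 [e eTS <-]; exact: TSspan_sigmaMr. Qed.

(** Local units e and f with a = e a f write a as a sum of terms
   T(q) (S(p) a T(q')) S(p'). *)
Lemma compress0 a : lunital a -> runital a ->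
  (forall p q, S p ∙ a ∙ T q = 0) -> a = 0.
Proof.
move=> /lunital1 [e /TSspan_seq [s es] ea] /runital1 [f /TSspan_seq [t ft] af] h.
rewrite -ea -af es ft rng_suml big1 // => z _.
rewrite !rng_sumr big1 // => w _.
by rewrite -mulgA (mulgA a) (mulgA (S _)) (mulgA (S _) a) h rng0l rng0r.
Qed.

(** Homogeneous elements for the grading in which T(q) has degree 1, sigma(r)
   degree 0 and S(p) degree -1. Adding new factors only on these two sides
   suffices because S(p)T(q) lies in sigma(R). *)
Inductive homog : int -> O -> Prop :=
| homog_sigma r : homog 0 (sigma r)
| homogT q d a : homog d a -> homog (d + 1) (T q ∙ a)
| homogS p d a : homog d a -> homog (d - 1) (a ∙ S p)
| homogB d a b : homog d a -> homog d b -> homog d (a - b)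
| homog0 d : homog d 0.

Lemma homog_zsub d : zsubgroup (homog d).
Proof. by split=> [|a b]; [exact: homog0|exact: homogB]. Qed.

Lemma homog_sigmaMl r d a : homog d a -> homog d (sigma r ∙ a).
Proof.
elim=> {d a} [s|q d a ha IHa|p d a ha IHa|d a b _ IHa _ IHb|d].
- by rewrite -rmM; exact: homog_sigma.
- by rewrite mulgA -repT_lact; exact: homogT.
- by rewrite mulgA; exact: homogS.
- by rewrite rngBr; exact: homogB.
- by rewrite rng0r; exact: homog0.
Qed.

Lemma homog_sigmaMr r d a : homog d a -> homog d (a ∙ sigma r).
Proof.
elim=> {d a} [s|q d a ha IHa|p d a ha IHa|d a b _ IHa _ IHb|d].
- by rewrite -rmM; exact: homog_sigma.
- by rewrite -mulgA; exact: homogT.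
- by rewrite -mulgA -repS_ract; exact: homogS.
- by rewrite rngBl; exact: homogB.
- by rewrite rng0l; exact: homog0.
Qed.

Lemma homogT1 q : homog 1 (T q).
Proof.
have [s /(_ q (mem_head _ _)) <-] := fs_unitQ FS [:: q].
rewrite raddf_sum; apply: zsubgroup_sum; first exact: homog_zsub.
by move=> z _; rewrite repT_ract; apply: (@homogT _ 0); exact: homog_sigma.
Qed.

Lemma homogS1 p : homog (-1) (S p).
Proof.
have [s /(_ p (mem_head _ _)) <-] := fs_unitP FS [:: p].
rewrite raddf_sum; apply: zsubgroup_sum; first exact: homog_zsub.
by move=> z _; rewrite repS_lact; apply: (@homogS _ 0); exact: homog_sigma.
Qed.

Lemma homogSl p d a : homog d a -> homog (d - 1) (S p ∙ a).
Proof.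
elim=> {d a} [s|q d a ha IHa|p' d a ha IHa|d a b _ IHa _ IHb|d].
- by rewrite -repS_ract sub0r; exact: homogS1.
- by rewrite mulgA -rep_psi addrK; exact: homog_sigmaMl.
- by rewrite mulgA; exact: homogS.
- by rewrite rngBr; exact: homogB.
- by rewrite rng0r; exact: homog0.
Qed.

Lemma homogTr q d a : homog d a -> homog (d + 1) (a ∙ T q).
Proof.
elim=> {d a} [s|q' d a ha IHa|p' d a ha IHa|d a b _ IHa _ IHb|d].
- by rewrite -repT_lact add0r; exact: homogT1.
- by rewrite -mulgA; exact: homogT.
- by rewrite -mulgA -rep_psi subrK; exact: homog_sigmaMr.
- by rewrite rngBl; exact: homogB.
- by rewrite rng0l; exact: homog0.
Qed.

Lemma homog_compress p q d a : homog d a -> homog d (S p ∙ a ∙ T q).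
Proof. by move=> /(homogSl p) /(homogTr q); rewrite subrK. Qed.

(** A word with factors of both kinds starts with some T(q) and ends with some
   S(p); the other words have one kind of factor only, which the sign of the
   degree tells. *)
Lemma homog_unital d a : homog d a ->
  [/\ 0 < d -> lunital a, d < 0 -> runital a &
    d = 0 -> exists r, lunital (a - sigma r) /\ runital (a - sigma r)].
Proof.
have [l0 lB] := lunital_zsub; have [r0 rB] := runital_zsub.
elim=> {d a} [s|q d a ha [IHl IHr IH0]|p d a ha [IHl IHr IH0]|
  d a b ha [al ar a0] hb [bl br b0]|d].
- by split=> // _; exists s; rewrite subrr.
- split=> [_|d1|d1]; first exact: lunitalT.
    by apply: runitalMl; apply: IHr; rewrite (lt_trans _ d1) // ltrDl.
  exists 0; rewrite raddf0 subr0; split; first exact: lunitalT.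
  apply: runitalMl; apply: IHr; have /eqP := d1; rewrite addr_eq0 => /eqP ->.
  by rewrite oppr_lt0.
- split=> [d1|_|d1]; last 2 first.
  + exact: runitalS.
  + exists 0; rewrite raddf0 subr0; split; last exact: runitalS.
    apply: lunitalMr; apply: IHl; have /eqP := d1; rewrite subr_eq0 => /eqP ->.
    exact: ltr01.
  by apply: lunitalMr; apply: IHl; rewrite (lt_trans d1) // ltrBlDr ltrDl.
- split=> [h|h|h]; [by apply: lB; [exact: al|exact: bl]|
    by apply: rB; [exact: ar|exact: br]|].
  have [r [rl rr]] := a0 h; have [s [sl sr]] := b0 h.
  exists (r - s); have -> : a - b - sigma (r - s) = (a - sigma r) - (b - sigma s).
    by rewrite raddfB !opprD !opprK !addrA; congr (_ + _); rewrite addrAC.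
  by split; [exact: lB|exact: rB].
- by split=> // _; exists 0; rewrite raddf0 subr0.
Qed.

Fixpoint Ncompress (A : set O) (m : nat) (a : O) : Prop :=
  if m is m'.+1 then forall p q, Ncompress A m' (S p ∙ a ∙ T q) else A a.

Lemma Ncompress_zsub A m : zsubgroup A -> zsubgroup (Ncompress A m).
Proof.
move=> [A0 AB]; elim: m => [|m [IH0 IHB]] //=; split=> [p q|a b ha hb p q].
  by rewrite rng0r rng0l.
by rewrite rngBr rngBl; exact: IHB.
Qed.

End Representation.

(** * Pure words and compressions *)

Section Words.
Variables (R : rngType) (X : rsystem R) (FS : condition_FS X).
Variables (O : rngType) (u : covrep X O).
Local Notation P := (sysP X).
Local Notation Q := (sysQ X).
Local Notation S := (repS u).
Local Notation T := (repT u).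
Local Notation sigma := (repsigma u).
Implicit Types (a b e : O) (p : P) (q : Q) (r : R).

Fixpoint Tword (n : nat) : set O :=
  if n is n'.+1 then span [set b | exists q a, Tword n' a /\ b = T q ∙ a]
  else range sigma.
Fixpoint Sword (n : nat) : set O :=
  if n is n'.+1 then span [set b | exists p a, Sword n' a /\ b = a ∙ S p]
  else range sigma.

(** The elements of degree d that are not mixed: T^d(Q^d) for d > 0,
   sigma(R) for d = 0 and S^(-d)(P^(-d)) for d < 0. *)
Definition pureword (d : int) : set O :=
  match d with Posz n => Tword n | Negz n => Sword n.+1 end.

Lemma Tword_zsub n : zsubgroup (Tword n).
Proof. by case: n => [|n]; [exact: zsubgroup_range|exact: span_zsubgroup]. Qed.
Lemma Sword_zsub n : zsubgroup (Sword n).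
Proof. by case: n => [|n]; [exact: zsubgroup_range|exact: span_zsubgroup]. Qed.
Lemma pureword_zsub d : zsubgroup (pureword d).
Proof. by case: d => n; [exact: Tword_zsub|exact: (Sword_zsub n.+1)]. Qed.

Lemma Tword_sigmal r n a : Tword n a -> Tword n (sigma r ∙ a).
Proof.
case: n => [|n] /=; first by move=> [s _ <-]; exists (r ∙ s); rewrite ?rmM.
apply: (@span_morph _ _ (monoid.mul (sigma r))) => _ [q [b [hb ->]]].
by apply: sub_span; exists (r *> q), b; rewrite repT_lact /= mulgA.
Qed.

Lemma Sword_sigmar r n a : Sword n a -> Sword n (a ∙ sigma r).
Proof.
case: n => [|n] /=; first by move=> [s _ <-]; exists (s ∙ r); rewrite ?rmM.
apply: (@span_morph _ _ (mulrr (sigma r))) => _ [p [b [hb ->]]].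
by apply: sub_span; exists (p <* r), b; rewrite repS_ract /mulrr mulgA.
Qed.

Lemma Tword1 q : Tword 1 (T q).
Proof.
have [s /(_ q (mem_head _ _)) <-] := fs_unitQ FS [:: q].
rewrite raddf_sum; apply: span_sum => z _; apply: sub_span.
by exists z.1, (sigma (psi (z.2 ⊗ q))); split; [exists (psi (z.2 ⊗ q))|rewrite repT_ract].
Qed.

Lemma Sword1 p : Sword 1 (S p).
Proof.
have [s /(_ p (mem_head _ _)) <-] := fs_unitP FS [:: p].
rewrite raddf_sum; apply: span_sum => z _; apply: sub_span.
by exists z.1, (sigma (psi (p ⊗ z.2))); split; [exists (psi (p ⊗ z.2))|rewrite repS_lact].
Qed.

Lemma TwordT q n a : Tword n a -> Tword n.+1 (a ∙ T q).
Proof.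
elim: n a => [|n IHn] a; first by move=> [r _ <-]; rewrite -repT_lact; exact: Tword1.
apply: (@span_morph _ _ (mulrr (T q))) => _ [q' [b [hb ->]]].
rewrite /= /mulrr -mulgA; apply: sub_span; exists q', (b ∙ T q); split=> //.
exact: IHn.
Qed.

Lemma SwordS p n a : Sword n a -> Sword n.+1 (S p ∙ a).
Proof.
elim: n a => [|n IHn] a; first by move=> [r _ <-]; rewrite -repS_ract; exact: Sword1.
apply: (@span_morph _ _ (monoid.mul (S p))) => _ [p' [b [hb ->]]].
rewrite /= mulgA; apply: sub_span; exists p', (S p ∙ b); split=> //.
exact: IHn.
Qed.

Lemma pureword_T q d a : pureword d a -> pureword (d + 1) (a ∙ T q).
Proof.
case: d => n; first by rewrite -PoszD addn1; exact: TwordT.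
have -> : Negz n + 1 = - n%:Z by rewrite NegzE intS opprD addrAC addNr add0r.
have -> : pureword (- n%:Z) = Sword n by case: n => [|n]; rewrite ?oppr0 -?NegzE.
apply: (@span_sub _ _ (mulrr (T q) @^-1` Sword n)).
  by apply: zsubgroup_preim; exact: Sword_zsub.
by move=> _ [p [b [hb ->]]]; rewrite /= /mulrr -mulgA -rep_psi; exact: Sword_sigmar.
Qed.

Lemma pureword_S p d a : pureword d a -> pureword (d - 1) (S p ∙ a).
Proof.
case: d => [[|n]|n] ha.
- exact: (@SwordS p 0).
- have -> : pureword (Posz n.+1 - 1) = Tword n by rewrite intS addrC addKr.
  move: ha; apply: (@span_sub _ _ (monoid.mul (S p) @^-1` Tword n)).
    by apply: zsubgroup_preim; exact: Tword_zsub.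
  by move=> _ [q [b [hb ->]]]; rewrite /= mulgA -rep_psi; exact: Tword_sigmal.
- have -> : pureword (Negz n - 1) = Sword n.+2 by rewrite NegzE -opprD -PoszD addn1.
  exact: SwordS.
Qed.

Lemma Ncompress_sigmal A r m a :
  (forall b s, A b -> A (sigma s ∙ b)) ->
  Ncompress u A m a -> Ncompress u A m (sigma r ∙ a).
Proof.
case: m => [|m] hA /=; first exact: hA.
by move=> ha p q; rewrite mulgA -repS_ract; exact: ha.
Qed.

Lemma Ncompress_sigmar A r m a :
  (forall b s, A b -> A (b ∙ sigma s)) ->
  Ncompress u A m a -> Ncompress u A m (a ∙ sigma r).
Proof.
case: m => [|m] hA /=; first exact: hA.
by move=> ha p q; rewrite (mulgA (S p)) -(mulgA _ (sigma r)) -repT_lact; exact: ha.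
Qed.

Lemma Ncompress_T q d m a :
  Ncompress u (pureword d) m a -> Ncompress u (pureword (d + 1)) m (a ∙ T q).
Proof.
elim: m a q => [|m IHm] a q /=; first exact: pureword_T.
by move=> ha p q'; rewrite mulgA; apply: IHm; exact: ha.
Qed.

Lemma Ncompress_S p d m a :
  Ncompress u (pureword d) m a -> Ncompress u (pureword (d - 1)) m (S p ∙ a).
Proof.
elim: m a p => [|m IHm] a p /=; first exact: pureword_S.
by move=> ha p' q'; rewrite -[_ ∙ T q']mulgA; apply: IHm; exact: ha.
Qed.

Lemma Ncompress_succ d m a :
  Ncompress u (pureword d) m a -> Ncompress u (pureword d) m.+1 a.
Proof.
by move=> ha p q; rewrite -[d](subrK 1); apply: Ncompress_T; exact: Ncompress_S.
Qed.

Lemma Ncompress_leq d m m' a : (m <= m')%N ->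
  Ncompress u (pureword d) m a -> Ncompress u (pureword d) m' a.
Proof.
move=> /subnK <-; elim: (m' - m)%N => // k IHk /IHk.
by rewrite addSn; exact: Ncompress_succ.
Qed.

(** A mixed word T^(k+d)(q)S^k(p) is turned into a pure one by k
   compressions, since S(p)T(q) lies in sigma(R). *)
Lemma homog_Ncompress d a : homog u d a ->
  exists m, Ncompress u (pureword d) m a.
Proof.
elim=> {d a} [s|q d a ha [m IHa]|p d a ha [m IHa]|d a b _ [m IHa] _ [m' IHb]|d].
- by exists 0; exists s.
- have sl d' b s : pureword d' b -> pureword d' (sigma s ∙ b).
    case: d' => n; first exact: Tword_sigmal.
    rewrite /pureword; elim: (n.+1) b => [|k IHk] b; first exact: (@Tword_sigmal s 0).
    apply: (@span_morph _ _ (monoid.mul (sigma s))) => _ [p [c [hc ->]]].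
    by rewrite /= mulgA; apply: sub_span; exists p, (sigma s ∙ c); split=> //; exact: IHk.
  exists m.+1 => p q'; rewrite mulgA -rep_psi -mulgA.
  by apply: Ncompress_sigmal; [exact: sl|exact: Ncompress_T].
- have sr d' b s : pureword d' b -> pureword d' (b ∙ sigma s).
    case: d' => n; last exact: Sword_sigmar.
    rewrite /pureword; elim: n b => [|k IHk] b; first exact: (@Sword_sigmar s 0).
    apply: (@span_morph _ _ (mulrr (sigma s))) => _ [q [c [hc ->]]].
    by rewrite /= /mulrr -mulgA; apply: sub_span; exists q, (c ∙ sigma s); split=> //; exact: IHk.
  exists m.+1 => p' q; rewrite (mulgA (S _)) -(mulgA _ (S p)) -rep_psi.
  by apply: Ncompress_sigmar; [exact: sr|exact: Ncompress_S].
- exists (maxn m m'); apply: (Ncompress_zsub u _ (pureword_zsub d)).2.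
    by apply: Ncompress_leq IHa; exact: leq_maxl.
  by apply: Ncompress_leq IHb; exact: leq_maxr.
- by exists 0; apply: (pureword_zsub d).1.
Qed.

Lemma repTn_B n : zmod_morphism (repTn u (n := n)).
Proof.
move=> y z; apply: (addIr (repTn u z)).
by rewrite -(repTn_morph u n).1 !addrNK.
Qed.
HB.instance Definition _ n :=
  GRing.isZmodMorphism.Build (tpow Q n) O (@repTn _ _ _ u n) (@repTn_B n).

Lemma repSn_B n : zmod_morphism (repSn u (n := n)).
Proof.
move=> y z; apply: (addIr (repSn u z)).
by rewrite -(repSn_morph u n).1 !addrNK.
Qed.
HB.instance Definition _ n :=
  GRing.isZmodMorphism.Build (tpow P n) O (@repSn _ _ _ u n) (@repSn_B n).

Lemma Tword_range n : Tword n.+1 `<=` range (repTn u (n := n)).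
Proof.
elim: n => [|n IHn]; apply: span_sub.
- exact: zsubgroup_range.
- by move=> _ [q [_ [[r _ <-] ->]]]; exists (q <* r) => //=; exact: repT_ract.
- exact: zsubgroup_range.
- by move=> _ [q [_ [/IHn [y _ <-] ->]]]; exists (q ⊗ y) => //; exact: repTn_tens.
Qed.

Lemma repTn_ract n (y : tpow Q n) r : repTn u (y <* r) = repTn u y ∙ sigma r.
Proof.
elim: n y => [|n IHn] y; first exact: repT_ract.
move: y; apply: (tlift_ext (g := fun y => repTn u (y <* r : tpow Q n.+1))
  (h := fun y => repTn u (y : tpow Q n.+1) ∙ sigma r)).
- by move=> y z; rewrite ractBl raddfB.
- by move=> y z; rewrite raddfB rngBl.
- by move=> q y; rewrite ract_tens !repTn_tens IHn mulgA.
Qed.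

Lemma tcontractB p n : zmod_morphism (@tcontract R X p n).
Proof. by apply: tliftB; exact: contract_balanced. Qed.

Lemma tappendB q n : zmod_morphism (fun y : tpow Q n => tappend y q).
Proof.
by move=> y z; apply: (addIr (tappend z q)); rewrite -(tappend_morph n q).1 !addrNK.
Qed.

Lemma repTn_contract p n (y : tpow Q n.+1) :
  S p ∙ repTn u y = repTn u (tcontract p y).
Proof.
move: y; apply: (tlift_ext (g := fun y => S p ∙ repTn u (y : tpow Q n.+1))
  (h := fun y => repTn u (tcontract p (y : tpow Q n.+1)))).
- by move=> y z; rewrite raddfB rngBr.
- by move=> y z; rewrite tcontractB raddfB.
- by move=> q y; rewrite repTn_tens tcontractE (repTn_morph u n).2 rep_psi mulgA.
Qed.

Lemma repTn_append n (y : tpow Q n) q : repTn u (tappend y q) = repTn u y ∙ T q.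
Proof.
elim: n y => [|n IHn] y; first exact: repTn_tens.
move: y; apply: (tlift_ext (g := fun y => repTn u (tappend (y : tpow Q n.+1) q))
  (h := fun y => repTn u (y : tpow Q n.+1) ∙ T q)).
- by move=> y z; rewrite [tappend _ _]tappendB (raddfB (repTn u (n := n.+2))).
- by move=> y z; rewrite raddfB rngBl.
- by move=> q1 y; rewrite tappend_tens !repTn_tens IHn mulgA.
Qed.

Lemma homogSn n (y : tpow P n) d a : homog u d a ->
  homog u (d - n.+1%:Z) (a ∙ repSn u y).
Proof.
elim: n y d a => [|n IHn] y d a ha; first exact: homogS.
apply: (@tens_ind _ _ _ (fun y => homog u (d - n.+2%:Z) (a ∙ repSn u (y : tpow P n.+1)))).
  split=> [|y1 y2 h1 h2]; cbv beta in *; rewrite ?raddf0 ?rng0r; first exact: homog0.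
  by rewrite raddfB rngBr; exact: homogB.
move=> p z; rewrite repSn_tens mulgA intS opprD addrA.
by apply: IHn; exact: homogS.
Qed.

Lemma homogTn1 n (y : tpow Q n) : homog u n.+1%:Z (repTn u y).
Proof.
suff : Tword n.+1 (repTn u y).
  elim: (n.+1) (repTn u y) => [|k IHk] a /=.
    by move=> [r _ <-]; exact: homog_sigma.
  apply: span_sub; first exact: homog_zsub.
  by move=> _ [q [b [hb ->]]]; rewrite -addn1 PoszD; apply: homogT; exact: IHk.
elim: n y => [|n IHn] y; first exact: Tword1.
apply: (@tens_ind _ _ _ (fun y => Tword n.+2 (repTn u (y : tpow Q n.+1)))).
  split=> [|y1 y2 h1 h2]; cbv beta in *; rewrite ?raddf0; first exact: (Tword_zsub n.+2).1.
  by rewrite raddfB; exact: (Tword_zsub n.+2).2.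
by move=> q z; rewrite repTn_tens; apply: sub_span; exists q, (repTn u z); split=> //; exact: IHn.
Qed.

Lemma degree0_homog : degree0_part u `<=` homog u 0.
Proof.
apply: span_sub; first exact: homog_zsub.
move=> _ [[r _ <-]|[k [q [p ->]]]]; first exact: homog_sigma.
by rewrite -(subrr k.+1%:Z); apply: homogSn; exact: homogTn1.
Qed.

(** A tensor is determined by its contractions, as a local unit acts on its
   first factor. *)
Lemma tcontract_unit n (y : tpow Q n.+1) : exists s : seq (Q * P),
  y = \sum_(z <- s) (z.1 ⊗ tcontract z.2 y : tpow Q n.+1).
Proof.
suff [qs qsP] : exists qs : seq Q, forall s : seq (Q * P),
    {in qs, forall q, \sum_(z <- s) z.1 <* psi (z.2 ⊗ q) = q} ->
    y = \sum_(z <- s) (z.1 ⊗ tcontract z.2 y : tpow Q n.+1).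
  by have [s hs] := fs_unitQ FS qs; exists s; exact: qsP.
move: y; apply: tens_ind; first split=> [|a b [s1 h1] [s2 h2]].
- exists [::] => s _; rewrite big1 // => z _.
  have -> : tcontract z.2 (0 : tpow Q n.+1) = 0.
    by rewrite -(subrr (0 : tpow Q n.+1)) tcontractB subrr.
  exact: tens0r.
- exists (s1 ++ s2) => s hs.
  have /h1 e1 : {in s1, forall q, \sum_(z <- s) z.1 <* psi (z.2 ⊗ q) = q}.
    by move=> q qs; apply: hs; rewrite mem_cat qs.
  have /h2 e2 : {in s2, forall q, \sum_(z <- s) z.1 <* psi (z.2 ⊗ q) = q}.
    by move=> q qs; apply: hs; rewrite mem_cat qs orbT.
  apply: etrans (congr2 (fun x y => x - y) e1 e2) _.
  by rewrite -sumrB; apply: eq_bigr => z _; rewrite tcontractB tensBr.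
- move=> q z; exists [:: q] => s /(_ q (mem_head _ _)) hs.
  rewrite -{1}hs tens_suml; apply: eq_bigr => i _.
  by rewrite tcontractE tens_bal.
Qed.

Lemma repTn_inj n : injective sigma -> injective (repTn u (n := n)).
Proof.
move=> sinj; suff h : forall y : tpow Q n, repTn u y = 0 -> y = 0.
  move=> y z yz; apply/eqP; rewrite -subr_eq0; apply/eqP; apply: h.
  by rewrite raddfB; apply/eqP; rewrite subr_eq0; apply/eqP.
elim: n => [|n IHn] y hy.
  apply: (psi_nondegQ FS) => p; apply: sinj.
  by rewrite rep_psi [T y]hy rng0r raddf0.
have [s ->] := tcontract_unit y; rewrite big1 // => z _.
by rewrite (IHn (tcontract z.2 y)) -?repTn_contract ?hy ?rng0r // tens0r.
Qed.

End Words.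

(** * Generation *)

Section Generation.
Variables (R : rngType) (X : rsystem R) (FS : condition_FS X).
Variables (O : rngType) (u : covrep X O).
Hypothesis gen : smallest (@subrng O)
  (range (repsigma u) `|` range (repS u) `|` range (repT u)) = setT.
Local Notation P := (sysP X).
Local Notation Q := (sysQ X).
Local Notation S := (repS u).
Local Notation T := (repT u).
Local Notation sigma := (repsigma u).

Lemma subrng_full (A : set O) : subrng A -> (forall r, A (sigma r)) ->
  (forall p, A (S p)) -> (forall q, A (T q)) -> forall b, A b.
Proof.
move=> sA As AS AT b; have: setT b by [].
rewrite -gen; apply: smallest_sub => // _ [[[r _ <-]|[p _ <-]]|[q _ <-]] //.
Qed.

(** As S(p)T(q) lies in sigma(R), multiplication by a generator from the left
   preserves the span of the homogeneous elements. *)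
Lemma span_homog b : span [set a | exists d, homog u d a] b.
Proof.
set W := span _; have zW : zsubgroup W := @span_zsubgroup _ _.
have Wh d a : homog u d a -> W a by move=> ha; apply: sub_span; exists d.
pose stab := [set x | W x /\ forall c, W c -> W (x ∙ c)].
have Wmul (x : O) : (forall d c, homog u d c -> W (x ∙ c)) -> forall c, W c -> W (x ∙ c).
  move=> hx; apply: (@span_morph _ _ (monoid.mul x)) => c [d hc]; exact: hx hc.
have [//] : stab b.
apply: subrng_full => [|r|p|q].
- split; first split=> [|x y [Wx hx] [Wy hy]].
  + by split=> [|c Wc]; rewrite ?rng0l; exact: zW.1.
  + by split=> [|c Wc]; rewrite ?rngBl; apply: zW.2 => //; [exact: hx|exact: hy].
  + move=> x y [Wx hx] [Wy hy]; split=> [|c Wc]; first exact: hx.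
    by rewrite -mulgA; apply: hx; exact: hy.
- split; first by apply: Wh; exact: homog_sigma.
  by apply: Wmul => d c hc; apply: Wh; exact: homog_sigmaMl hc.
- split; first by apply: Wh; exact: homogS1.
  by apply: Wmul => d c hc; apply: Wh; exact: homogSl hc.
- split; first by apply: Wh; exact: homogT1.
  by apply: Wmul => d c hc; apply: Wh; exact: homogT hc.
Qed.

Lemma gen_ind (A : set O) : zsubgroup A -> (forall r, A (sigma r)) ->
  (forall q a, A a -> A (T q ∙ a)) -> (forall p a, A a -> A (a ∙ S p)) ->
  forall b, A b.
Proof.
move=> zA As AT AS b; apply: (span_sub zA _ (span_homog b)) => a [d].
elim=> {d a} [s|q d a _|p d a _|d a c _ ha _ hc|d] //.
- exact: AT.
- exact: AS.
- exact: zA.2.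
- exact: zA.1.
Qed.

Lemma homog_decomp b : exists (D : seq int) (g : int -> O),
  [/\ uniq D, forall d, homog u d (g d) & b = \sum_(d <- D) g d].
Proof.
move: b; apply: (gen_ind (A := fun b => exists (D : seq int) (g : int -> O),
  [/\ uniq D, forall d, homog u d (g d) & b = \sum_(d <- D) g d])).
- split=> [|_ _ [D1 [g1 [u1 h1 ->]]] [D2 [g2 [u2 h2 ->]]]].
    by exists [::], (fun=> 0); split=> // [d|]; [exact: homog0|rewrite big_nil].
  pose D := undup (D1 ++ D2).
  exists D, (fun d => (if d \in D1 then g1 d else 0) - (if d \in D2 then g2 d else 0)).
  split=> [|d|]; first exact: undup_uniq.
    by apply: homogB; case: ifP => _; try exact: homog0.
  have key D' g : uniq D' -> {subset D' <= D1 ++ D2} ->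
      \sum_(d <- D') g d = \sum_(d <- D) (if d \in D' then g d else 0) :> O.
    move=> uD' sub; rewrite -big_mkcond -big_filter; apply: perm_big.
    apply: uniq_perm => //; first by rewrite filter_uniq // undup_uniq.
    move=> d; rewrite mem_filter mem_undup.
    by case: (boolP (d \in D')) => // /sub ->.
  by rewrite sumrB -!key // => d hd; rewrite mem_cat hd ?orbT.
- move=> r; exists [:: 0], (fun d => if d == 0 then sigma r else 0).
  split=> // [d|]; last by rewrite big_seq1 eqxx.
  by case: eqP => [->|_]; [exact: homog_sigma|exact: homog0].
- move=> q _ [D [g [uD hg ->]]].
  exists [seq d + 1 | d <- D], (fun d => T q ∙ g (d - 1)); split=> [|d|].
  + by rewrite map_inj_uniq //; exact: addIr.
  + by rewrite -{1}[d](subrK 1); exact: homogT.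
  + by rewrite big_map rng_sumr; apply: eq_bigr => d _; rewrite addrK.
- move=> p _ [D [g [uD hg ->]]].
  exists [seq d - 1 | d <- D], (fun d => g (d + 1) ∙ S p); split=> [|d|].
  + by rewrite map_inj_uniq //; exact: addIr.
  + by rewrite -{1}[d](addrK 1); exact: homogS.
  + by rewrite big_map rng_suml; apply: eq_bigr => d _; rewrite subrK.
Qed.

End Generation.

(** * Quotient systems *)

Section QuotientSystem.
Variables (R : rngType) (X : rsystem R) (FS : condition_FS X).
Variables (I : set R) (iI : is_ideal I) (Iinv : psi_invariant X I).
Local Notation P := (sysP X).
Local Notation Q := (sysQ X).
Local Notation XI := (quot_system FS iI Iinv).
Local Notation pQ := (projQ FS iI Iinv : Q -> sysQ XI).
Local Notation pP := (projP FS iI Iinv : P -> sysP XI).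
Local Notation pR := (rproj iI : R -> rquot iI).

Lemma projQ_B : zmod_morphism pQ. Proof. exact: raddfB. Qed.
Lemma projP_B : zmod_morphism pP. Proof. exact: raddfB. Qed.
HB.instance Definition _ := GRing.isZmodMorphism.Build Q (sysQ XI) pQ projQ_B.
HB.instance Definition _ := GRing.isZmodMorphism.Build P (sysP XI) pP projP_B.

Lemma projQ_surj (q : sysQ XI) : exists q0, pQ q0 = q.
Proof. by exists (zrepr q); exact: zreprK. Qed.
Lemma projP_surj (p : sysP XI) : exists p0, pP p0 = p.
Proof. by exists (zrepr p); exact: zreprK. Qed.

Lemma projQ_lact r q : pQ (r *> q) = pR r *> pQ q. Proof. exact: bproj_lact. Qed.
Lemma projQ_ract q r : pQ (q <* r) = pQ q <* pR r. Proof. exact: bproj_ract. Qed.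
Lemma projP_lact r p : pP (r *> p) = pR r *> pP p. Proof. exact: bproj_lact. Qed.
Lemma projP_ract p r : pP (p <* r) = pP p <* pR r. Proof. exact: bproj_ract. Qed.
Lemma proj_psi p q : psi (pP p ⊗ pQ q) = pR (psi (p ⊗ q)).
Proof. exact: psi_quotE. Qed.

Lemma projQ_seq (qs : seq (sysQ XI)) : exists qs0, qs = [seq pQ q | q <- qs0].
Proof.
elim: qs => [|q qs [qs0 ->]]; first by exists [::].
by have [q0 <-] := projQ_surj q; exists (q0 :: qs0).
Qed.
Lemma projP_seq (ps : seq (sysP XI)) : exists ps0, ps = [seq pP p | p <- ps0].
Proof.
elim: ps => [|q qs [qs0 ->]]; first by exists [::].
by have [q0 <-] := projP_surj q; exists (q0 :: qs0).
Qed.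

Lemma quot_FS : condition_FS XI.
Proof.
move=> qs ps; have [qs0 ->] := projQ_seq qs; have [ps0 ->] := projP_seq ps.
have [s hs] := fs_unitQ FS qs0; have [t ht] := fs_unitP FS ps0.
exists (\sum_(z <- [seq (pQ z.1, pP z.2) | z <- s]) thetaQ z.1 z.2).
exists (\sum_(z <- [seq (pP z.1, pQ z.2) | z <- t]) thetaP z.1 z.2); split.
- exact: finrankQ_of_seq.
- by apply: span_sum => z _; apply: sub_span; exists z.1, z.2.
- move=> _ /mapP [q qqs ->]; rewrite fct_sumE big_map -{2}(hs q qqs) raddf_sum.
  by apply: eq_bigr => z _; rewrite /thetaQ [RHS]projQ_ract -proj_psi.
- move=> _ /mapP [p pps ->]; rewrite fct_sumE big_map -{2}(ht p pps) raddf_sum.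
  by apply: eq_bigr => z _; rewrite /thetaP [RHS]projP_lact -proj_psi.
Qed.

End QuotientSystem.

(** * The T-pair of a representation *)

Section RepTPair.
Variables (R : rngType) (X : rsystem R) (FS : condition_FS X).
Variables (B : rngType) (v : covrep X B).
Local Notation P := (sysP X).
Local Notation Q := (sysQ X).
Local Notation S := (repS v).
Local Notation T := (repT v).
Local Notation sigma := (repsigma v).

Lemma repi_TSspan f : finrankQ f -> TSspan v (repi v f).
Proof. by move=> /finrankQ_seq [s ->]; rewrite repi_sum //; exact: TSspan_of_seq. Qed.

Lemma CP_TSspan J x : faithful_psi_compatible X J -> CP_invariant v J -> J x ->
  TSspan v (sigma x).
Proof.
move=> [[_ cJ] _] cv Jx; rewrite -(cv x Jx); apply: repi_TSspan.
by apply: cJ; exists x.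
Qed.

Definition repker : set R := [set r | sigma r = 0].
Definition repcov : set R := [set r | TSspan v (sigma r)].

Lemma repker_ideal : is_ideal repker. Proof. exact: rker_ideal. Qed.

Lemma repker_inv : psi_invariant X repker.
Proof. by move=> p x q sx; rewrite /repker /= rep_psi repS_ract [sigma x]sx rng0r rng0l. Qed.

Lemma repcov_ideal : is_ideal repcov.
Proof.
split=> [|r x|x r] /=; rewrite /repcov /= ?rmM.
- by apply: zsubgroup_preim; exact: span_zsubgroup.
- exact: TSspan_sigmaMl.
- exact: TSspan_sigmaMr.
Qed.

(** A local unit writes q as a sum of q_j psi(p_j ⊗ q), where T(q) = 0 puts
   the coefficients into ker sigma. *)
Lemma repT_ker q : T q = 0 -> span (@QI_gen R X repker) q.
Proof.
move=> Tq; have [s /(_ q (mem_head _ _)) <-] := fs_unitQ FS [:: q].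
apply: span_sum => z _; apply: sub_span; exists z.1, (psi (z.2 ⊗ q)).
by rewrite /repker /= rep_psi Tq rng0r.
Qed.

(** If sigma(r) = sum T(q_i) S(p_i) then left multiplication by r agrees with
   sum theta_{q_i, p_i} on Q modulo ker T = Q ker(sigma), so that r acts
   on the quotient system by a finite-rank operator. If this operator is 0, then
   sigma(r) = sigma(r) e vanishes too, for a local unit e in T(Q)S(P). *)
Lemma rep_T_pair : repker `<=` repcov /\ T_pair FS repker repcov.
Proof.
split=> [r|].
  by rewrite /repker /repcov /= => ->; exact: (span_zsubgroup _).1.
split=> [|r|]; first exact: repcov_ideal.
  by rewrite /repker /repcov /= => ->; exact: (span_zsubgroup _).1.
exists repker_ideal, repker_inv; set XI := quot_system _ _ _.
pose pQ (q : Q) : sysQ XI := projQ FS repker_ideal repker_inv q.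
pose pP (p : P) : sysP XI := projP FS repker_ideal repker_inv p.
have TpQ q : pQ q = 0 <-> T q = 0.
  split=> [q0|Tq]; last first.
    apply: etrans (raddf0 (projQ FS repker_ideal repker_inv)).
    by apply/bproj_eqP; rewrite subr0; exact: repT_ker.
  have : span (@QI_gen R X repker) (q - 0).
    apply/(bproj_eqP (QI_compat FS repker_ideal repker_inv)).
    exact: etrans q0 (esym (raddf0 (projQ FS repker_ideal repker_inv))).
  rewrite subr0; apply: (@span_sub _ _ (T @^-1` [set 0])).
    by apply: zsubgroup_preim; exact: zsubgroup_set0.
  by move=> _ [q' [x [sx ->]]]; rewrite /= repT_ract [sigma x]sx rng0r.
split; first split.
- by apply: image_ideal; [exact: rproj_surj|exact: repcov_ideal].
- move=> _ [_ [r /TSspan_seq [s rs] <-] <-].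
  have -> : Delta (rproj repker_ideal r : rquot repker_ideal) =
      \sum_(z <- [seq (pQ z.1, pP z.2) | z <- s]) thetaQ z.1 z.2.
    apply/funext => y; have [q <-] := projQ_surj y.
    rewrite fct_sumE big_map.
    transitivity (\sum_(z <- s) pQ (z.1 <* psi (z.2 ⊗ q))); last first.
      apply: eq_bigr => z _.
      by rewrite /thetaQ [LHS]projQ_ract -(proj_psi FS repker_ideal repker_inv).
    apply: etrans (esym (projQ_lact FS repker_ideal repker_inv r q)) _.
    rewrite -raddf_sum; apply/eqP; rewrite -subr_eq0 -raddfB.
    apply/eqP/TpQ; rewrite raddfB raddf_sum repT_lact rs rng_suml.
    apply/eqP; rewrite subr_eq0; apply/eqP; apply: eq_bigr => z _.
    by rewrite -mulgA -rep_psi repT_ract.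
  exact: finrankQ_of_seq.
- apply/seteqP; split=> [_ [[r rJ <-] /= Dr]|_ ->] /=; last first.
    split; first by exists 0; rewrite ?raddf0 //; exact: (ideal_zsub repcov_ideal).1.
    by apply/funext => y; rewrite /Delta lact0l.
  have Tr0 (q : Q) : T (r *> q) = 0.
    apply/TpQ; apply: etrans (projQ_lact FS repker_ideal repker_inv r q) _.
    by rewrite -[LHS]/(Delta (rproj repker_ideal r : rquot repker_ideal) (pQ q)) Dr.
  apply/rproj_eq0; rewrite /repker /=.
  have [f /TSspan_seq [s ->] <-] := runital1 FS (TSspan_runital rJ).
  rewrite rng_sumr big1 // => z _.
  by rewrite mulgA -repT_lact Tr0 rng0l.
Qed.

Lemma nonzero_repker : nonzero_rep v -> repker <> setT.
Proof.
move=> nz kT; apply: nz; have s0 r : sigma r = 0 by have : repker r by rewrite kT.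
by split=> x; [exact: repS_eq0|exact: repT_eq0|exact: s0].
Qed.

(** The T-pair (R, R) is the one of the zero representation only. *)
Lemma super_maximal_rep J : faithful_psi_compatible X J -> super_maximal FS J ->
  nonzero_rep v -> CP_invariant v J ->
  injective sigma /\ forall r, TSspan v (sigma r) -> J r.
Proof.
move=> HJ sm nz cv.
have [_ tp] := rep_T_pair.
have [|[k0 c0]|[kT _]] := sm _ _ tp; last by have := nonzero_repker nz.
  by move=> x Jx; exact: CP_TSspan HJ cv Jx.
split; first exact: rker_inj.
by move=> r hr; rewrite -c0.
Qed.

End RepTPair.

(** * The degree-zero part *)

Section DegreeZero.
Variables (R : rngType) (X : rsystem R) (FS : condition_FS X).
Variables (O B : rngType) (u : covrep X O) (v : covrep X B).
Variables (eta : {rngmorphism O -> B}) (uv : rep_factor u v eta).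
Hypothesis vinj : injective (repsigma v).
Hypothesis vcov : forall r, TSspan v (repsigma v r) -> TSspan u (repsigma u r).
Local Notation sigma := (repsigma u).

Lemma eta_TSspan a : TSspan u a -> TSspan v (eta a).
Proof.
have [eS eT _] := uv; apply: span_morph => _ [q [p ->]]; apply: sub_span.
by exists q, p; rewrite /= rmM -eT -eS.
Qed.

(** By induction on the number of compressions that take a into sigma(R), all
   S(p) a T(q) vanish. As a - sigma(r) begins with T(q) and ends with S(p), this leaves
   a = sigma(r) - b with b in T(Q)S(P), and then sigma_v(r) lies in
   T_v(Q)S_v(P). *)
Lemma homog0_inj a : homog u 0 a -> eta a = 0 -> a = 0.
Proof.
have [eS eT es] := uv; move=> ha; have [m] := homog_Ncompress FS ha.
elim: m a ha => [|m IHm] a ha /=.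
  move=> [r _ <-] e0; suff -> : r = 0 by rewrite raddf0.
  by apply: vinj; rewrite raddf0 -es /= e0.
move=> hm e0; have c0 p q : repS u p ∙ a ∙ repT u q = 0.
  by apply: IHm; [exact: homog_compress|exact: hm|rewrite !rmM e0 rng0r rng0l].
have [_ _ /(_ erefl) [r [ll rr]]] := homog_unital ha.
suff hr : TSspan u (sigma r).
  apply: (compress0 FS) => //; rewrite -[a](subrK (sigma r)).
    by apply: zsubgroupD => //; [exact: lunital_zsub|exact: TSspan_lunital].
  by apply: zsubgroupD => //; [exact: runital_zsub|exact: TSspan_runital].
apply: vcov; rewrite -es /=.
have -> : eta (sigma r) = eta (sigma r - a) by rewrite raddfB /= e0 subr0.
apply: eta_TSspan.
have [e eTS ea] := lunital1 FS ll; have [f fTS af] := runital1 FS rr.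
have eaf : e ∙ a ∙ f = 0.
  have [s ->] := TSspan_seq eTS; have [t ->] := TSspan_seq fTS.
  rewrite !rng_suml big1 // => z _; rewrite rng_sumr big1 // => w _.
  by rewrite -!mulgA (mulgA a) (mulgA _ _ (repS u _)) (mulgA _ a) c0 rng0l rng0r.
have : sigma r - a = e ∙ sigma r ∙ f.
  apply/eqP; rewrite -opprB -[a - _]af -ea -rngNl -rngNr opprB rngBr rngBl eaf subr0.
  by [].
move=> ->; have [t ->] := TSspan_seq fTS.
rewrite rng_sumr; apply: span_sum => z _.
have [s ->] := TSspan_seq eTS; rewrite !rng_suml; apply: span_sum => w _.
apply: sub_span; exists (w.1 <* psi ((w.2 <* r) ⊗ z.1)), z.2.
by rewrite repT_ract rep_psi repS_ract !mulgA.
Qed.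

End DegreeZero.

(** * Condition (L) and the ideals that miss degree zero *)

Section Cycle.
Variables (R : rngType) (X : rsystem R) (FS : condition_FS X) (J : set R).
Variables (O : rngType) (u : covrep X O).
Hypothesis gen : smallest (@subrng O)
  (range (repsigma u) `|` range (repS u) `|` range (repT u)) = setT.
Hypothesis sinj : injective (repsigma u).
Hypothesis covJ : forall r, TSspan u (repsigma u r) -> J r.
Variable K : set O.
Hypothesis iK : is_ideal K.
Hypothesis K0 : forall a, homog u 0 a -> K a -> a = 0.
Local Notation P := (sysP X).
Local Notation Q := (sysQ X).
Local Notation S := (repS u).
Local Notation T := (repT u).
Local Notation sigma := (repsigma u).

(** A decomposition of an element of K into homogeneous elements. The offset d
   allows multiplications by S(p) and T(q) to change all degrees while the index
   list D stays the same. *)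
Definition kfam (D : seq int) (d : int) (g : int -> O) :=
  (forall e, e \in D -> homog u (d + e) (g e)) /\ K (\sum_(e <- D) g e).

Lemma kfamB D d g g' : kfam D d g -> kfam D d g' -> kfam D d (fun e => g e - g' e).
Proof.
move=> [hg Kg] [hg' Kg']; split=> [e eD|]; first by apply: homogB; auto.
by rewrite sumrB; apply: (ideal_zsub iK).2.
Qed.

Lemma kfam_S D d g p : kfam D d g -> kfam D (d - 1) (fun e => S p ∙ g e).
Proof.
move=> [hg Kg]; split=> [e eD|]; first by rewrite addrAC; apply: homogSl; auto.
by rewrite -rng_sumr; exact: idealMl.
Qed.

Lemma kfam_T D d g q : kfam D d g -> kfam D (d + 1) (fun e => g e ∙ T q).
Proof.
move=> [hg Kg]; split=> [e eD|]; first by rewrite addrAC; apply: homogTr; auto.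
by rewrite -rng_suml; exact: idealMr.
Qed.

Lemma kfam_compress D d g p q :
  kfam D d g -> kfam D d (fun e => S p ∙ g e ∙ T q).
Proof. by move=> /(kfam_S p) /(kfam_T q); rewrite subrK. Qed.

Lemma kfam_sigmal D d g r : kfam D d g -> kfam D d (fun e => sigma r ∙ g e).
Proof.
move=> [hg Kg]; split=> [e eD|]; first by apply: homog_sigmaMl; auto.
by rewrite -rng_sumr; exact: idealMl.
Qed.

Lemma kfam_sigmar D d g r : kfam D d g -> kfam D d (fun e => g e ∙ sigma r).
Proof.
move=> [hg Kg]; split=> [e eD|]; first by apply: homog_sigmaMr; auto.
by rewrite -rng_suml; exact: idealMr.
Qed.

Lemma lunital_S a : lunital u a -> a <> 0 -> exists p, S p ∙ a <> 0.
Proof.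
move=> /(lunital1 FS) [e /TSspan_seq [s es] ea] a0.
apply: contrapT => h; apply: a0; rewrite -ea es rng_suml big1 // => z _.
rewrite -mulgA; suff -> : S z.2 ∙ a = 0 by rewrite rng0r.
by apply: contrapT => n0; apply: h; exists z.2.
Qed.

Lemma runital_T a : runital u a -> a <> 0 -> exists q, a ∙ T q <> 0.
Proof.
move=> /(runital1 FS) [e /TSspan_seq [s es] ea] a0.
apply: contrapT => h; apply: a0; rewrite -ea es rng_sumr big1 // => z _.
rewrite mulgA; suff -> : a ∙ T z.1 = 0 by rewrite rng0l.
by apply: contrapT => n0; apply: h; exists z.1.
Qed.

(** Multiplying by some S(p) or T(q) moves the degree d + e0 of a chosen
   component to 0 without killing that component. *)
Lemma kfam_shift D e0 d g : e0 \in D -> kfam D d g -> g e0 <> 0 ->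
  exists2 g', kfam D (- e0) g' & g' e0 <> 0.
Proof.
move=> eD; have [n hn] : exists n, absz (d + e0) = n by exists (absz (d + e0)).
elim: n d g hn => [|n IHn] d g hn kg g0.
  move/eqP: hn; rewrite absz_eq0 addr_eq0 => /eqP dE.
  by exists g; rewrite // -dE.
have [dpos|dneg|d0] := ltgtP 0 (d + e0); last by rewrite -d0 in hn.
  have [lu _ _] := homog_unital (kg.1 _ eD).
  have [p hp] := lunital_S (lu dpos) g0.
  apply: (IHn (d - 1) _ _ (kfam_S p kg) hp).
  by case: (d + e0) dpos hn (addrAC d (-1) e0) => [[|m]|m] // _ [<-] ->; rewrite intS addrC addKr.
have [_ ru _] := homog_unital (kg.1 _ eD).
have [q hq] := runital_T (ru dneg) g0.
apply: (IHn (d + 1) _ _ (kfam_T q kg) hq).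
case: (d + e0) dneg hn (addrAC d 1 e0) => [m|m] // _ [<-] ->.
by rewrite NegzE intS opprD addrAC addNr add0r abszN.
Qed.

(** From here on D lists the degrees of a non-zero family of least size, shifted
   so that the minimum e0 of D stands for degree 0. *)
Section Minimal.
Variables (D : seq int) (e0 : int).
Hypothesis uD : uniq D.
Hypothesis e0D : e0 \in D.
Hypothesis e0min : forall e, e \in D -> e0 <= e.
Hypothesis Dmin : forall D' d g, uniq D' -> (size D' < size D)%N -> kfam D' d g ->
  forall e, e \in D' -> g e = 0.
Local Notation L := (kfam D (- e0)).

(** Without its zero member the family would be smaller than the least size. *)
Lemma kfam_eq0 g e : L g -> e \in D -> g e = 0 -> forall e', e' \in D -> g e' = 0.
Proof.
move=> [hg Kg] eD ge0 e' e'D.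
have [->//|ne] := eqVneq e' e.
apply: (Dmin (D' := rem e D) (d := - e0) (g := g)).
- exact: rem_uniq.
- by rewrite size_rem // prednK //; case: (D) eD.
- split=> [e2|]; first by rewrite mem_rem_uniq // inE => /andP [_]; exact: hg.
  by move: Kg; rewrite (big_rem _ eD) /= ge0 add0r.
- by rewrite mem_rem_uniq // inE ne.
Qed.

(** The components of positive degree are fixed by a local unit e from the
   left, so multiplying by 1 - e leaves an element of K of degree 0. *)
Lemma kfam_lunital g : L g -> lunital u (g e0).
Proof.
move=> [hg Kg].
have [|e eTS he] := @lunital_seq _ _ FS _ u _ (rem e0 D) g.
  move=> e; rewrite mem_rem_uniq // inE => /andP [ne eD].
  have [lu _ _] := homog_unital (hg e eD); apply: lu.
  by rewrite addrC subr_gt0 lt_neqAle eq_sym ne e0min.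
have hz : g e0 - e ∙ g e0 = 0.
  apply: K0.
    have h0 : homog u 0 (g e0) by rewrite -(addNr e0); exact: hg.
    apply: homogB => //; have [s ->] := TSspan_seq eTS.
    rewrite rng_suml; apply: zsubgroup_sum; first exact: homog_zsub.
    move=> z _; rewrite -mulgA -(addNr 1); apply: homogT.
    by rewrite -[-1]add0r; exact: homogSl.
  have -> : g e0 - e ∙ g e0 = \sum_(i <- D) g i - e ∙ \sum_(i <- D) g i.
    rewrite !(big_rem _ e0D) /= rngDr opprD addrACA.
    rewrite rng_sumr -sumrB big_seq big1 ?addr0 // => i iD.
    by rewrite he ?subrr.
  apply: (ideal_zsub iK).2 => //; exact: idealMl.
move/eqP: hz; rewrite subr_eq0 => /eqP ->.
by apply: lunitalMr; exact: TSspan_lunital.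
Qed.

Lemma leading_TSspan r g : L g -> g e0 = sigma r -> TSspan u (sigma r).
Proof. by move=> /kfam_lunital + h; rewrite h; exact: lunital_sigma. Qed.

(** If no family had a non-zero sigma(r) in degree 0, then the compressions,
   which end in sigma(R), would show by induction that all members of degree 0
   vanish. *)
Lemma leading_sigma g : L g -> g e0 <> 0 ->
  exists r g', [/\ L g', g' e0 = sigma r & r <> 0].
Proof.
move=> Lg; apply: contra_notP => h.
have hI r g' : L g' -> g' e0 = sigma r -> r = 0.
  by move=> Lg' gr; apply: contrapT => r0; apply: h; exists r, g'.
have h0 g' : L g' -> homog u 0 (g' e0).
  by move=> [hg _]; rewrite -(addNr e0); exact: hg.
have [m hm] := homog_Ncompress FS (h0 g Lg).
elim: m g Lg hm => [|m IHm] g Lg hm.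
  by case: hm => r _ gr; rewrite -gr (hI r g) ?raddf0.
have lu := kfam_lunital Lg.
have [_ _ /(_ erefl) [r [ll rr]]] := homog_unital (h0 g Lg).
have ls : lunital u (sigma r).
  rewrite -[sigma r](subKr (g e0)); exact: (lunital_zsub u).2.
apply: (@compress0 _ _ FS _ u) => // [|p q].
  rewrite -[g e0](subrK (sigma r)).
  apply: zsubgroupD => //; first exact: runital_zsub.
  by apply: TSspan_runital; exact: lunital_sigma.
by apply: (IHm _ (kfam_compress p q Lg)); exact: hm.
Qed.

Variables (e1 : int) (n : nat).
Hypothesis e1D : e1 \in D.
Hypothesis e1n : - e0 + e1 = n.+1%:Z.

(** The graph of the future cycle: r is related to y when some family has
   sigma(r) in the lowest degree and T^n(y) in the degree of e1. By minimality
   this is the graph of an injective map. *)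
Definition cyc_rel (r : R) (y : tpow Q n) :=
  exists g, [/\ L g, g e0 = sigma r & g e1 = repTn u y].
Definition cyc_ideal : set R := [set r | exists y, cyc_rel r y].
Definition cyc_map (r : R) : tpow Q n := xget 0 [set y | cyc_rel r y].

Lemma cyc_relB r r' y y' : cyc_rel r y -> cyc_rel r' y' -> cyc_rel (r - r') (y - y').
Proof.
move=> [g [Lg g0 g1]] [g' [Lg' g'0 g'1]].
by exists (fun e => g e - g' e); rewrite g0 g1 g'0 g'1 !raddfB; split=> //; exact: kfamB.
Qed.

Lemma cyc_rel0 : cyc_rel 0 0.
Proof.
exists (fun=> 0); rewrite !raddf0; split=> //; split=> [e _|]; first exact: homog0.
by rewrite big1 //; exact: (ideal_zsub iK).1.
Qed.

Lemma cyc_rel_sigmal s r y : cyc_rel r y -> cyc_rel (s ∙ r) (s *> y).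
Proof.
move=> [g [Lg g0 g1]]; exists (fun e => sigma s ∙ g e).
by rewrite g0 g1 rmM (repTn_morph u n).2; split=> //; exact: kfam_sigmal.
Qed.

Lemma cyc_rel_sigmar s r y : cyc_rel r y -> cyc_rel (r ∙ s) (y <* s).
Proof.
move=> [g [Lg g0 g1]]; exists (fun e => g e ∙ sigma s).
by rewrite g0 g1 rmM repTn_ract; split=> //; exact: kfam_sigmar.
Qed.

Lemma cyc_rel_compress p q r y : cyc_rel r y ->
  cyc_rel (psi ((p <* r) ⊗ q)) (tcontract p (tappend y q)).
Proof.
move=> [g [Lg g0 g1]]; exists (fun e => S p ∙ g e ∙ T q).
rewrite g0 g1 rep_psi repS_ract -repTn_contract repTn_append mulgA.
by split=> //; exact: kfam_compress.
Qed.

Lemma cyc_rel_fun y : cyc_rel 0 y -> y = 0.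
Proof.
move=> [g [Lg g0 g1]]; apply: (repTn_inj FS sinj).
by rewrite raddf0 -g1; apply: (kfam_eq0 Lg e0D) => //; rewrite g0 raddf0.
Qed.

Lemma cyc_rel_inj r : cyc_rel r 0 -> r = 0.
Proof.
move=> [g [Lg g0 g1]]; apply: sinj; rewrite raddf0 -g0.
by apply: (kfam_eq0 Lg e1D) => //; rewrite g1 raddf0.
Qed.

Lemma cyc_mapE r y : cyc_rel r y -> cyc_map r = y.
Proof.
move=> hy; rewrite /cyc_map; case: xgetP => [z _ hz|/(_ y)]; last by case.
by apply/eqP; rewrite -subr_eq0; apply/eqP/cyc_rel_fun; rewrite -(subrr r); exact: cyc_relB.
Qed.

Lemma cyc_ideal_cycle : psi_invariant_cycle X cyc_ideal.
Proof.
split.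
- split=> [|r x [y hy]|x r [y hy]]; first split=> [|x x' [y hy] [y' hy']].
  + by exists 0; exact: cyc_rel0.
  + by exists (y - y'); exact: cyc_relB.
  + by exists (r *> y); exact: cyc_rel_sigmal.
  + by exists (y <* r); exact: cyc_rel_sigmar.
- by move=> p x q [y hy]; exists (tcontract p (tappend y q)); exact: cyc_rel_compress.
exists n, cyc_map; split.
- move=> x x' [y hy] [y' hy'].
  rewrite (cyc_mapE hy) (cyc_mapE hy'); apply: cyc_mapE.
  rewrite -[x']opprK -[y']opprK; apply: cyc_relB => //.
  by rewrite -sub0r -[- y']sub0r; apply: cyc_relB => //; exact: cyc_rel0.
- move=> r x [y hy]; rewrite (cyc_mapE hy); split; apply: cyc_mapE.
    exact: cyc_rel_sigmal.
  exact: cyc_rel_sigmar.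
- move=> x x' [y hy] [y' hy']; rewrite (cyc_mapE hy) (cyc_mapE hy') => yy.
  apply/eqP; rewrite -subr_eq0; apply/eqP/cyc_rel_inj; rewrite -(subrr y) {2}yy.
  exact: cyc_relB.
- by move=> p x q [y hy]; rewrite (cyc_mapE hy); symmetry; apply: cyc_mapE; exact: cyc_rel_compress.
Qed.

(** A psi-invariant ideal inside J lies in all the J^[k]. *)
Lemma cyc_ideal_infty : cyc_ideal `<=` ideal_infty X J.
Proof.
have [_ inv _] := cyc_ideal_cycle.
have IJ r : cyc_ideal r -> J r.
  by move=> [y [g [Lg g0 _]]]; apply: covJ; exact: leading_TSspan Lg g0.
move=> r Ir k _; elim: k r Ir => [|k IHk] r Ir /=; first exact: IJ.
by split=> [p q|]; [apply: IHk; exact: inv|exact: IJ].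
Qed.

(** Compressions turn the degree n component into an element of T^n(Q^n) and
   sigma(r) into some sigma(r'), which cannot all vanish: rQ = 0 would imply
   r = 0 as sigma(r) lies in T(Q)S(P). *)
Lemma cyc_ideal_neq0 r g : L g -> g e0 = sigma r -> r <> 0 -> cyc_ideal <> [set 0].
Proof.
move=> Lg g0 r0 c0; apply: r0.
have [m hm] : exists m, Ncompress u (pureword u n.+1%:Z) m (g e1).
  by apply: homog_Ncompress => //; rewrite -e1n; exact: Lg.1.
elim: m r g Lg g0 hm => [|m IHm] r g Lg g0 hm.
  have [y _ yg] := Tword_range hm.
  have : cyc_ideal r by exists y, g.
  by rewrite c0.
have rq (q : Q) : r *> q = 0.
  apply: (psi_nondegQ FS) => p; rewrite -tens_bal.
  apply: (IHm _ _ (kfam_compress p q Lg)); last exact: hm.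
  by rewrite g0 rep_psi repS_ract.
apply: sinj; rewrite raddf0.
have [e eTS <-] := runital1 FS (TSspan_runital (leading_TSspan Lg g0)).
have [s ->] := TSspan_seq eTS.
by rewrite rng_sumr big1 // => z _; rewrite mulgA -repT_lact rq raddf0 rng0l.
Qed.

End Minimal.

Lemma condition_L_ideal0 : condition_L X J -> K `<=` [set 0].
Proof.
move=> cL a Ka; apply: contrapT => a0.
pose bad k := exists D d g, [/\ size D = k, uniq D, kfam D d g &
  exists2 e, e \in D & g e <> 0].
have exb : exists k, `[< bad k >].
  have [D [g [uD hg aE]]] := homog_decomp FS gen a.
  exists (size D); apply/asboolP; exists D, 0, g; split=> //.
    by split=> [e _|]; rewrite ?add0r // -aE.
  apply: contrapT => h; apply: a0; rewrite /= aE big_seq big1 // => e eD.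
  by apply: contrapT => ge; apply: h; exists e.
have [k /asboolP [D [d [g [sD uD kg [e eD ge]]]]] kmin] := ex_minnP exb.
have Dmin D' d' g' : uniq D' -> (size D' < size D)%N -> kfam D' d' g' ->
    forall e, e \in D' -> g' e = 0.
  move=> uD' szD' kg' e' e'D'; apply: contrapT => ge'.
  suff /kmin : `[< bad (size D') >] by rewrite -sD leqNgt szD'.
  by apply/asboolP; exists D', d', g'; split=> //; exists e'.
have [e0 e0D e0min] : exists2 e0, e0 \in D & forall e, e \in D -> e0 <= e.
  case: (D) eD => // x s _; elim: s x => [|y s IHs] x.
    by exists x => [|e']; rewrite ?mem_head // inE => /eqP ->.
  have [m ms mmin] := IHs y; have [xm|mx] := leP x m.
    exists x; first exact: mem_head.
    move=> e'; rewrite inE => /orP [/eqP -> //|/mmin]; exact: le_trans.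
  exists m; first by rewrite inE ms orbT.
  by move=> e'; rewrite inE => /orP [/eqP ->|/mmin //]; exact: ltW.
have ge0 : g e0 <> 0.
  move=> ge0; apply: ge; have [->//|ne] := eqVneq e e0.
  apply: (Dmin (rem e0 D) d g); rewrite ?rem_uniq ?mem_rem_uniq ?inE ?ne //.
    by rewrite size_rem // prednK //; case: (D) eD.
  split=> [e2|]; first by rewrite mem_rem_uniq // inE => /andP [_]; exact: kg.1.
  by move: kg.2; rewrite (big_rem _ e0D) /= ge0 add0r.
have [g' Lg' g'0] := kfam_shift e0D kg ge0.
have [e1 e1D ne1] : exists2 e1, e1 \in D & e1 != e0.
  apply: contrapT => h; apply: g'0; apply: K0.
    by rewrite -(addNr e0); exact: Lg'.1.
  suff DE : D = [:: e0] by move: Lg'.2; rewrite DE big_seq1.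
  apply/perm_small_eq => //; apply: uniq_perm => // e'.
  rewrite inE; apply/idP/eqP => [e'D|-> //].
  by apply: contrapT => /eqP ne; apply: h; exists e'.
have [n e1n] : exists n : nat, - e0 + e1 = n.+1%:Z.
  have : 0 < - e0 + e1 by rewrite addrC subr_gt0 lt_neqAle eq_sym ne1 e0min.
  by case: (- e0 + e1) => [[|n]|n] // _; exists n.
have [r [h [Lh h0 r0]]] := leading_sigma uD e0D e0min Lg' g'0.
apply: cL; exists (cyc_ideal D e0 e1 n); split.
- exact: cyc_ideal_cycle.
- exact: cyc_ideal_neq0 Lh h0 r0.
- exact: cyc_ideal_infty.
Qed.

End Cycle.

(** * Simplicity implies condition (L) *)

(** An element of degree d acts on functions from the integers to O as left
   multiplication followed by a translation by d. On finitely supported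
   functions this separates the degrees, while on periodic functions it can
   identify elements of different degrees. *)
Section ShiftRep.
Variables (R : rngType) (X : rsystem R) (FS : condition_FS X).
Variables (O : rngType) (u : covrep X O).
Local Notation P := (sysP X).
Local Notation Q := (sysQ X).
Local Notation V := (int -> O).

Fact shift_mul_proof (d : int) (b : O) :
  zmod_morphism (fun f : V => (fun k => b ∙ f (k - d)) : V).
Proof. by move=> f g; apply/funext => k; rewrite [LHS]rngBr. Qed.
Definition shift_mul d b : zendo V := Zendo (@shift_mul_proof d b).

Lemma shift_mulE d b (f : V) k : shift_mul d b f k = b ∙ f (k - d).
Proof. by []. Qed.

Lemma shift_mulB d : zmod_morphism (shift_mul d).
Proof.
move=> b c; apply: zendoP => f; apply/funext => k.
by rewrite zendoBE shift_mulE [LHS]rngBl.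
Qed.

Lemma shift_mulM d d' b c : shift_mul (d + d') (b ∙ c) = shift_mul d b ∙ shift_mul d' c.
Proof.
apply: zendoP => f; apply/funext => k.
by rewrite zendoME !shift_mulE mulgA opprD addrA.
Qed.

Definition shS (p : P) := shift_mul (-1) (repS u p).
Definition shT (q : Q) := shift_mul 1 (repT u q).
Definition shsigma (r : R) := shift_mul 0 (repsigma u r).
Lemma shSB : zmod_morphism shS.
Proof. by move=> x y; rewrite /shS raddfB shift_mulB. Qed.
Lemma shTB : zmod_morphism shT.
Proof. by move=> x y; rewrite /shT raddfB shift_mulB. Qed.
Lemma shsigmaB : zmod_morphism shsigma.
Proof. by move=> x y; rewrite /shsigma raddfB shift_mulB. Qed.
Lemma shsigmaM : {morph shsigma : x y / x ∙ y}.
Proof. by move=> x y; rewrite /shsigma rmM -shift_mulM addr0. Qed.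
HB.instance Definition _ := GRing.isZmodMorphism.Build P (zendo V) shS shSB.
HB.instance Definition _ := GRing.isZmodMorphism.Build Q (zendo V) shT shTB.
HB.instance Definition _ := GRing.isZmodMorphism.Build R (zendo V) shsigma shsigmaB.
HB.instance Definition _ := isMultiplicative.Build R (zendo V) shsigma shsigmaM.

Fact shift_rep_subproof :
  [/\ forall p r, shS (p <* r) = shS p ∙ shsigma r,
      forall r p, shS (r *> p) = shsigma r ∙ shS p,
      forall q r, shT (q <* r) = shT q ∙ shsigma r,
      forall r q, shT (r *> q) = shsigma r ∙ shT q &
      forall p q, shsigma (psi (p ⊗ q)) = shS p ∙ shT q].
Proof.
split=> [p r|r p|q r|r q|p q]; rewrite /shS /shT /shsigma -shift_mulM;
  rewrite ?addr0 ?add0r ?addNr.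
- by rewrite repS_ract.
- by rewrite repS_lact.
- by rewrite repT_ract.
- by rewrite repT_lact.
- by rewrite rep_psi.
Qed.

Definition shift_rep : covrep X (zendo V) :=
  let: And5 a b c d e := shift_rep_subproof in @CovRep _ X _ shS shT shsigma a b c d e.

Lemma shift_repS p : repS shift_rep p = shift_mul (-1) (repS u p).
Proof. by rewrite /shift_rep; case: shift_rep_subproof. Qed.
Lemma shift_repT q : repT shift_rep q = shift_mul 1 (repT u q).
Proof. by rewrite /shift_rep; case: shift_rep_subproof. Qed.
Lemma shift_repsigma r : repsigma shift_rep r = shift_mul 0 (repsigma u r).
Proof. by rewrite /shift_rep; case: shift_rep_subproof. Qed.

Lemma shift_CP J : faithful_psi_compatible X J -> CP_invariant u J ->
  CP_invariant shift_rep J.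
Proof.
move=> HJ cu x Jx; have [s Ds] := Delta_seq HJ Jx.
have := cu x Jx; rewrite Ds !repi_sum // => h.
apply: zendoP => f; apply/funext => k; rewrite zendo_sumE fct_sumE.
rewrite shift_repsigma shift_mulE -h rng_suml; apply: eq_bigr => z _.
by rewrite zendoME shift_repS shift_repT !shift_mulE mulgA opprK addrNK subr0.
Qed.

Lemma shift_repTn n (y : tpow Q n) : repTn shift_rep y = shift_mul n.+1%:Z (repTn u y).
Proof.
elim: n y => [|n IHn] y; first exact: shift_repT.
move: y; apply: (tlift_ext (g := fun y => repTn shift_rep (y : tpow Q n.+1))
  (h := fun y => shift_mul n.+2%:Z (repTn u (y : tpow Q n.+1)))).
- by move=> y z; rewrite raddfB.
- by move=> y z; rewrite raddfB shift_mulB.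
- by move=> q y; rewrite !repTn_tens IHn shift_repT -shift_mulM -intS.
Qed.

End ShiftRep.

Lemma rep_factor_repTn (R : rngType) (X : rsystem R) (O B : rngType)
    (u : covrep X O) (v : covrep X B) (eta : {rngmorphism O -> B}) n
    (y : tpow (sysQ X) n) : rep_factor u v eta -> eta (repTn u y) = repTn v y.
Proof.
move=> uv; have [_ eT _] := uv; elim: n y => [|n IHn] y; first exact: eT.
move: y; apply: (tlift_ext (g := fun y => eta (repTn u (y : tpow (sysQ X) n.+1)))
  (h := fun y => repTn v (y : tpow (sysQ X) n.+1))).
- by move=> y z; rewrite !raddfB.
- by move=> y z; rewrite raddfB.
- by move=> q y; rewrite !repTn_tens rmM IHn -eT.
Qed.

Section SimpleL.
Variables (R : rngType) (X : rsystem R) (FS : condition_FS X) (J : set R).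
Variables (HJ : faithful_psi_compatible X J).
Variables (O : rngType) (u : covrep X O) (HO : is_CP_ring J u).
Hypothesis sO : simple_rng O.
Local Notation P := (sysP X).
Local Notation Q := (sysQ X).
Local Notation S := (repS u).
Local Notation T := (repT u).
Local Notation sigma := (repsigma u).

Let gen : smallest (@subrng O)
  (range (repsigma u) `|` range (repS u) `|` range (repT u)) = setT.
Proof. by case: HO. Qed.
Let sinj : injective sigma. Proof. by case: HO. Qed.
Let cpu : CP_invariant u J. Proof. by case: HO. Qed.

Variables (I : set R) (n : nat) (eta : R -> tpow Q n).
Hypothesis iI : is_ideal I.
Hypothesis IJ : I `<=` J.
Hypothesis Iinv : psi_invariant X I.
Hypothesis etaD : forall x y, I x -> I y -> eta (x + y) = eta x + eta y.
Hypothesis etaM : forall r x, I x -> eta (r ∙ x) = r *> eta x /\ eta (x ∙ r) = eta x <* r.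
Hypothesis eta_inj : forall x y, I x -> I y -> eta x = eta y -> x = y.
Hypothesis eta_cyc : forall p x q, I x ->
  tcontract p (tappend (eta x) q) = eta (psi ((p <* x) ⊗ q)).
Variables (x0 : R).
Hypothesis Ix0 : I x0.
Hypothesis x00 : x0 <> 0.

Local Notation tau x := (repTn u (eta x)).

Let I0 : I 0. Proof. exact: (ideal_zsub iI).1. Qed.

Let eta0 : eta 0 = 0.
Proof. by apply: (addrI (eta 0)); rewrite -etaD // !addr0. Qed.

Let ITS y : I y -> TSspan u (sigma y).
Proof. by move=> Iy; exact: (CP_TSspan FS HJ cpu (IJ Iy)). Qed.

Let tau_sum (K : eqType) (s : seq K) (F : K -> R) : (forall z, I (F z)) ->
  tau (\sum_(z <- s) F z) = \sum_(z <- s) tau (F z).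
Proof.
move=> IF; elim: s => [|z s IHs]; first by rewrite !big_nil eta0 raddf0.
rewrite !big_cons etaD ?(repTn_morph u n).1 ?IHs //.
by apply: (zsubgroup_sum (ideal_zsub iI)).
Qed.

Let tau_compress p x q : I x -> S p ∙ tau x ∙ T q = tau (psi ((p <* x) ⊗ q)).
Proof. by move=> Ix; rewrite -eta_cyc // -repTn_contract repTn_append mulgA. Qed.

Let tau_sigmal r x : I x -> tau (r ∙ x) = sigma r ∙ tau x.
Proof. by move=> Ix; rewrite (etaM r Ix).1 (repTn_morph u n).2. Qed.
Let tau_sigmar r x : I x -> tau (x ∙ r) = tau x ∙ sigma r.
Proof. by move=> Ix; rewrite (etaM r Ix).2 repTn_ract. Qed.

Lemma annihilator0 c : (forall b y, I y -> c ∙ b ∙ sigma y = 0) -> c = 0.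
Proof.
pose N := [set c : O | forall b y, I y -> c ∙ b ∙ sigma y = 0].
have iN : is_ideal N.
  split; first split=> [b y _|a b ha hb d y Iy]; rewrite ?rng0l // ?rngBl.
  - by rewrite ha // hb // subrr.
  - by move=> r a ha b y Iy; rewrite -!mulgA (mulgA a) ha // rng0r.
  - by move=> a r ha b y Iy; rewrite -(mulgA a) ha.
move=> hc; have : N c by [].
have [->//|NT] := sO iN; case: x00; apply: sinj; rewrite raddf0.
have [e eTS <-] := lunital1 FS (TSspan_lunital (ITS Ix0)).
have [s ->] := TSspan_seq eTS; rewrite rng_suml big1 // => z _.
have hN : N (T z.1) by rewrite NT.
exact: hN.
Qed.

(** As sigma(I) is contained in T(Q)S(P), nothing is lost by testing an
   element on T(Q) only. *)
Lemma eq0_on_T c : (forall q, c ∙ T q = 0) -> c = 0.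
Proof.
move=> hc; apply: annihilator0 => b.
move: b; apply: (gen_ind FS gen (A := fun b => forall y, I y -> c ∙ b ∙ sigma y = 0)).
- split=> [y Iy|a b ha hb y Iy]; first by rewrite rng0r rng0l.
  by rewrite rngBr rngBl ha // hb // subrr.
- move=> r y Iy; rewrite -mulgA -rmM.
  have [s ->] := TSspan_seq (ITS (idealMl r iI Iy)).
  by rewrite rng_sumr big1 // => z _; rewrite mulgA hc rng0l.
- by move=> q b _ y Iy; rewrite mulgA hc !rng0l.
- move=> p b hb y Iy.
  have [s hs] := fs_unitP FS [:: p <* y].
  rewrite -!mulgA -repS_ract -(hs (p <* y)) ?mem_head // raddf_sum !rng_sumr big1 // => z _.
  by rewrite repS_lact !mulgA hb ?rng0l //; exact: Iinv.
Qed.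

(** The factor T(q) passes from the right of sigma(x) and tau(x) to the left
   with the same coefficients, which is the source of [tau_central]. *)
Lemma tau_T x q : I x -> exists s : seq (Q * P),
  sigma x ∙ T q = \sum_(z <- s) T z.1 ∙ sigma (psi ((z.2 <* x) ⊗ q)) /\
  tau x ∙ T q = \sum_(z <- s) T z.1 ∙ tau (psi ((z.2 <* x) ⊗ q)).
Proof.
move=> Ix; have [|e eTS he] := @lunital_seq _ _ FS _ u _ [:: true; false]
  (fun b : bool => if b then sigma x ∙ T q else tau x ∙ T q).
  move=> [] _.
    by have := TSspan_lunital (ITS Ix); exact: lunitalMr.
  rewrite -repTn_append.
  by have [lu _ _] := homog_unital (homogTn1 FS u (tappend (eta x) q)); exact: lu.
have [s es] := TSspan_seq eTS; exists s; split.
- rewrite -(he true) // es rng_suml; apply: eq_bigr => z _.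
  by rewrite rep_psi repS_ract !mulgA.
- rewrite -(he false) // es rng_suml; apply: eq_bigr => z _.
  by rewrite -tau_compress // !mulgA.
Qed.

(** For tau the two sides are compared on T(Q) only: nothing says directly that
   tau(y) ends with an S(p). *)
Lemma tau_S p y : I y -> exists s : seq (P * Q),
  S p ∙ sigma y = \sum_(z <- s) sigma (psi ((p <* y) ⊗ z.2)) ∙ S z.1 /\
  S p ∙ tau y = \sum_(z <- s) tau (psi ((p <* y) ⊗ z.2)) ∙ S z.1.
Proof.
move=> Iy; have [s /(_ _ (mem_head _ _)) hs] := fs_unitP FS [:: p <* y].
exists s; split.
  rewrite -repS_ract -{1}hs raddf_sum; apply: eq_bigr => z _.
  by rewrite repS_lact.
apply/eqP; rewrite -subr_eq0; apply/eqP/eq0_on_T => q.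
rewrite rngBl tau_compress // rng_suml; apply/eqP; rewrite subr_eq0; apply/eqP.
transitivity (\sum_(z <- s) tau (psi ((p <* y) ⊗ z.2) ∙ psi (z.1 ⊗ q))); last first.
  by apply: eq_bigr => z _; rewrite -mulgA -rep_psi tau_sigmar //; exact: Iinv.
rewrite -tau_sum => [|z]; last by apply: idealMr => //; exact: Iinv.
congr (tau _); rewrite -{1}hs tens_suml.
rewrite (big_morph _ (@psiD _ X) (psi0 X)).
by apply: eq_bigr => z _; rewrite psi_lact.
Qed.

(** tau behaves like sigma multiplied by a central unit c of degree n + 1. No
   such c need exist in O; what remains of c sigma(x) b sigma(y) =
   sigma(x) b c sigma(y) is this identity, and its proof moves the factors of
   b out one by one. *)
Lemma tau_central b x y : I x -> I y -> tau x ∙ b ∙ sigma y = sigma x ∙ b ∙ tau y.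
Proof.
move: b x y; apply: (gen_ind FS gen (A := fun b => forall x y, I x -> I y ->
  tau x ∙ b ∙ sigma y = sigma x ∙ b ∙ tau y)).
- split=> [x y _ _|a b ha hb x y Ix Iy]; first by rewrite !rng0r !rng0l.
  by rewrite !rngBr !rngBl ha // hb.
- move=> r x y Ix Iy.
  by rewrite -(tau_sigmar r Ix) -(tau_sigmar y (idealMr r iI Ix)) -rmM -tau_sigmal.
- move=> q b hb x y Ix Iy; have [s [sE tE]] := tau_T q Ix.
  rewrite !mulgA sE tE !rng_suml; apply: eq_bigr => z _.
  by rewrite -!mulgA; congr (_ ∙ _); rewrite !mulgA; apply: hb => //; exact: Iinv.
- move=> p b hb x y Ix Iy; have [s [sE tE]] := tau_S p Iy.
  rewrite -!mulgA sE tE !rng_sumr; apply: eq_bigr => z _.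
  by rewrite !mulgA; congr (_ ∙ _); apply: hb => //; exact: Iinv.
Qed.

(** The graph of the multiplication by c. It is a sub-bimodule of O x O, so its
   two projections are ideals of O, and both are O by simplicity. *)
Definition cgraph (b c : O) := forall b' y, I y -> c ∙ b' ∙ sigma y = b ∙ b' ∙ tau y.

Lemma cgraphB b b' c c' : cgraph b c -> cgraph b' c' -> cgraph (b - b') (c - c').
Proof. by move=> h h' d y Iy; rewrite !rngBl h // h'. Qed.
Lemma cgraph0 : cgraph 0 0.
Proof. by move=> d y _; rewrite !rng0l. Qed.
Lemma cgraphMl a b c : cgraph b c -> cgraph (a ∙ b) (a ∙ c).
Proof. by move=> h d y Iy; rewrite -!mulgA (mulgA c) h // !mulgA. Qed.
Lemma cgraphMr a b c : cgraph b c -> cgraph (b ∙ a) (c ∙ a).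
Proof. by move=> h d y Iy; rewrite -(mulgA c) h // !mulgA. Qed.
Lemma cgraph_tau x : I x -> cgraph (sigma x) (tau x).
Proof. by move=> Ix b y Iy; exact: tau_central. Qed.

Lemma cgraph_total b : exists c, cgraph b c.
Proof.
suff E : [set b | exists c, cgraph b c] = setT by have : [set: O] b by []; rewrite -E.
apply: (simple_ideal (x := sigma x0) sO).
- split; first split=> [|a a' [c h] [c' h']].
  + by exists 0; exact: cgraph0.
  + by exists (c - c'); exact: cgraphB.
  + by move=> r a [c h]; exists (r ∙ c); exact: cgraphMl.
  + by move=> a r [c h]; exists (c ∙ r); exact: cgraphMr.
- by exists (tau x0); exact: cgraph_tau.
- by move=> s0; apply: x00; apply: sinj; rewrite raddf0.
Qed.

Lemma cgraph_total_inv c : exists b, cgraph b c.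
Proof.
suff E : [set c | exists b, cgraph b c] = setT by have : [set: O] c by []; rewrite -E.
apply: (simple_ideal (x := tau x0) sO).
- split; first split=> [|a a' [d h] [d' h']].
  + by exists 0; exact: cgraph0.
  + by exists (d - d'); exact: cgraphB.
  + by move=> r a [d h]; exists (r ∙ d); exact: cgraphMl.
  + by move=> a r [d h]; exists (d ∙ r); exact: cgraphMr.
- by exists (sigma x0); exact: cgraph_tau.
- move=> t0; apply: x00; apply: eta_inj => //; rewrite eta0.
  by apply: (repTn_inj FS sinj); rewrite t0 raddf0.
Qed.

Lemma cgraph_sigma_tau b c x : I x -> cgraph b c -> sigma x ∙ c = tau x ∙ b.
Proof.
move=> Ix h; apply/eqP; rewrite -subr_eq0; apply/eqP/annihilator0 => d y Iy.
by rewrite !rngBl -!(mulgA _ _ d) tau_central // -mulgA h // !mulgA subrr.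
Qed.

(** The relation f(k) = c f(k - n - 1) makes sigma(x) and tau(x) act in the
   same way on f in the shift representation. *)
Definition periodic (f : int -> O) := forall k, cgraph (f (k - n.+1%:Z)) (f k).

Lemma periodic_ex c : exists2 f, periodic f & f 0 = c.
Proof.
have [nxt hn] := boolp.choice cgraph_total.
have [prv hp] := boolp.choice cgraph_total_inv.
(* the two-sided orbit of a value under multiplication by c; k - n - 1 has the
   quotient of k by n + 1 lowered by 1 *)
pose F (j : int) := match j with
  | Posz m => iter m nxt c | Negz m => iter m.+1 prv c end.
have hF j : cgraph (F (j - 1)) (F j).
  case: j => [[|m]|m].
  - exact: hp.
  - by rewrite intS addrC addKr; exact: hn.
  - by rewrite NegzE -opprD -PoszD addn1 -NegzE; exact: hp.
exists (fun k => F (k %/ n.+1%:Z)%Z) => [k|]; last by rewrite div0z.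
by rewrite -mulN1r addrC divzMDl // addrC; exact: hF.
Qed.

(** The elements that kill all periodic functions form an ideal, which is 0 or
   O. It contains sigma(x0) - tau(x0), and this is not 0, as one sees on a
   function supported at 0; it does not contain sigma(x0), because periodic
   functions take arbitrary values at 0. *)
Lemma simple_no_cycle : False.
Proof.
have [_ _ _ univ] := HO; have [[g ug] _] := univ _ _ (shift_CP FS HJ cpu).
have [gS gT gs] := ug.
have gsE r (f : int -> O) k : g (sigma r) f k = sigma r ∙ f k.
  by have := gs r; rewrite /= => ->; rewrite shift_repsigma shift_mulE subr0.
have gtE x (f : int -> O) k : g (tau x) f k = tau x ∙ f (k - n.+1%:Z).
  by rewrite (rep_factor_repTn _ ug) shift_repTn shift_mulE.
have stable b f : periodic f -> periodic (g b f).
  move: b f; apply: (subrng_full gen (A := fun b => forall f, periodic f -> periodic (g b f))).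
  - split; first split=> [f _ k|a b ha hb f pf k].
    + by rewrite raddf0; exact: cgraph0.
    + by rewrite raddfB; apply: cgraphB; [exact: ha|exact: hb].
    + by move=> a b ha hb f pf; rewrite rmM; apply: ha; exact: hb.
  - by move=> r f pf k; rewrite !gsE; apply: cgraphMl; exact: pf.
  - move=> p f pf k; have := gS p; rewrite /= => ->.
    by rewrite shift_repS !shift_mulE [_ - n.+1%:Z - _]addrAC; apply: cgraphMl; exact: pf.
  - move=> q f pf k; have := gT q; rewrite /= => ->.
    by rewrite shift_repT !shift_mulE [_ - n.+1%:Z - _]addrAC; apply: cgraphMl; exact: pf.
have s0 (c0 : forall c, sigma x0 ∙ c = 0) : False.
  apply: x00; apply: sinj; rewrite raddf0.
  by have [e _ <-] := runital1 FS (TSspan_runital (ITS Ix0)).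
pose K := [set b | forall f, periodic f -> g b f = 0].
have iK : is_ideal K.
  split; first split=> [f _|a b ha hb f pf]; rewrite ?raddf0 ?raddfB //.
  - by rewrite zendoBE ha // hb // subrr.
  - by move=> r a ha f pf; rewrite rmM zendoME ha // raddf0.
  - by move=> a r ha f pf; rewrite rmM zendoME ha //; exact: stable.
have [K0|KT] := sO iK.
- apply: s0 => c; have h : sigma x0 = tau x0.
    apply/eqP; rewrite -subr_eq0; apply/eqP.
    suff : K (sigma x0 - tau x0) by rewrite K0.
    move=> f pf; apply/funext => k; rewrite raddfB.
    by rewrite [LHS](_ : _ = g (sigma x0) f k - g (tau x0) f k) // gsE gtE
      (cgraph_sigma_tau Ix0 (pf k)) subrr.
  pose f (k : int) := if k == 0 then c else 0.
  have := gtE x0 f 0; rewrite -h gsE /f eqxx => ->.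
  by rewrite sub0r oppr_eq0 rng0r.
- apply: s0 => c; have [f pf <-] := periodic_ex c.
  have : K (sigma x0) by rewrite KT.
  by move=> /(_ f pf) h; rewrite -gsE h.
Qed.

End SimpleL.

Lemma simple_condition_L (R : rngType) (X : rsystem R) (FS : condition_FS X)
    (J : set R) (O : rngType) (u : covrep X O) :
  faithful_psi_compatible X J -> is_CP_ring J u -> simple_rng O ->
  condition_L X J.
Proof.
move=> HJ HO sO [I [[iI Iinv [n [eta [eD eM einj ecyc]]]] In0 IJ]].
have [x0 [Ix0 x00]] : exists x0, I x0 /\ x0 <> 0.
  apply: contrapT => h; apply: In0; apply/seteqP; split=> [x Ix|_ ->]; last first.
    exact: (ideal_zsub iI).1.
  by apply: contrapT => x0; apply: h; exists x.
apply: (simple_no_cycle FS HJ HO sO iI _ Iinv eD eM einj ecyc Ix0 x00).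
by move=> x /IJ /(_ 0 Logic.I).
Qed.

(** * The Fock representation *)

(** The unitization Z x R as an R-bimodule: the R-bimodule generated by a
   vacuum vector (1, 0) on which R acts freely. *)
Definition unitization (R : rngType) : Type := (int * R)%type.

Section Unitization.
Variable R : rngType.
Local Notation U := (unitization R).
HB.instance Definition _ := GRing.Zmodule.on U.
Implicit Types (r s : R) (m : U).

Definition ulact r m : U := (0, r *~ m.1 + r ∙ m.2).
Definition uract m r : U := (0, r *~ m.1 + m.2 ∙ r).

Let umulrzr r s k : r ∙ (s *~ k) = (r ∙ s) *~ k.
Proof. exact: (raddfMz (monoid.mul r)). Qed.
Let umulrzl r s k : (s *~ k) ∙ r = (s ∙ r) *~ k.
Proof. exact: (raddfMz (mulrr r)). Qed.
Let udE m m' : m + m' = (m.1 + m'.1, m.2 + m'.2) :> U. Proof. by []. Qed.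

Let lDl r s m : ulact (r + s) m = ulact r m + ulact s m.
Proof. by rewrite udE /ulact /= ?addr0 mulrzDl rngDl addrACA. Qed.
Let lDr r m m' : ulact r (m + m') = ulact r m + ulact r m'.
Proof. by rewrite udE /ulact /= ?addr0 mulrzDr rngDr addrACA. Qed.
Let lM r s m : ulact (r ∙ s) m = ulact r (ulact s m).
Proof. by rewrite /ulact /= mulr0z add0r rngDr umulrzr mulgA. Qed.
Let rDl m m' r : uract (m + m') r = uract m r + uract m' r.
Proof. by rewrite udE /uract /= ?addr0 mulrzDr rngDl addrACA. Qed.
Let rDr m r s : uract m (r + s) = uract m r + uract m s.
Proof. by rewrite udE /uract /= ?addr0 mulrzDl rngDr addrACA. Qed.
Let rM m r s : uract m (r ∙ s) = uract (uract m r) s.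
Proof. by rewrite /uract /= mulr0z add0r rngDl umulrzl mulgA. Qed.
Let lrA r m s : uract (ulact r m) s = ulact r (uract m s).
Proof.
by rewrite /uract /ulact /= !mulr0z !add0r rngDl rngDr umulrzl umulrzr mulgA.
Qed.
HB.instance Definition _ := @Zmodule_isBimodule.Build R U ulact uract
  lDl lDr lM rDl rDr rM lrA.

Definition vacuum : U := (1, 0).
Lemma lact_vacuum r : r *> vacuum = (0, r) :> U.
Proof. by rewrite /lact /= /ulact /= mulr1z rng0r addr0. Qed.
Lemma ract_vacuum r : vacuum <* r = (0, r) :> U.
Proof. by rewrite /ract /= /uract /= mulr1z rng0l addr0. Qed.

End Unitization.

Section QuotientEndo.
Variables (V : zmodType) (W : set V).
Hypothesis zW : zsubgroup W.

Lemma zproj0P x : zproj W x = 0 <-> W x.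
Proof. by rewrite -(raddf0 (zproj W)) zproj_eqP subr0 span_id. Qed.

Variables (f : zendo V) (fW : forall x, W x -> W (f x)).
Definition qfun (x : zquot W) : zquot W := zproj W (f (zrepr x)).

Lemma qfunE x : qfun (zproj W x) = zproj W (f x).
Proof.
apply/zproj_eqP; rewrite span_id // -raddfB; apply: fW.
have : span W (zrepr (zproj W x) - x) by apply/zproj_eqP; rewrite zreprK.
by rewrite span_id.
Qed.

Lemma qfunB : zmod_morphism qfun.
Proof.
move=> x y; rewrite -(zreprK x) -(zreprK y).
by rewrite -raddfB !qfunE !raddfB.
Qed.

Definition qendo : zendo (zquot W) := Zendo qfunB.
Lemma qendoE x : qendo (zproj W x) = zproj W (f x). Proof. exact: qfunE. Qed.

End QuotientEndo.

Lemma qendoME (V : zmodType) (W : set V) (zW : zsubgroup W) (f g : zendo V)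
    (fW : forall x, W x -> W (f x)) (gW : forall x, W x -> W (g x)) x :
  (qendo zW fW ∙ qendo zW gW) (zproj W x) = zproj W (f (g x)).
Proof. by rewrite zendoME (qendoE zW gW) qendoE. Qed.

Lemma qendoP (V : zmodType) (W : set V) (a b : zendo (zquot W)) :
  (forall x, a (zproj W x) = b (zproj W x)) -> a = b.
Proof. by move=> h; apply: zendoP => x; rewrite -(zreprK x). Qed.

Definition zseq (L : nat -> zmodType) : Type := forall n, L n.

Section Zseq.
Variable L : nat -> zmodType.
HB.instance Definition _ := gen_eqMixin (zseq L).
HB.instance Definition _ := gen_choiceMixin (zseq L).
Implicit Types f g : zseq L.

Let zsP f g : (forall n, f n = g n) -> f = g. Proof. exact: functional_extensionality_dep. Qed.
Let add f g : zseq L := fun n => f n + g n.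
Let addA : associative add. Proof. by move=> f g h; apply: zsP => n; exact: addrA. Qed.
Let addC : commutative add. Proof. by move=> f g; apply: zsP => n; exact: addrC. Qed.
Let add0 : left_id (fun n => 0) add. Proof. by move=> f; apply: zsP => n; exact: add0r. Qed.
Let addN : left_inverse (fun n => 0) (fun f n => - f n) add.
Proof. by move=> f; apply: zsP => n; exact: addNr. Qed.
HB.instance Definition _ := GRing.isZmodule.Build (zseq L) addA addC add0 addN.

Lemma zseqP f g : (forall n, f n = g n) -> f = g. Proof. exact: zsP. Qed.
Lemma zseqBE f g n : (f - g) n = f n - g n. Proof. by []. Qed.
Lemma zseq_sumE (I : Type) (s : seq I) (F : I -> zseq L) n :
  (\sum_(i <- s) F i) n = \sum_(i <- s) F i n.
Proof. by elim/big_rec2: _ => // i y z _ <-. Qed.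
End Zseq.

Section Fock.
Variables (R : rngType) (X : rsystem R) (FS : condition_FS X) (J : set R).
Hypothesis HJ : faithful_psi_compatible X J.
Local Notation P := (sysP X).
Local Notation Q := (sysQ X).

Let iJ : is_ideal J. Proof. by case: HJ => -[]. Qed.

(** The tensor powers of Q times the unitization. Starting from the unitization
   gives all levels one recursive form, and the vacuum vector makes r visible
   on level 0. *)
Fixpoint fock_level (n : nat) : bimodType R :=
  if n is n'.+1 then (Q ⊠ fock_level n' : bimodType R) else unitization R.
Local Notation L := fock_level.
Local Notation F := (zseq (fun n => L n : zmodType)).

Section Contract.
Variables (M : bimodType R) (p : P).
Definition contr : Q ⊠ M -> M := tlift (fun q (y : M) => psi (p ⊗ q) *> y).
Lemma contrE q (y : M) : contr (q ⊗ y) = psi (p ⊗ q) *> y.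
Proof. by apply: tliftE; exact: contract_balanced. Qed.
Lemma contrB : zmod_morphism contr.
Proof. by apply: tliftB; exact: contract_balanced. Qed.
HB.instance Definition _ := GRing.isZmodMorphism.Build (Q ⊠ M) M contr contrB.
Lemma contr_ract t r : contr (t <* r) = contr t <* r.
Proof.
move: t; apply: (tlift_ext (g := fun t => contr (t <* r)) (h := fun t => contr t <* r)).
- by move=> x y; rewrite ractBl raddfB.
- by move=> x y; rewrite raddfB ractBl.
- by move=> q y; rewrite ract_tens !contrE lractA.
Qed.
End Contract.

Lemma contr_psi (M : bimodType R) p (q q' : Q) (y : M) :
  q' ⊗ contr p (q ⊗ y) = (q' <* psi (p ⊗ q)) ⊗ y.
Proof. by rewrite contrE tens_bal. Qed.

Definition mulJ (M : bimodType R) : set M :=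
  span [set z | exists y x, J x /\ z = y <* x].

Lemma mulJ_sub (M N : bimodType R) (f : {additive M -> N}) :
  (forall y r, f (y <* r) = f y <* r) -> forall z, mulJ z -> mulJ (f z).
Proof.
move=> hf; apply: span_morph => _ [y [x [Jx ->]]]; rewrite hf.
by apply: sub_span; exists (f y), x.
Qed.

Lemma mulJ_zsub (M : bimodType R) : zsubgroup (@mulJ M).
Proof. exact: span_zsubgroup. Qed.

Lemma mulJ_gen (M : bimodType R) (y : M) x : J x -> mulJ (y <* x).
Proof. by move=> Jx; apply: sub_span; exists y, x. Qed.

Lemma mulJ_ind (M : bimodType R) (A : set M) : zsubgroup A ->
  (forall y x, J x -> A (y <* x)) -> forall z, mulJ z -> A z.
Proof. by move=> zA hA; apply: span_sub => // _ [y [x [Jx ->]]]; exact: hA. Qed.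

(** The sequences that are divided out. On level 0, sigma(x) multiplies by x and
   pi(Delta(x)) vanishes; on the other levels they agree. Sequences supported
   on finitely many levels have to go to make them equal, and only those with
   values in MJ may go, or they would also become equal for x outside J. *)
Definition fock_null : set F :=
  [set f | (forall n, mulJ (f n)) /\ exists N, forall n, (N <= n)%N -> f n = 0].

Lemma fock_null_zsub : zsubgroup fock_null.
Proof.
split=> [|f g [hf [N Nf]] [hg [N' Ng]]].
  by split=> [n|]; [exact: (mulJ_zsub _).1|by exists 0%N].
split=> [n|]; first exact: (mulJ_zsub _).2.
exists (maxn N N') => n; rewrite geq_max => /andP [Nn N'n].
by rewrite zseqBE Nf // Ng // subrr.
Qed.

Fact fockS_proof p : zmod_morphism (fun f : F => (fun n => contr p (f n.+1)) : F).
Proof. by move=> f g; apply: zseqP => n; rewrite [RHS]zseqBE -contrB. Qed.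
Definition fockS p : zendo F := Zendo (fockS_proof p).

Fact fockT_proof q : zmod_morphism
  (fun f : F => (fun n => if n is n'.+1 then q ⊗ f n' : L n'.+1 else 0) : F).
Proof.
move=> f g; apply: zseqP => -[|n]; first by rewrite zseqBE subrr.
by rewrite [RHS]zseqBE -tensBr.
Qed.
Definition fockT q : zendo F := Zendo (fockT_proof q).

Fact focksigma_proof r : zmod_morphism (fun f : F => (fun n => r *> f n) : F).
Proof. by move=> f g; apply: zseqP => n; rewrite [RHS]zseqBE -lactBr. Qed.
Definition focksigma r : zendo F := Zendo (focksigma_proof r).

Lemma fockS_null p f : fock_null f -> fock_null (fockS p f).
Proof.
move=> [hf [N Nf]]; split=> [n|].
  by apply: (@mulJ_sub _ _ (contr p)); [exact: contr_ract|exact: (hf n.+1)].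
by exists N => n Nn /=; rewrite (Nf n.+1 (leqW Nn)) raddf0.
Qed.

Lemma fockT_null q f : fock_null f -> fock_null (fockT q f).
Proof.
move=> [hf [N Nf]]; split=> [[|n]|]; first exact: (mulJ_zsub _).1.
  apply: (mulJ_ind (A := fun z => mulJ (q ⊗ z : L n.+1)) _ _ (hf n)).
    split=> [|y z hy hz]; first by rewrite tens0r; exact: (mulJ_zsub _).1.
    by rewrite tensBr; exact: (mulJ_zsub _).2.
  by move=> y x Jx; rewrite -ract_tens; exact: mulJ_gen.
by exists N.+1 => -[|n] //= Nn; rewrite Nf ?tens0r.
Qed.

Lemma focksigma_null r f : fock_null f -> fock_null (focksigma r f).
Proof.
move=> [hf [N Nf]]; split=> [n|]; last by exists N => n Nn; rewrite /= Nf ?lact0.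
apply: (mulJ_ind (A := fun z => mulJ (r *> z)) _ _ (hf n)).
  split=> [|y z hy hz]; first by rewrite lact0; exact: (mulJ_zsub _).1.
  by rewrite lactBr; exact: (mulJ_zsub _).2.
by move=> y x Jx; rewrite -lractA; exact: mulJ_gen.
Qed.

Local Notation V := (zquot fock_null).
Definition fockqS p : zendo V := qendo fock_null_zsub (@fockS_null p).
Definition fockqT q : zendo V := qendo fock_null_zsub (@fockT_null q).
Definition fockqsigma r : zendo V := qendo fock_null_zsub (@focksigma_null r).

Let contrBl (M : bimodType R) p p' (t : Q ⊠ M) : contr (p - p') t = contr p t - contr p' t.
Proof.
have h p1 p2 : contr (p1 + p2) t = contr p1 t + contr p2 t.
  move: t; apply: (tlift_ext (g := contr (p1 + p2)) (h := fun t => contr p1 t + contr p2 t)).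
  - exact: contrB.
  - by move=> x y; rewrite !contrB opprD addrACA.
  - by move=> q y; rewrite !contrE tensDl psiD lactDl.
by apply: (addIr (contr p' t)); rewrite -h !addrNK.
Qed.

Lemma fockqSB : zmod_morphism fockqS.
Proof.
move=> p p'; apply: qendoP => f; rewrite zendoBE !qendoE -raddfB.
by congr zproj; apply: zseqP => n; rewrite [RHS]zseqBE -contrBl.
Qed.
Lemma fockqTB : zmod_morphism fockqT.
Proof.
move=> q q'; apply: qendoP => f; rewrite zendoBE !qendoE -raddfB.
congr zproj; apply: zseqP => -[|n]; rewrite [RHS]zseqBE /= ?subrr //.
by apply: (addIr (q' ⊗ f n)); rewrite -tensDl !addrNK.
Qed.
Lemma fockqsigmaB : zmod_morphism fockqsigma.
Proof.
move=> r r'; apply: qendoP => f; rewrite zendoBE !qendoE -raddfB.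
by congr zproj; apply: zseqP => n; rewrite [RHS]zseqBE -lactBl.
Qed.
Lemma fockqsigmaM : {morph fockqsigma : x y / x ∙ y}.
Proof.
move=> r r'; apply: qendoP => f; rewrite qendoME qendoE.
by congr zproj; apply: zseqP => n; rewrite /= lactM.
Qed.
HB.instance Definition _ := GRing.isZmodMorphism.Build P (zendo V) fockqS fockqSB.
HB.instance Definition _ := GRing.isZmodMorphism.Build Q (zendo V) fockqT fockqTB.
HB.instance Definition _ := GRing.isZmodMorphism.Build R (zendo V) fockqsigma fockqsigmaB.
HB.instance Definition _ := isMultiplicative.Build R (zendo V) fockqsigma fockqsigmaM.

Fact fock_rep_subproof :
  [/\ forall p r, fockqS (p <* r) = fockqS p ∙ fockqsigma r,
      forall r p, fockqS (r *> p) = fockqsigma r ∙ fockqS p,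
      forall q r, fockqT (q <* r) = fockqT q ∙ fockqsigma r,
      forall r q, fockqT (r *> q) = fockqsigma r ∙ fockqT q &
      forall p q, fockqsigma (psi (p ⊗ q)) = fockqS p ∙ fockqT q].
Proof.
split=> [p r|r p|q r|r q|p q]; apply: qendoP => f; rewrite qendoME qendoE;
  congr zproj; apply: zseqP => n /=.
- move: (f n.+1); apply: (tlift_ext (g := contr (p <* r)) (h := fun t => contr p (r *> t))).
  + exact: contrB.
  + by move=> x y; rewrite lactBr contrB.
  + by move=> q y; rewrite lact_tens !contrE tens_bal.
- move: (f n.+1); apply: (tlift_ext (g := contr (r *> p)) (h := fun t => r *> contr p t)).
  + exact: contrB.
  + by move=> x y; rewrite contrB lactBr.
  + by move=> q y; rewrite !contrE psi_lact lactM.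
- by case: n => // n; rewrite tens_bal.
- by case: n => [|n]; rewrite ?lact0 // [RHS]lact_tens.
- by rewrite contrE.
Qed.

Definition fock_rep : covrep X (zendo V) :=
  let: And5 a b c d e := fock_rep_subproof in @CovRep _ X _ fockqS fockqT fockqsigma a b c d e.

Lemma fock_repS p : repS fock_rep p = fockqS p.
Proof. by rewrite /fock_rep; case: fock_rep_subproof. Qed.
Lemma fock_repT q : repT fock_rep q = fockqT q.
Proof. by rewrite /fock_rep; case: fock_rep_subproof. Qed.
Lemma fock_repsigma r : repsigma fock_rep r = fockqsigma r.
Proof. by rewrite /fock_rep; case: fock_rep_subproof. Qed.

Lemma fock_sumE (s : seq (Q * P)) f :
  (\sum_(z <- s) repT fock_rep z.1 ∙ repS fock_rep z.2) (zproj fock_null f) =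
  zproj fock_null (\sum_(z <- s) fockT z.1 (fockS z.2 f)).
Proof.
rewrite zendo_sumE raddf_sum; apply: eq_bigr => z _.
by rewrite fock_repS fock_repT qendoME.
Qed.

Lemma fock_sum0 (s : seq (Q * P)) f : (\sum_(z <- s) fockT z.1 (fockS z.2 f)) 0%N = 0.
Proof. by rewrite zseq_sumE big1. Qed.

Lemma mulJ0_snd (y : L 0%N) : mulJ y -> J (y : unitization R).2.
Proof.
have [zJ Jl Jr] := iJ.
apply: (@span_sub _ _ [set y | J (y : unitization R).2]).
  split=> [|u w /= hu hw]; first exact: zJ.1.
  exact: zJ.2.
move=> _ [[k s] [x [Jx ->]]]; rewrite /= /ract /= /uract /=.
apply: zsubgroupD => //; last exact: Jl.
exact: zsubgroup_mulrz.
Qed.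

Lemma fock_CP : CP_invariant fock_rep J.
Proof.
move=> x Jx; have [s Ds] := Delta_seq HJ Jx.
rewrite Ds repi_sum //; apply: qendoP => f; rewrite fock_sumE fock_repsigma qendoE.
apply/eqP; rewrite eq_sym -subr_eq0 -raddfB; apply/eqP/(zproj0P fock_null_zsub).
have e0 n : (focksigma x f - \sum_(z <- s) fockT z.1 (fockS z.2 f)) n.+1 = 0.
  rewrite zseqBE zseq_sumE; apply/eqP; rewrite subr_eq0; apply/eqP.
  rewrite /=; move: (f n.+1); apply: (tlift_ext (g := fun t => x *> t)
    (h := fun t => \sum_(z <- s) (z.1 ⊗ contr z.2 t : L n.+1))).
  - by move=> t t'; rewrite lactBr.
  - by move=> t t'; rewrite -sumrB; apply: eq_bigr => z _; rewrite contrB tensBr.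
  - move=> q y; rewrite lact_tens.
    have -> : x *> q = \sum_(z <- s) z.1 <* psi (z.2 ⊗ q).
      by rewrite -[x *> q]/(Delta x q) Ds fct_sumE.
    by rewrite tens_suml; apply: eq_bigr => z _; rewrite contr_psi.
split=> [[|n]|]; last by exists 1%N => -[|n] // _; exact: e0.
  rewrite zseqBE fock_sum0 subr0 /=; case: (f 0%N) => k s' /=.
  have [zJ Jl Jr] := iJ; rewrite [_ *> _](_ : _ = vacuum R <* (x *~ k + x ∙ s')).
    by apply: mulJ_gen; apply: zsubgroupD => //; [exact: zsubgroup_mulrz|exact: Jr].
  by rewrite ract_vacuum.
by rewrite e0; exact: (mulJ_zsub _).1.
Qed.

Lemma fock_cov r : TSspan fock_rep (repsigma fock_rep r) -> J r.
Proof.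
move=> /TSspan_seq [s rs].
pose f : F := fun n => if n is 0 then vacuum R : L 0%N else 0.
have := fock_sumE s f; rewrite -rs fock_repsigma qendoE => /eqP.
rewrite -subr_eq0 -raddfB => /eqP /(zproj0P fock_null_zsub) [/(_ 0%N) + _].
by rewrite zseqBE fock_sum0 subr0 /= lact_vacuum => /mulJ0_snd.
Qed.

(** The elements psi(p r ⊗ q) inherit both hypotheses, the second one for the
   level below, so they vanish by induction. Then rQ = 0, and r = 0 because r
   lies in the faithful ideal J, as its action on the vacuum shows. *)
Lemma fock_kill N r : (forall n (y : L n), mulJ (r *> y)) ->
  (forall y : L N, r *> y = 0) -> r = 0.
Proof.
elim: N r => [|N IHN] r hJ h0.
  by have := h0 (vacuum R); rewrite lact_vacuum => -[].
have Jr : J r by have := mulJ0_snd (hJ 0%N (vacuum R)); rewrite lact_vacuum.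
have key p q n (y : L n) : psi ((p <* r) ⊗ q) *> y = contr p (r *> (q ⊗ y) : L n.+1).
  by rewrite lact_tens contrE tens_bal.
have Dr : Delta r = (0 : Q -> Q).
  apply: funext => q; apply: (psi_nondegQ FS) => p; rewrite -tens_bal; apply: IHN.
    move=> n y; rewrite key; apply: (@mulJ_sub _ _ (contr p)); first exact: contr_ract.
    exact: (hJ n.+1).
  by move=> y; rewrite key h0 raddf0.
have [_ hk] := HJ; have : [set (0 : R)] r by rewrite -hk.
by [].
Qed.

(** If sigma(r) = 0 then r kills all levels from some N on: otherwise a sequence
   of vectors that r does not kill would have an image of infinite support. *)
Lemma fock_inj : injective (repsigma fock_rep).
Proof.
apply: rker_inj; apply/seteqP; split=> [r /= sr|_ ->]; last by rewrite /= raddf0.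
have hr f : fock_null (focksigma r f).
  apply/(zproj0P fock_null_zsub).
  by rewrite -(qendoE fock_null_zsub (@focksigma_null r)) -[qendo _ _]/(fockqsigma r)
    -fock_repsigma sr.
have [N hN] : exists N, forall y : L N, r *> y = 0.
  (* on each level where this is possible, a vector that r does not kill *)
  have [_ [N /(_ N (leqnn _)) hN]] := hr (fun n => xget 0 [set y : L n | r *> y <> 0]).
  exists N => y; apply: contrapT => hy.
  by move: hN; rewrite /=; case: xgetP => [z _ hz /hz|/(_ y)].
apply: (fock_kill (N := N)) => // n y.
by have [/(_ n) + _] := hr (dfwith (fun n => 0 : L n) y); rewrite /= dfwith_in.
Qed.

End Fock.

(** * Pulling back and pushing forward representations *)

Section QuotientRep.
Variables (R : rngType) (X : rsystem R) (FS : condition_FS X).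
Variables (I : set R) (iI : is_ideal I) (Iinv : psi_invariant X I).
Local Notation P := (sysP X).
Local Notation Q := (sysQ X).
Local Notation XI := (quot_system FS iI Iinv).
Local Notation pQ := (projQ FS iI Iinv : Q -> sysQ XI).
Local Notation pP := (projP FS iI Iinv : P -> sysP XI).
Local Notation pR := (rproj iI : R -> rquot iI).

Variables (B : rngType) (w : covrep XI B).

Let wS p := repS w (pP p).
Let wT q := repT w (pQ q).
Let wsigma r := repsigma w (pR r).
Let wSB : zmod_morphism wS. Proof. by move=> x y; rewrite /wS !raddfB. Qed.
Let wTB : zmod_morphism wT. Proof. by move=> x y; rewrite /wT !raddfB. Qed.
Let wsigmaB : zmod_morphism wsigma. Proof. by move=> x y; rewrite /wsigma !raddfB. Qed.
Let wsigmaM : {morph wsigma : x y / x ∙ y}.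
Proof. by move=> x y; rewrite /wsigma !rmM. Qed.
HB.instance Definition _ := GRing.isZmodMorphism.Build P B wS wSB.
HB.instance Definition _ := GRing.isZmodMorphism.Build Q B wT wTB.
HB.instance Definition _ := GRing.isZmodMorphism.Build R B wsigma wsigmaB.
HB.instance Definition _ := isMultiplicative.Build R B wsigma wsigmaM.

Fact pullback_subproof :
  [/\ forall p r, wS (p <* r) = wS p ∙ wsigma r,
      forall r p, wS (r *> p) = wsigma r ∙ wS p,
      forall q r, wT (q <* r) = wT q ∙ wsigma r,
      forall r q, wT (r *> q) = wsigma r ∙ wT q &
      forall p q, wsigma (psi (p ⊗ q)) = wS p ∙ wT q].
Proof.
rewrite /wS /wT /wsigma; split=> [p r|r p|q r|r q|p q].
- by rewrite projP_ract repS_ract.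
- by rewrite projP_lact repS_lact.
- by rewrite projQ_ract repT_ract.
- by rewrite projQ_lact repT_lact.
- by rewrite -(proj_psi FS iI Iinv) rep_psi.
Qed.

Definition pullback_rep : covrep X B :=
  let: And5 a b c d e := pullback_subproof in @CovRep _ X _ wS wT wsigma a b c d e.

Lemma pullback_repS p : repS pullback_rep p = repS w (pP p).
Proof. by rewrite /pullback_rep; case: pullback_subproof. Qed.
Lemma pullback_repT q : repT pullback_rep q = repT w (pQ q).
Proof. by rewrite /pullback_rep; case: pullback_subproof. Qed.
Lemma pullback_repsigma r : repsigma pullback_rep r = repsigma w (pR r).
Proof. by rewrite /pullback_rep; case: pullback_subproof. Qed.

Lemma pullback_CP J J' : faithful_psi_compatible X J -> J `<=` J' ->
  CP_invariant w (pR @` J') -> CP_invariant pullback_rep J.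
Proof.
move=> HJ JJ' cw x Jx; have [s Ds] := Delta_seq HJ Jx.
rewrite Ds repi_sum // pullback_repsigma -cw; last by exists x => //; exact: JJ'.
have -> : Delta (pR x) = \sum_(z <- [seq (pQ z.1, pP z.2) | z <- s]) thetaQ z.1 z.2.
  apply/funext => q; have [q0 <-] := projQ_surj q.
  rewrite fct_sumE big_map [LHS](esym (projQ_lact FS iI Iinv x q0)) -[x *> q0]/(Delta x q0) Ds.
  rewrite fct_sumE raddf_sum; apply: eq_bigr => z _.
  by rewrite /thetaQ [LHS]projQ_ract -(proj_psi FS iI Iinv).
rewrite (repi_sum _ (@quot_FS _ _ FS _ iI Iinv)) big_map; apply: eq_bigr => z _.
by rewrite pullback_repS pullback_repT.
Qed.

End QuotientRep.

Section ImageRep.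
Variables (R : rngType) (X : rsystem R) (FS : condition_FS X).
Variables (O B : rngType) (u : covrep X O) (f : {rngmorphism O -> B}).
Local Notation P := (sysP X).
Local Notation Q := (sysQ X).

Let iS p := f (repS u p).
Let iT q := f (repT u q).
Let isigma r := f (repsigma u r).
Let iSB : zmod_morphism iS. Proof. by move=> x y; rewrite /iS !raddfB. Qed.
Let iTB : zmod_morphism iT. Proof. by move=> x y; rewrite /iT !raddfB. Qed.
Let isigmaB : zmod_morphism isigma. Proof. by move=> x y; rewrite /isigma !raddfB. Qed.
Let isigmaM : {morph isigma : x y / x ∙ y}.
Proof. by move=> x y; rewrite /isigma !rmM. Qed.
HB.instance Definition _ := GRing.isZmodMorphism.Build P B iS iSB.
HB.instance Definition _ := GRing.isZmodMorphism.Build Q B iT iTB.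
HB.instance Definition _ := GRing.isZmodMorphism.Build R B isigma isigmaB.
HB.instance Definition _ := isMultiplicative.Build R B isigma isigmaM.

Fact image_subproof :
  [/\ forall p r, iS (p <* r) = iS p ∙ isigma r,
      forall r p, iS (r *> p) = isigma r ∙ iS p,
      forall q r, iT (q <* r) = iT q ∙ isigma r,
      forall r q, iT (r *> q) = isigma r ∙ iT q &
      forall p q, isigma (psi (p ⊗ q)) = iS p ∙ iT q].
Proof.
rewrite /iS /iT /isigma; split=> *; rewrite -rmM.
- by rewrite repS_ract.
- by rewrite repS_lact.
- by rewrite repT_ract.
- by rewrite repT_lact.
- by rewrite rep_psi.
Qed.

Definition image_rep : covrep X B :=
  let: And5 a b c d e := image_subproof in @CovRep _ X _ iS iT isigma a b c d e.

Lemma image_factor : rep_factor u image_rep f.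
Proof. by rewrite /image_rep; case: image_subproof. Qed.

Lemma image_CP J : faithful_psi_compatible X J -> CP_invariant u J ->
  CP_invariant image_rep J.
Proof.
move=> HJ cu x Jx; have [iSE iTE isE] := image_factor.
have [s Ds] := Delta_seq HJ Jx.
rewrite -isE /= -(cu x Jx) Ds !repi_sum // raddf_sum; apply: eq_bigr => z _.
by rewrite -iSE -iTE /= rmM.
Qed.

End ImageRep.

(** * Simplicity *)

Section Simplicity.
Variables (R : rngType) (X : rsystem R) (FS : condition_FS X) (J : set R).
Variables (HJ : faithful_psi_compatible X J).
Variables (O : rngType) (u : covrep X O) (HO : is_CP_ring J u).
Local Notation sigma := (repsigma u).

Let gen : smallest (@subrng O)
  (range (repsigma u) `|` range (repS u) `|` range (repT u)) = setT.
Proof. by case: HO. Qed.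

(** For x outside J the Fock representation separates sigma(x) from
   T(Q)S(P), and O maps to it. *)
Lemma CP_ring_cov r : TSspan u (sigma r) -> J r.
Proof.
have [cu _ _ univ] := HO.
have [[g ug] _] := univ _ (fock_rep X J) (fock_CP FS HJ).
have [_ _ gs] := ug.
by move=> /(eta_TSspan ug) h; apply: (fock_cov HJ); rewrite -gs.
Qed.

Lemma proper_ideal_nonzero (K : set O) (iK : is_ideal K) : K <> setT ->
  nonzero_rep (image_rep u (rproj iK)).
Proof.
move=> KT [S0 T0 s0]; apply: KT.
have [hS hT hs] := image_factor u (rproj iK).
have hK b : rproj iK b = 0 -> K b.
  by move/rproj_eq0.
have [zK Kl Kr] := iK.
rewrite -subTset => b _; move: b; apply: (subrng_full gen).
- by split=> // x y _; exact: Kl.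
- by move=> r; apply: hK; apply: etrans (hs r) (s0 r).
- by move=> p; apply: hK; apply: etrans (hS p) (S0 p).
- by move=> q; apply: hK; apply: etrans (hT q) (T0 q).
Qed.

(** If O itself meets sigma(R) in 0 only, then sigma vanishes, and all generators
   with it. *)
Lemma simple_sigma_IIP : simple_rng O -> ideal_intersection_property (range sigma).
Proof.
move=> sO K iK Ks; have [//|KT] := sO K iK.
have s0 r : sigma r = 0.
  have : (K `&` range sigma) (sigma r) by split; [rewrite KT|exists r].
  by rewrite Ks.
apply/seteqP; split=> [b _|_ ->]; last exact: (ideal_zsub iK).1.
move: b; apply: (subrng_full gen) => [|r|p|q] /=.
- by split=> [|x y -> ->]; [exact: zsubgroup_set0|rewrite /= rng0r].
- exact: s0.
- exact: repS_eq0.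
- exact: repT_eq0.
Qed.

(** A T-pair (I, J') is realized by the Fock representation of the quotient
   system, pulled back to X; if J is contained in J' then O maps to it, and
   this map is injective or zero. *)
Lemma simple_super_maximal : simple_rng O -> super_maximal FS J.
Proof.
move=> sO I J' [iJ' IJ' [iI [Iinv fJ']]] JJ'.
have qFS := @quot_FS _ _ FS _ iI Iinv.
pose w := fock_rep (quot_system FS iI Iinv) (rproj iI @` J').
have cw : CP_invariant w (rproj iI @` J') by exact: fock_CP.
have winj : injective (repsigma w) by exact: fock_inj.
pose v := pullback_rep w.
have cv : CP_invariant v J by exact: pullback_CP HJ JJ' cw.
have [cu sinj _ univ] := HO; have [[g ug] _] := univ _ v cv.
have [gS gT gs] := ug.
have [[I0 IB] Il Ir] := iI.
have vI r : repsigma v r = 0 <-> I r.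
  split=> [h|Ir0].
    apply/(rproj_eq0 iI); apply: winj.
    by rewrite -pullback_repsigma [LHS]h raddf0.
  by rewrite /v pullback_repsigma (rproj_eq0 iI r).2 // raddf0.
have [k0|kT] := sO _ (rker_ideal g); [left|right].
  have ginj := rker_inj k0.
  split.
    apply/seteqP; split=> [r /vI r0|_ ->] //=.
    apply: sinj; apply: ginj; apply: etrans (gs r) _.
    by rewrite [RHS](_ : _ = 0) // !raddf0.
  apply/seteqP; split=> // r J'r; apply: CP_ring_cov.
  have : TSspan w (repsigma w (rproj iI r)).
    by apply: (CP_TSspan qFS fJ' cw); exists r.
  move=> /TSspan_seq [s sE].
  have [t tE] : exists t : seq (sysQ X * sysP X),
      s = [seq (projQ FS iI Iinv z.1, projP FS iI Iinv z.2) | z <- t].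
    elim: (s) => [|[q p] s' [t ->]]; first by exists [::].
    have [q0 <-] := projQ_surj q; have [p0 <-] := projP_surj p.
    by exists ((q0, p0) :: t).
  suff -> : sigma r = \sum_(z <- t) repT u z.1 ∙ repS u z.2 by exact: TSspan_of_seq.
  apply: ginj; apply: etrans (gs r) _; rewrite pullback_repsigma sE tE big_map.
  rewrite raddf_sum; apply: eq_bigr => z _; rewrite /= rmM.
  have := gS z.2; have := gT z.1; rewrite /= => -> ->.
  by rewrite pullback_repS pullback_repT.
have IT : I = setT.
  rewrite -subTset => r _; apply/vI; apply: etrans (esym (gs r)) _.
  by have : [set x | g x = 0] (sigma r) by rewrite kT.
by split=> //; rewrite -subTset -IT.
Qed.

(** The quotient by a proper ideal is a non-zero representation, so super
   maximality makes it injective in degree zero. *)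
Lemma degree0_IIP_simple : ideal_intersection_property (degree0_part u) ->
  super_maximal FS J -> simple_rng O.
Proof.
move=> iip sm K iK; have [->|KT] := pselect (K = setT); first by right.
left; apply: iip => //.
have [cu _ _ _] := HO.
have [vinj vcov] := super_maximal_rep HJ sm (proper_ideal_nonzero (iK := iK) KT)
  (image_CP FS (rproj iK) HJ cu).
apply/seteqP; split=> [b [Kb b0]|_ ->] /=; last first.
  by split; [exact: (ideal_zsub iK).1|exact: (span_zsubgroup _).1].
apply: (homog0_inj FS (image_factor u (rproj iK)) vinj).
- by move=> r /vcov; exact: CP_TSspan HJ cu.
- exact: degree0_homog.
- exact/rproj_eq0.
Qed.

Lemma condition_L_injective (B : rngType) (v : covrep X B)
    (g : {rngmorphism O -> B}) :
  condition_L X J -> super_maximal FS J -> nonzero_rep v -> CP_invariant v J ->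
  rep_factor u v g -> injective g.
Proof.
move=> cL sm nz cv uv; have [cu sinj _ _] := HO.
have [vinj vcov] := super_maximal_rep HJ sm nz cv.
apply: rker_inj; apply/seteqP; split=> [|_ ->]; last by rewrite /= raddf0.
apply: (condition_L_ideal0 FS gen sinj CP_ring_cov (rker_ideal g)) => // a ha ga.
by apply: (homog0_inj FS uv vinj) => // r /vcov; exact: CP_TSspan HJ cu.
Qed.

End Simplicity.

Theorem theorem5p3 (R : rngType) (X : rsystem R) (FS : condition_FS X)
    (J : set R) (HJ : faithful_psi_compatible X J)
    (O : rngType) (u : covrep X O) (HO : is_CP_ring J u) :
  [<-> simple_rng O;
       ideal_intersection_property (range (repsigma u)) /\ super_maximal FS J;
       ideal_intersection_property (degree0_part u) /\ super_maximal FS J;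
       condition_L X J /\ super_maximal FS J;
       forall (B : rngType) (v : covrep X B),
         nonzero_rep v -> CP_invariant v J ->
         forall eta : {rngmorphism O -> B}, rep_factor u v eta -> injective eta].
Proof.
tfae.
- by move=> sO; split; [exact: (simple_sigma_IIP FS HO)|exact: (simple_super_maximal HJ HO)].
- move=> [iip sm]; split=> // K iK K0; apply: iip => //.
  apply/seteqP; split=> [b [Kb [r _ rb]]|_ ->].
    by rewrite -K0; split=> //; apply: sub_span; left; exists r.
  by split; [exact: (ideal_zsub iK).1|exists 0; rewrite ?raddf0].
- move=> [iip sm]; split=> //.
  by apply: (simple_condition_L FS HJ HO); exact: (degree0_IIP_simple HJ HO iip sm).
- by move=> [cL sm] B v nz cv g uv; exact: (condition_L_injective HJ HO cL sm nz cv uv).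
- move=> h K iK; have [->|KT] := pselect (K = setT); [by right|left].
  have [cu _ _ _] := HO.
  have inj := h _ _ (proper_ideal_nonzero HO (iK := iK) KT) (image_CP FS (rproj iK) HJ cu)
    (rproj iK) (image_factor u (rproj iK)).
  apply/seteqP; split=> [b Kb|_ ->] /=; last exact: (ideal_zsub iK).1.
  by apply: inj; rewrite raddf0; apply/rproj_eq0.
Qed.
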